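(* Let $G$ and $H$ be infinite finitely generated groups. If $G$ and $H$ have the Haagerup property, then so does $G \wr H$. Moreover, the compression bounds can be taken as follows: suppose $\psi : H \to L_2$ and $\phi : G \to L_2$ are equivariant maps and $\rho_1,\rho_2,\tau_1,\tau_2$ are increasing unbounded functions such that $$\rho_1(d_H(x,y)) \leq \|\psi(x) - \psi(y)\|_2 \leq \rho_2(d_H(x,y)) \quad \text{for all } x,y\in H,$$ $$\tau_1(d_G(x,y)) \leq \|\phi(x) - \phi(y)\|_2 \leq \tau_2(d_G(x,y)) \quad \text{for all } x,y\in G.$$ Then there are an equivariant map $\Phi : G \wr H \to L_2$ and constants $c,C>0$ such that for all $(f,x),(g,y)\in G\wr H$, $$c\,\nu_1\big(d_{G\wr H}((f,x),(g,y))\big) \le \|\Phi(f,x) - \Phi(g,y)\|_2 \le C\,\nu_2\big(d_{G\wr H}((f,x),(g,y))\big),$$ where, for nonnegative integers $t$, $\nu_2(t) = t^{1/2}$ and $$\nu_1(t) = \left[\min\left\{ \sqrt{\min\left\{ \sum_{k=1}^n \rho_1(s_k) : s_k \geq 0,\ \sum_{k=1}^n s_k = t_1 \right\}} + \sum_{j=2}^m \tau_1(t_j) \;:\; t_j \geq 0,\ \sum_{j=1}^m t_j = t \right\}\right]^{1/2}.$$ Here the outer minimum is over all $m\ge 1$ and all nonnegative integers $t_1,\dots,t_m$ with sum $t$, and the inner minimum is over all $n \ge 1$ and all nonnegative integers $s_1,\dots,s_n$ with sum $t_1$.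
   Context: $L_p$ denotes $L_p([0,1])$. For a group $\Gamma$ and a Banach space $X$, a map $f:\Gamma\to X$ is called equivariant if there is an action $\alpha:\Gamma\to \mathrm{Isom}(X)$ of $\Gamma$ on $X$ by affine isometries with $f(g)=\alpha(g)\cdot 0$ for all $g\in\Gamma$. It is metrically proper if $\inf\{\|f(g)-f(h)\|_X : d_\Gamma(g,h)\ge t\}\to\infty$ as $t\to\infty$, where $d_\Gamma$ is the word metric. A finitely generated group $\Gamma$ has the Haagerup property if there exists a metrically proper equivariant map $\Gamma\to L_2$. Since word metrics take only integer values, the bounding functions are viewed as increasing unbounded functions from the nonnegative integers to $[0,\infty)$, with $0$ mapped to $0$. Wreath product: $G \wr H$ is the group of all pairs $(f,x)$ where $x \in H$ and $f : H \to G$ is finitely supported (i.e. $f(z)=e_G$ for all but finitely many $z\in H$), with product $(f,x)\cdot(g,y) = (z \mapsto f(z)g(x^{-1}z),\, xy)$. Fix finite generating sets $S$ of $G$ and $T$ of $H$; then $G\wr H$ is generated by $\{(\mathbf{e},t): t \in T\} \cup \{(\delta_s,e_H) : s \in S\}$, where $\mathbf{e}$ is the function constantly equal to $e_G$ and $\delta_s$ has value $s$ at $e_H$ and $e_G$ elsewhere. $d_G,d_H,d_{G\wr H}$ are the left-invariant word metrics for these generating sets. *)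

(* Defs.v *)
From HB Require Import structures.
From mathcomp Require Import all_boot all_order all_algebra.
From mathcomp Require Import all_classical all_reals all_analysis.
From mathcomp Require Import measurable_realfun ess_sup_inf.
Set Implicit Arguments.
Unset Strict Implicit.
Unset Printing Implicit Defensive.
Import Order.TTheory GRing.Theory Num.Theory.
Import numFieldNormedType.Exports.
Local Open Scope classical_set_scope.
Local Open Scope ring_scope.
Local Open Scope quotient_scope.

(* The library provides the carrier [LspaceType] of a.e. classes with finite
   Lp-norm; this section equips it with its normed module structure. *)
Section Lspace_normedModType.
Context d (T : measurableType d) (R : realType).
Variables (mu : {measure set T -> \bar R}) (p : \bar R) (p1 : (1 <= p)%E).

Local Notation Lsp := (LspaceType mu p1).
Local Notation Lf := (LfunType mu p1).

HB.instance Definition _ := gen_eqMixin Lsp.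
HB.instance Definition _ := gen_choiceMixin Lsp.

Lemma ae_eq_Lnorm (f g : T -> R) :
    measurable_fun setT f -> measurable_fun setT g -> f = g %[ae mu] ->
  ('N[mu]_p[EFin \o f] = 'N[mu]_p[EFin \o g])%E.
Proof.
move=> mf mg fg; rewrite unlock /Lnorm.
case: p p1 => [r r1|_|//]; last first.
  case: ifPn => // _; apply: eq_ess_sup.
  by apply: filterS fg => x /(_ I)/= ->.
congr (_ `^ _)%E; apply: ge0_ae_eq_integral => //.
  apply/measurable_EFinP.
  apply: (@measurableT_comp _ _ _ _ _ _ (@powR R ^~ r)) => //.
  exact: measurableT_comp.
  apply/measurable_EFinP.
  apply: (@measurableT_comp _ _ _ _ _ _ (@powR R ^~ r)) => //.
  exact: measurableT_comp.
- by move=> x _; exact: poweR_ge0.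
- by move=> x _; exact: poweR_ge0.
- by apply: filterS fg => x /(_ I)/= -> _.
Qed.

Let lift_Lfun (u : Lsp) : (u : T -> R) \in Lfun mu p.
Proof.
rewrite inE; apply/andP; split; rewrite inE/=; last exact: Lebesgue_finite.
exact: (@measurable_funPT _ _ _ (measurableTypeR R) (repr (u : {mfun_ mu, T >-> measurableTypeR R}))).
Qed.


Definition Lspace_rep (u : Lsp) : Lf := Lfun_Sub p1 (lift_Lfun u).


Lemma Lfun_in_mfun (f : Lf) :
  (f : T -> measurableTypeR R) \in @mfun _ _ T (measurableTypeR R).
Proof. by rewrite inE; exact: (@measurable_funPT _ _ _ _ f). Qed.

Local Notation mfT := {mfun T >-> measurableTypeR R}.

Let aepi (f : Lf) : {mfun_ mu, T >-> measurableTypeR R} :=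
  \pi_({mfun_ mu, T >-> measurableTypeR R}) (mfun_Sub (Lfun_in_mfun f) : mfT).

Let aepiP (f : Lf) : (aepi f : T -> R) = f %[ae mu].
Proof.
rewrite /aepi /aqEqMfun_to_fun.
case: piP => g /eqmodP /= /asboolP.
by apply: filterS => x /= h ?; rewrite -h.
Qed.

Let aepi_fin (f : Lf) : finite_norm mu p (aepi f : T -> R).
Proof.
rewrite /finite_norm (@ae_eq_Lnorm _ f).
- exact: Lfunction_finite.
- exact: (@measurable_funPT _ _ _ (measurableTypeR R) (repr (aepi f))).
- exact: measurable_funPT.
- exact: aepiP.
Qed.

Definition Lspace_pi (f : Lf) : Lsp :=
  LebesgueSpace.Pack (LebesgueSpace.Class (isFinLebesgue.Build _ _ _ mu p p1 _ (aepi_fin f))).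

Lemma Lspace_piP (f : Lf) : (Lspace_pi f : T -> R) = f %[ae mu].
Proof. exact: aepiP. Qed.

Lemma Lspace_eq (u v : Lsp) : (u : T -> R) = v %[ae mu] -> u = v.
Proof.
case: u v => [u [[hu]]] [v [[hv]]] /= uv.
have E : u = v.
  rewrite -[u]reprK -[v]reprK; apply/eqmodP/asboolP; exact: uv.
subst v.
by rewrite (Prop_irrelevance hu hv).
Qed.

Lemma Lspace_repK : cancel Lspace_rep Lspace_pi.
Proof. by move=> u; apply: Lspace_eq; exact: Lspace_piP. Qed.

Lemma Lspace_pi_eq (f g : Lf) :
  (f : T -> R) = g %[ae mu] -> Lspace_pi f = Lspace_pi g.
Proof.
move=> fg; apply: Lspace_eq.
apply: ae_eq_trans (Lspace_piP f) _; apply: ae_eq_trans fg _.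
exact: ae_eq_sym (Lspace_piP g).
Qed.

Let Ladd (u v : Lsp) := Lspace_pi (Lspace_rep u + Lspace_rep v).
Let Lopp (u : Lsp) := Lspace_pi (- Lspace_rep u).
Let Lscale (a : R) (u : Lsp) := Lspace_pi (a *: Lspace_rep u).

Let LaddE (f g : Lf) : Ladd (Lspace_pi f) (Lspace_pi g) = Lspace_pi (f + g).
Proof.
apply: Lspace_pi_eq.
by apply: filterS2 (Lspace_piP f) (Lspace_piP g) => x fx gx _ /=; congr (_ + _); [exact: fx|exact: gx].
Qed.

Let LoppE (f : Lf) : Lopp (Lspace_pi f) = Lspace_pi (- f).
Proof.
apply: Lspace_pi_eq.
by apply: filterS (Lspace_piP f) => x fx _ /=; congr (- _); exact: fx.
Qed.

Let LscaleE a (f : Lf) : Lscale a (Lspace_pi f) = Lspace_pi (a *: f).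
Proof.
apply: Lspace_pi_eq.
by apply: filterS (Lspace_piP f) => x fx _ /=; congr (_ * _); exact: fx.
Qed.

Let LaddA : associative Ladd.
Proof.
move=> u v w; rewrite -(Lspace_repK u) -(Lspace_repK v) -(Lspace_repK w).
by rewrite !LaddE addrA.
Qed.

Let LaddC : commutative Ladd.
Proof. by move=> u v; rewrite /Ladd addrC. Qed.

Let Ladd0 : left_id (Lspace_pi 0) Ladd.
Proof. by move=> u; rewrite -(Lspace_repK u) LaddE add0r. Qed.

Let LaddN : left_inverse (Lspace_pi 0) Lopp Ladd.
Proof. by move=> u; rewrite -(Lspace_repK u) LoppE LaddE addNr. Qed.

HB.instance Definition _ := GRing.isZmodule.Build Lsp LaddA LaddC Ladd0 LaddN.

Let LscaleA a b u : Lscale a (Lscale b u) = Lscale (a * b) u.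
Proof. by rewrite -(Lspace_repK u) !LscaleE scalerA. Qed.

Let Lscale1 : left_id 1 Lscale.
Proof. by move=> u; rewrite -(Lspace_repK u) LscaleE scale1r. Qed.

Let LscaleDr : right_distributive Lscale +%R.
Proof.
move=> a u v; rewrite -(Lspace_repK u) -(Lspace_repK v).
by rewrite [_ + _]LaddE !LscaleE scalerDr [RHS]LaddE.
Qed.

Let LscaleDl u : {morph Lscale^~ u : a b / a + b}.
Proof.
move=> a b /=; rewrite -(Lspace_repK u).
by rewrite !LscaleE scalerDl [RHS]LaddE.
Qed.

HB.instance Definition _ :=
  GRing.Zmodule_isLmodule.Build R Lsp LscaleA Lscale1 LscaleDr LscaleDl.

Definition Lspace_norm (u : Lsp) : R := fine ('N[mu]_p[EFin \o u])%E.

Let Lnorm_pi (f : Lf) :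
  Lspace_norm (Lspace_pi f) = fine ('N[mu]_p[EFin \o f])%E.
Proof.
rewrite /Lspace_norm; congr fine; apply: ae_eq_Lnorm.
- exact: (@measurable_funPT _ _ _ (measurableTypeR R) (repr (aepi f))).
- exact: measurable_funPT.
- exact: Lspace_piP.
Qed.

Let LnormD u v : Lspace_norm (u + v) <= Lspace_norm u + Lspace_norm v.
Proof.
rewrite -(Lspace_repK u) -(Lspace_repK v) [X in Lspace_norm X]LaddE !Lnorm_pi.
exact: ler_LnormD.
Qed.

Let Lnorm_scale a u : Lspace_norm (a *: u) = `|a| * Lspace_norm u.
Proof.
rewrite -(Lspace_repK u) [X in Lspace_norm X]LscaleE !Lnorm_pi.
by apply: EFin_inj; rewrite EFinM !finite_norm_fine LnormZ.
Qed.

Let Lnorm_eq0 u : Lspace_norm u = 0 -> u = 0.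
Proof.
rewrite -(Lspace_repK u) Lnorm_pi => /fine_Lnormr_eq0 h.
exact: Lspace_pi_eq.
Qed.

HB.instance Definition _ :=
  Lmodule_isNormed.Build R Lsp LnormD Lnorm_scale Lnorm_eq0.

Lemma Lspace_normE (u : Lsp) : `|u| = fine ('N[mu]_p[EFin \o u])%E.
Proof. by []. Qed.

Lemma Lspace_addE (u v : Lsp) : (u + v : Lsp) = (u \+ v : T -> R) %[ae mu].
Proof. exact: Lspace_piP. Qed.

Lemma Lspace_scaleE (a : R) (u : Lsp) :
  (a *: u : Lsp) = (fun x => a * u x) %[ae mu].
Proof. exact: Lspace_piP. Qed.

End Lspace_normedModType.

Definition lebesgue01 (R : realType) :
    {measure set (measurableTypeR R) -> \bar R} :=
  mrestr (@lebesgue_measure R) (measurable_itv `[0, 1]%R).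
Arguments lebesgue01 : clear implicits.

(* Real L_2([0,1]), as classes of functions modulo equality a.e. on [0,1]. *)
Definition L2 (R : realType) : normedModType R := LspaceType2 (lebesgue01 R).

Section Wreath.
Variables G H : groupType.
Local Open Scope group_scope.

Record wreath := Wreath {
  lamps : H -> G;
  cursor : H;
  lamps_fin : finite_set [set z | lamps z <> 1] }.
Arguments Wreath : clear implicits.

Lemma wreath_eq (u v : wreath) :
  lamps u =1 lamps v -> cursor u = cursor v -> u = v.
Proof.
case: u v => [f x hf] [g y hg] /= /funext fg xy.
by move: hf hg; rewrite fg xy => hf hg; rewrite (Prop_irrelevance hf hg).
Qed.

HB.instance Definition _ := gen_eqMixin wreath.
HB.instance Definition _ := gen_choiceMixin wreath.

Fact wreath_one_fin : finite_set [set z : H | (1 : G) <> 1].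
Proof. by rewrite (_ : [set _ | _] = set0)//; apply/seteqP; split. Qed.

Definition wreath_one : wreath := Wreath (fun=> 1) 1 wreath_one_fin.

Fact wreath_mul_fin (u v : wreath) :
  finite_set [set z | lamps u z * lamps v ((cursor u)^-1 * z) <> 1].
Proof.
apply: (@sub_finite_set _ _ ([set z | lamps u z <> 1] `|`
    [set cursor u * z | z in [set z | lamps v z <> 1]])).
  move=> z /= uvz; have [uz|uz] := pselect (lamps u z = 1); last by left.
  right; exists ((cursor u)^-1 * z); last by rewrite mulVKg.
  by move: uvz; rewrite uz mul1g.
by rewrite finite_setU; split; [|apply: finite_image]; exact: lamps_fin.
Qed.

Definition wreath_mul (u v : wreath) : wreath :=
  Wreath (fun z => lamps u z * lamps v ((cursor u)^-1 * z))
    (cursor u * cursor v) (wreath_mul_fin u v).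

Fact wreath_inv_fin (u : wreath) :
  finite_set [set z | (lamps u (cursor u * z))^-1 <> 1].
Proof.
apply: (@sub_finite_set _ _
    [set (cursor u)^-1 * z | z in [set z | lamps u z <> 1]]).
  move=> z /= uz; exists (cursor u * z); last by rewrite mulKg.
  by move=> uz1; apply: uz; rewrite uz1 invg1.
by apply: finite_image; exact: lamps_fin.
Qed.

Definition wreath_inv (u : wreath) : wreath :=
  Wreath (fun z => (lamps u (cursor u * z))^-1) (cursor u)^-1 (wreath_inv_fin u).

Let wmulA : associative wreath_mul.
Proof.
move=> u v w; apply: wreath_eq => [z|] /=; last by rewrite mulgA.
by rewrite invgM !mulgA.
Qed.

Let wmul1 : left_id wreath_one wreath_mul.
Proof. by move=> u; apply: wreath_eq => [z|] /=; rewrite ?invg1 !mul1g. Qed.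

Let wmulr1 : right_id wreath_one wreath_mul.
Proof. by move=> u; apply: wreath_eq => [z|] /=; rewrite ?mulg1. Qed.

Let wmulV : left_inverse wreath_one wreath_inv wreath_mul.
Proof.
move=> u; apply: wreath_eq => [z|] /=; last by rewrite mulVg.
by rewrite invgK mulVg.
Qed.

Let wmulrV : right_inverse wreath_one wreath_inv wreath_mul.
Proof.
move=> u; apply: wreath_eq => [z|] /=; last by rewrite mulgV.
by rewrite mulVKg mulgV.
Qed.

HB.instance Definition _ :=
  isGroup.Build wreath wmulA wmul1 wmulr1 wmulV wmulrV.

Definition delta (s : G) : H -> G := fun z => if z == 1 then s else 1.

Fact delta_fin (s : G) : finite_set [set z | delta s z <> 1].
Proof.
apply: (@sub_finite_set _ _ [set 1]) => [z /=|]; last exact: finite_set1.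
by rewrite /delta; case: eqP.
Qed.

Definition wreath_base (t : H) : wreath := Wreath (fun=> 1) t wreath_one_fin.
Definition wreath_lamp (s : G) : wreath := Wreath (delta s) 1 (delta_fin s).

Definition wreath_gens (S : set G) (T : set H) : set wreath :=
  wreath_base @` T `|` wreath_lamp @` S.

End Wreath.
Arguments Wreath {G H}.

Section Word_metric.
Variable Gam : groupType.
Implicit Types S : set Gam.
Local Open Scope group_scope.

Definition spells S (n : nat) (g : Gam) := exists w : seq Gam,
  [/\ size w = n, forall s, s \in w -> S s \/ S s^-1 & \prod_(s <- w) s = g].

Definition generates S := forall g, exists n, spells S n g.

(* The default value 0 is only used when [g] is not in the subgroup generated
   by [S]. *)
Definition word_length S (g : Gam) : nat :=
  xget 0%N [set n | spells S n g /\ forall m, spells S m g -> (n <= m)%N].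

Lemma word_lengthP S g : generates S ->
  spells S (word_length S g) g /\
  forall m, spells S m g -> (word_length S g <= m)%N.
Proof.
move=> genS; rewrite /word_length; case: xgetP => [n -> //|noN].
have ex : exists n, `[< spells S n g >].
  by have [n gn] := genS g; exists n; exact/asboolP.
case: (noN (ex_minn ex)); case: ex_minnP => n /asboolP gn n_min.
by split=> // m gm; exact/n_min/asboolP.
Qed.

Definition word_dist S (g h : Gam) : nat := word_length S (g^-1 * h).

End Word_metric.

Section Equivariant_maps.
Variables (R : realType) (Gam : groupType) (X : normedModType R).

Definition affine_isometry (A : X -> X) :=
  [/\ bijective A,
      forall x y, `|A x - A y| = `|x - y| &
      forall (a : R) x y,
        A (a *: x + (1 - a) *: y) = a *: A x + (1 - a) *: A y].

Definition affine_isometric_action (alpha : Gam -> X -> X) :=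
  [/\ forall g, affine_isometry (alpha g),
      alpha 1%g =1 id &
      forall g h, alpha (g * h)%g =1 alpha g \o alpha h].

Definition equivariant (f : Gam -> X) :=
  exists2 alpha, affine_isometric_action alpha & forall g, f g = alpha g 0.

(* Extended-real infimum: it is +oo on an empty set of pairs. *)
Definition metrically_proper (dist : Gam -> Gam -> nat) (f : Gam -> X) :=
  ereal_inf [set (`|f gh.1 - f gh.2|)%:E | gh in
    [set gh : Gam * Gam | (t <= dist gh.1 gh.2)%N]] @[t --> \oo] --> +oo%E.

End Equivariant_maps.

(* Word metrics of two finite generating sets are bi-Lipschitz equivalent, so
   the choice of generating set is immaterial. *)
Definition haagerup (R : realType) (Gam : groupType) :=
  exists S : set Gam, [/\ finite_set S, generates S &
    exists2 f : Gam -> L2 R, equivariant f & metrically_proper (word_dist S) f].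

Section Compression.
Variable R : realType.
Implicit Types rho tau : nat -> R.

Definition bounding_function rho :=
  [/\ rho 0%N = 0,
      forall t, 0 <= rho t,
      {homo rho : s t / (s <= t)%N >-> s <= t} &
      forall M, exists t, M < rho t].

Definition split_sums rho (t : nat) : set R :=
  [set \sum_(s <- ss) rho s | ss in
    [set ss : seq nat | (0 < size ss)%N /\ sumn ss = t]].

Definition min_split rho t : R := inf (split_sums rho t).

(* [ts.1] is t_1 and [ts.2] is the possibly empty list t_2, .., t_m. *)
Definition nu1_values rho tau (t : nat) : set R :=
  [set Num.sqrt (min_split rho ts.1) + \sum_(u <- ts.2) tau u | ts in
    [set ts : nat * seq nat | (ts.1 + sumn ts.2)%N = t]].

Definition nu1 rho tau t : R := Num.sqrt (inf (nu1_values rho tau t)).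

Definition nu2 (t : nat) : R := Num.sqrt t%:R.

(* The infima above are minima for bounding functions: dropping null parts from
   a composition does not change the sum, so only finitely many values occur. *)

Lemma inf_finite (A : set R) : finite_set A -> A !=set0 ->
  A (inf A) /\ lbound A (inf A).
Proof.
move=> /finite_seqP[s ->] [x0 /= x0s].
have [m ms mP] : exists2 m, m \in s & {in s, forall x, m <= x}.
  elim: s x0 x0s => // a [_ _ _|b s ih _ _].
    by exists a; rewrite ?mem_head// => x; rewrite inE => /eqP ->.
  have [m ms mP] := ih b (mem_head _ _).
  have [am|ma] := leP a m.
    exists a; rewrite ?mem_head// => x; rewrite inE => /predU1P[->//|xs].
    by rewrite (le_trans am)// mP.
  exists m; first by rewrite inE ms orbT.
  by move=> x; rewrite inE => /predU1P[->|/mP//]; exact: ltW.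
have lbm : lbound [set` s] m by move=> x /= /mP.
suff -> : inf [set` s] = m by [].
apply/eqP; rewrite eq_le; apply/andP; split; first by apply: ge_inf => //; exists m.
by apply: lb_le_inf => //; exists m.
Qed.

Lemma finite_seqs (n t : nat) :
  finite_set [set s : seq nat | (size s <= n)%N /\ all (leq^~ t) s].
Proof.
elim: n => [|n ih].
  apply: (@sub_finite_set _ _ [set [::]]); last exact: finite_set1.
  by move=> s /= [+ _]; rewrite leqn0 => /nilP.
pose A := [set k : nat | (k <= t)%N].
have fA : finite_set A.
  by apply: (@sub_finite_set _ _ `I_t.+1); last exact: finite_II.
apply: (@sub_finite_set _ _ ([set [::]] `|` [set x.1 :: x.2 | x in
  A `*` [set s : seq nat | (size s <= n)%N /\ all (leq^~ t) s]])).
  move=> [|a s] /= []; first by left.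
  by rewrite ltnS => sn /andP[at_ st]; right; exists (a, s).
rewrite finite_setU; split; first exact: finite_set1.
by apply: finite_image; exact: finite_setX.
Qed.

Let nz (s : seq nat) := [seq x <- s | (0 < x)%N].

Let size_nz s : (size (nz s) <= sumn s)%N.
Proof.
by elim: s => //= -[|a] s ih//=; rewrite addSn ltnS (leq_trans ih)// leq_addl.
Qed.

Let le_nz s : all (leq^~ (sumn s)) (nz s).
Proof.
apply/allP => x; rewrite mem_filter => /andP[_].
elim: s => //= a s ih; rewrite inE => /predU1P[->|/ih xs]; first exact: leq_addr.
by rewrite (leq_trans xs)// leq_addl.
Qed.

Let sum_nz rho s : rho 0%N = 0 -> \sum_(x <- nz s) rho x = \sum_(x <- s) rho x.
Proof.
move=> rho0; rewrite big_filter big_mkcond/=; apply: eq_bigr => -[|x] _ //.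
Qed.

Lemma min_splitP rho t : rho 0%N = 0 ->
  split_sums rho t (min_split rho t) /\
  lbound (split_sums rho t) (min_split rho t).
Proof.
move=> rho0; apply: inf_finite; last first.
  by exists (\sum_(s <- [:: t]) rho s); exists [:: t] => //=; rewrite addn0.
apply: (@sub_finite_set _ _ [set \sum_(s <- ss) rho s | ss in
    [set ss | (size ss <= t)%N /\ all (leq^~ t) ss]]); last first.
  by apply: finite_image; exact: finite_seqs.
move=> _ [ss [_ <-] <-]; exists (nz ss); last exact: sum_nz.
by split; [exact: size_nz|exact: le_nz].
Qed.

Lemma nu1P rho tau t : tau 0%N = 0 ->
  nu1_values rho tau t (inf (nu1_values rho tau t)) /\
  lbound (nu1_values rho tau t) (inf (nu1_values rho tau t)).
Proof.
move=> tau0; apply: inf_finite; last first.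
  eexists; exists (t, [::]) => //=; exact: addn0.
pose V (ts : nat * seq nat) :=
  Num.sqrt (min_split rho ts.1) + \sum_(u <- ts.2) tau u.
apply: (@sub_finite_set _ _ (V @` (`I_t.+1 `*`
    [set ss | (size ss <= t)%N /\ all (leq^~ t) ss]))); last first.
  by apply/finite_image/finite_setX; [exact: finite_II|exact: finite_seqs].
move=> _ [[t1 ts] /= <- <-]; exists (t1, nz ts); last by rewrite /V/= sum_nz.
split => /=; first by rewrite ltnS leq_addr.
split; first by rewrite (leq_trans (size_nz _))// leq_addl.
apply/allP => x /(allP (le_nz ts)) xs.
by rewrite (leq_trans xs)// leq_addl.
Qed.

End Compression.

(* Main.v *)
Require Import Defs.
From mathcomp Require Import all_boot all_order all_algebra.
From mathcomp Require Import all_classical all_reals all_analysis.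
From mathcomp Require Import measurable_realfun lra ring zify.
Import Order.TTheory GRing.Theory Num.Theory.
Import numFieldNormedType.Exports.
Local Open Scope classical_set_scope.
Local Open Scope ring_scope.
Set Implicit Arguments.
Unset Strict Implicit.
Unset Printing Implicit Defensive.

(** Every invariant conditionally negative definite kernel on a countable group
    is the squared distance along an orbit of an affine isometric action
    ([equivariant_of_kernel]), so it is enough to find such a kernel [K] on the
    wreath product that is at most linear in the word distance and at least a
    multiple of [nu1 ^+ 2].  The kernel is the sum of

    - the mean width, under a Gaussian functional, of the image by [psi] of the
      set [B] formed by the two cursors and the lamps that differ;
    - the sum, over the lamps that differ, of the mean of the absolute
      difference of the values of the same functional on [phi];
    - the number of lamps that differ, plus one if the cursors differ.

    Why it is conditionally negative definite: for a fixed real function [t] on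
    the base group, the maximum of [t] over [B] is an ultrametric function of
    the two group elements, because the set [B] of the pair [u, w] is contained
    in the union of those of [u, v] and [v, w].  Ultrametric kernels are
    conditionally negative definite ([cnd_ultrametric]), and the width is the
    maximum of [t] plus that of [- t].  For the kernel to be invariant, [t] has
    to be random with a law that only depends on the distances between the
    points [psi x], which a Gaussian law achieves.

    Only expectations of maxima of finitely many Gaussian variables are used,
    and they are obtained as limits of averages over random signs.  For cosines
    of linear forms the limit is explicit ([omega_cos]) and depends on norms
    only; the uniform closure of the trigonometric polynomials is a lattice
    ([trig_cl_max]); and maxima are limits of elements of this closure, with an
    error controlled by second moments ([gavg_max_over]).

    Upper bound: the kernel satisfies the triangle inequality (each of its
    pieces does) and it is invariant, so it is at most linear in the word
    distance, whatever its values on the generators ([subadditive_le_word]).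

    Lower bound: let [Q] be the kernel and [N] the number of lamps that differ.
    The word distance is at most the length of a tour of the cursor through the
    [N] lamps plus the cost of the changes of the lamps ([wreath_dist_le]).
    Each of the [N + 1] steps of the tour joins two points of [B], so that
    [rho1] of its length is at most the diameter of [psi B], hence [O(Q)]; and
    [N + 1 = O(Q)] unless nothing happens.  The sum of [rho1] over the tour is
    therefore [O(Q ^+ 2)], which is where the inner square root of [nu1] comes
    from, and the sum of [tau1] over the changes is [O(Q)].

    The same estimates give properness when [psi] and [phi] are proper, directly
    and not through [nu1], since [rho1] may vanish at positive integers. *)

(** * The inner product of L_2 *)
Section L2_inner_product.
Context d (T : measurableType d) (R : realType) (mu : {measure set T -> \bar R}).

Local Notation X := (LspaceType2 mu).

Definition ip (u v : X) : R := (\int[mu]_x (u x * v x))%R.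

Lemma Lspace_measurable (u : X) : measurable_fun setT (u : T -> R).
Proof. exact: (@measurable_funPT _ _ _ _ (Lspace_rep u)). Qed.

Lemma Lspace_Lfun (u : X) : (u : T -> R) \in Lfun mu 2%:E.
Proof. exact: (LfunP (Lspace_rep u)). Qed.

Lemma integrable_ip (u v : X) : mu.-integrable setT (EFin \o (fun x => u x * v x)).
Proof.
by apply/Lfun1_integrable; apply: Lfun2_mul_Lfun1; exact: Lspace_Lfun.
Qed.

Lemma ae_eq_Rintegral (f g : T -> R) :
  measurable_fun setT f -> measurable_fun setT g -> f = g %[ae mu] ->
  (\int[mu]_x f x = \int[mu]_x g x)%R.
Proof.
move=> mf mg fg; congr fine; apply: ae_eq_integral => //.
- exact/measurable_EFinP.
- exact/measurable_EFinP.
- by apply: filterS fg => x /= fx Ax; rewrite fx.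
Qed.

Lemma ipC u v : ip u v = ip v u.
Proof. by apply: eq_Rintegral => x _; rewrite mulrC. Qed.

Lemma ipDl u v w : ip (u + v) w = ip u w + ip v w.
Proof.
rewrite /ip -RintegralD//; try exact: integrable_ip.
apply: ae_eq_Rintegral.
- by apply: measurable_funM; exact: Lspace_measurable.
- by apply: measurable_funD; apply: measurable_funM; exact: Lspace_measurable.
- by apply: filterS (Lspace_addE u v) => x /= -> // _; rewrite mulrDl.
Qed.

Lemma ipZl a u w : ip (a *: u) w = a * ip u w.
Proof.
rewrite /ip -RintegralZl//; try exact: integrable_ip.
apply: ae_eq_Rintegral.
- by apply: measurable_funM; exact: Lspace_measurable.
- by apply: measurable_funM => //; apply: measurable_funM; exact: Lspace_measurable.
- by apply: filterS (Lspace_scaleE a u) => x /= -> // _; rewrite mulrA.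
Qed.

Lemma ip_norm u : ip u u = `|u| ^+ 2.
Proof.
have -> : `|u| = fine ('N[mu]_2%:E[EFin \o u])%E by [].
rewrite -powR_mulrn ?fine_ge0 ?Lnorm_ge0//.
apply: EFin_inj; rewrite -poweR_EFin.
rewrite (_ : (fine ('N[mu]_2[EFin \o u])%E)%:E = 'N[mu]_2%:E[EFin \o u]%E); last first.
  rewrite fineK// ge0_fin_numE ?Lnorm_ge0//.
  by have := Lspace_Lfun u; rewrite inE => /andP[_]; rewrite inE/=.
rewrite powR_Lnorm// /ip /Rintegral fineK; last first.
  exact: integrable_fin_num (integrable_ip u u).
apply: eq_integral => x _ /=.
by rewrite powR_mulrn// real_normK ?num_real// expr2.
Qed.

End L2_inner_product.

Section L2_series.
Context d (T : measurableType d) (R : realType) (mu : {measure set T -> \bar R}).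

Local Notation X := (LspaceType2 mu).

(** Fatou's lemma, in the form that bounds the norm of a pointwise limit. *)
Lemma sqr_integral_le_limit (f_ : nat -> T -> R) (f : T -> R) (B : R) :
  (forall n, measurable_fun setT (f_ n)) ->
  (forall x, f_ ^~ x @ \oo --> f x) ->
  (\forall n \near \oo, (\int[mu]_x (f_ n x ^+ 2)%:E <= B%:E)%E) ->
  (\int[mu]_x (f x ^+ 2)%:E <= B%:E)%E.
Proof.
move=> mf f_f [n0 _ fB].
pose h n x := (f_ (n + n0)%N x ^+ 2)%:E.
have mh n : measurable_fun setT (h n).
  by apply/measurable_EFinP; exact: measurable_funX.
have h0 n x : setT x -> (0 <= h n x)%E by move=> _; rewrite lee_fin sqr_ge0.
have hf x : h ^~ x @ \oo --> (f x ^+ 2)%:E.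
  have fx : (fun n => f_ (n + n0)%N x) @ \oo --> f x.
    by rewrite (cvg_shiftn n0 (fun n => f_ n x)).
  rewrite -[X in X @ _](_ : EFin \o (fun n => f_ (n + n0)%N x ^+ 2) = _)//.
  by apply: cvg_EFin; [exact: nearW|rewrite expr2; under eq_fun do rewrite expr2; exact: cvgM].
have := fatou mu measurableT mh h0.
under eq_integral do rewrite (cvg_limn_einf_sup (hf _)).1.
move=> /le_trans; apply; rewrite limn_einf_lim.
apply: lime_le; first exact: is_cvg_einfs.
apply: nearW => n; apply: (@le_trans _ _ (\int[mu]_x h n x)%E).
  by apply: ereal_inf_lbound; exists n => /=.
by apply: fB => /=; rewrite leq_addl.
Qed.

Lemma Lfun2P (f : T -> R) : measurable_fun setT f ->
  (\int[mu]_x (f x ^+ 2)%:E < +oo)%E -> f \in Lfun mu 2%:E.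
Proof.
move=> mf f2; rewrite inE; apply/andP; split; rewrite inE//=.
rewrite /finite_norm (@lty_poweRy _ _ 2%R)// powR_Lnorm//.
apply: le_lt_trans f2; rewrite le_eqVlt; apply/orP; left; apply/eqP.
by apply: eq_integral => x _ /=; rewrite powR_mulrn// real_normK ?num_real.
Qed.

Lemma sqr_norm_integral (u : X) (f : T -> R) : measurable_fun setT f ->
  (u : T -> R) = f %[ae mu] -> (`|u| ^+ 2)%:E = (\int[mu]_x (f x ^+ 2)%:E)%E.
Proof.
move=> mf uf; rewrite -ip_norm /ip /Rintegral fineK; last first.
  exact: integrable_fin_num (integrable_ip u u).
apply: ae_eq_integral => //.
- by apply/measurable_EFinP; apply: measurable_funM; exact: Lspace_measurable.
- by apply/measurable_EFinP; exact: measurable_funX.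
- by apply: filterS uf => x /= ux _; rewrite -expr2 ux.
Qed.

Definition to_L2 (f : T -> R) (mf : measurable_fun setT f)
    (f2 : (\int[mu]_x (f x ^+ 2)%:E < +oo)%E) : X :=
  Lspace_pi (Lfun_Sub (lee1n 2) (Lfun2P mf f2)).

Lemma to_L2E f mf f2 : (@to_L2 f mf f2 : T -> R) = f %[ae mu].
Proof. exact: Lspace_piP. Qed.

End L2_series.

Section ip_theory.
Context d (T : measurableType d) (R : realType) (mu : {measure set T -> \bar R}).
Local Notation X := (LspaceType2 mu).
Implicit Types u v w : X.

Lemma ipDr u v w : ip w (u + v) = ip w u + ip w v.
Proof. by rewrite ipC ipDl !(ipC w). Qed.
Lemma ipZr a u w : ip w (a *: u) = a * ip w u.
Proof. by rewrite ipC ipZl (ipC w). Qed.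
Lemma ip0l u : ip 0 u = 0.
Proof. by rewrite -(scale0r u) ipZl mul0r. Qed.
Lemma ip0r u : ip u 0 = 0.
Proof. by rewrite ipC ip0l. Qed.
Lemma ipNl u v : ip (- u) v = - ip u v.
Proof. by rewrite -scaleN1r ipZl mulN1r. Qed.
Lemma ipNr u v : ip u (- v) = - ip u v.
Proof. by rewrite ipC ipNl ipC. Qed.
Lemma ip_suml (I : Type) (r : seq I) (P : pred I) (F : I -> X) v :
  ip (\sum_(i <- r | P i) F i) v = \sum_(i <- r | P i) ip (F i) v.
Proof. by elim/big_rec2: _ => [|i x y _ <-]; rewrite ?ip0l ?ipDl. Qed.
Lemma ip_sumr (I : Type) (r : seq I) (P : pred I) (F : I -> X) v :
  ip v (\sum_(i <- r | P i) F i) = \sum_(i <- r | P i) ip v (F i).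
Proof. by rewrite ipC ip_suml; apply: eq_bigr => i _; rewrite ipC. Qed.

Lemma norm_sqrD u v : `|u + v| ^+ 2 = `|u| ^+ 2 + 2 * ip u v + `|v| ^+ 2.
Proof. by rewrite -!ip_norm ipDl !ipDr (ipC v u); ring. Qed.

Lemma norm_sqrB u v : `|u - v| ^+ 2 = `|u| ^+ 2 - 2 * ip u v + `|v| ^+ 2.
Proof. by rewrite norm_sqrD ipNr normrN; ring. Qed.

Lemma ip_CauchySchwarz u v : `|ip u v| <= `|u| * `|v|.
Proof.
rewrite -ler_sqr ?nnegrE ?mulr_ge0// real_normK ?num_real// exprMn.
have [->|v0] := eqVneq v 0.
  by rewrite ipC ip0l normr0 expr0n mulr0.
have v2 : 0 < `|v| ^+ 2 by rewrite exprn_gt0 ?normr_gt0.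
have : 0 <= `|(`|v| ^+ 2) *: u - ip u v *: v| ^+ 2 by rewrite sqr_ge0.
rewrite norm_sqrB !normrZ !exprMn ipZl ipZr.
rewrite !real_normK ?num_real// ?rpredX ?num_real//.
set a := `|v| ^+ 2 in v2 *; set b := ip u v; set c := `|u| ^+ 2.
have -> : a ^+ 2 * c - 2 * (a * (b * b)) + b ^+ 2 * a = a * (c * a - b ^+ 2) by ring.
by rewrite pmulr_rge0// subr_ge0.
Qed.

End ip_theory.

(** * Orthonormal series and extension of isometries *)
Section orthonormal_L2.
Context d (T : measurableType d) (R : realType) (mu : {measure set T -> \bar R}).
Local Notation X := (LspaceType2 mu).
Variables (A : nat -> set T).
Hypotheses (mA : forall n, measurable (A n)) (tA : trivIset setT A).
Hypotheses (A0 : forall n, (0 < mu (A n))%E) (Aoo : forall n, (mu (A n) < +oo)%E).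

Let w n : R := (Num.sqrt (fine (mu (A n))))^-1.
Let f n (x : T) : R := w n * \1_(A n) x.

Let muA n : mu (A n) = (fine (mu (A n)))%:E.
Proof. by rewrite fineK// ge0_fin_numE// Aoo. Qed.

Let wA n : w n ^+ 2 * fine (mu (A n)) = 1.
Proof.
have m0 : 0 < fine (mu (A n)) by rewrite fine_gt0// A0 Aoo.
by rewrite /w exprVn sqr_sqrtr ?ltW// mulVf ?gt_eqF.
Qed.

Let mf n : measurable_fun setT (f n).
Proof. by apply: measurable_funM => //; exact: measurable_indic. Qed.

Let ff i j x : f i x * f j x = if i == j then w i ^+ 2 * \1_(A i) x else 0.
Proof.
rewrite /f !indicE; case: eqVneq => [<-|ij].
  by case: (x \in A i); rewrite ?mulr1 ?mulr0 ?expr2.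
have [xi|] := boolP (x \in A i); last by rewrite mulr0 mul0r.
have [xj|] := boolP (x \in A j); last by rewrite !mulr0.
move: xi xj; rewrite !inE => xi xj.
by have /eqP := @tA i j I I (ex_intro _ x (conj xi xj)); rewrite (negbTE ij).
Qed.

Let int_ff n : (\int[mu]_x (f n x ^+ 2)%:E = 1)%E.
Proof.
under eq_integral do rewrite expr2 ff eqxx EFinM.
rewrite ge0_integralZl//; last 2 first.
  by apply/measurable_EFinP; exact: measurable_indic.
  by rewrite lee_fin sqr_ge0.
by rewrite integral_indic// setIT muA -EFinM wA.
Qed.

Let f2 n : (\int[mu]_x (f n x ^+ 2)%:E < +oo)%E.
Proof. by rewrite int_ff ltry. Qed.

Let e n : X := to_L2 (mf n) (f2 n).

Let ee i j : ip (e i) (e j) = (i == j)%:R.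
Proof.
have [<-|ij] := eqVneq i j.
  rewrite ip_norm; apply: EFin_inj.
  by rewrite (sqr_norm_integral (mf i) (to_L2E _ _)) int_ff.
transitivity (\int[mu]_x (0 : R))%R; last by rewrite Rintegral_cst// mul0r.
apply: ae_eq_Rintegral => //.
  by apply: measurable_funM; exact: Lspace_measurable.
apply: filterS2 (to_L2E (mf i) (f2 i)) (to_L2E (mf j) (f2 j)) => x /= ex ej _.
by rewrite ex// ej// ff (negbTE ij).
Qed.

Let sum_e (c : nat -> R) (I : seq nat) :
  (\sum_(i <- I) c i *: e i : X) = (fun x => \sum_(i <- I) c i * f i x) %[ae mu].
Proof.
elim: I => [|n I ih].
  have := Lspace_scaleE 0 (0 : X); rewrite scale0r big_nil.
  by apply: filterS => x h _; rewrite h// mul0r big_nil.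
rewrite big_cons.
have h1 : (c n *: e n : X) = (fun x => c n * f n x) %[ae mu].
  apply: filterS2 (Lspace_scaleE (c n) (e n)) (to_L2E (mf n) (f2 n)) => x hx hy _.
  by rewrite hx// hy.
have h2 := Lspace_addE (c n *: e n) (\sum_(i <- I) c i *: e i).
apply: filterS3 h1 h2 ih => x {}h1 {}h2 ih _.
by rewrite h2//= h1// ih// big_cons.
Qed.

Let normr_sum_e (c : nat -> R) (I : seq nat) : uniq I ->
  `|\sum_(i <- I) c i *: e i| ^+ 2 = \sum_(i <- I) c i ^+ 2.
Proof.
move=> uI; rewrite -ip_norm ip_suml; apply: eq_big_seq => i iI.
rewrite ip_sumr (bigD1_seq i)//= ipZl ipZr ee eqxx mulr1 expr2.
rewrite big1 ?addr0// => j ji; rewrite ipZl ipZr ee.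
by rewrite eq_sym (negbTE ji) !mulr0.
Qed.

(** Normalised indicators of disjoint sets are orthonormal, and their series
    converge pointwise for trivial reasons; Fatou's lemma then gives convergence
    in norm of the square-summable ones.  The completeness of the whole space is
    thus avoided. *)
Lemma orthonormal_with_series : exists e : nat -> X,
  (forall i j, ip (e i) (e j) = (i == j)%:R) /\
  forall c : nat -> R, (exists B, forall N, \sum_(0 <= i < N) c i ^+ 2 <= B) ->
  exists v : X, forall N dl, (forall M, \sum_(N <= i < M) c i ^+ 2 <= dl) ->
    `|v - \sum_(0 <= i < N) c i *: e i| ^+ 2 <= dl.
Proof.
exists e; split=> [|c [B cB]]; first exact: ee.
pose g N x := \sum_(0 <= i < N) c i * f i x.
have mg N : measurable_fun setT (g N).
  by apply: measurable_sum => i; exact: measurable_funM.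
have f0 i j x : x \in A i -> i != j -> f j x = 0.
  move=> xi ij; have /eqP := ff i j x.
  rewrite (negbTE ij) mulf_eq0 {1}/f indicE xi mulr1 => /orP[/eqP wi|/eqP//].
  by have /eqP := wA i; rewrite wi expr0n mul0r eq_sym oner_eq0.
(* at each point at most one term of the series is nonzero *)
have [g_ gE] : exists g_ : T -> R, forall x, g ^~ x @ \oo --> g_ x.
  suff h : forall x, exists l : R, g ^~ x @ \oo --> l.
    by have [g_ gE] := boolp.choice h; exists g_.
  move=> x; have [[i xi]|nx] := pselect (exists i, x \in A i).
    exists (c i * f i x); apply: cvg_near_cst; exists i.+1 => //= n /= ni.
    rewrite /g (bigD1_seq i) ?iota_uniq ?mem_index_iota//=.
    by rewrite big1 ?addr0// => j ji; rewrite (f0 i)// ?mulr0// eq_sym.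
  exists 0; apply: cvg_near_cst; apply: nearW => n.
  rewrite /g big1// => j _; rewrite /f indicE; case: (boolP (x \in A j)) => [xj|]; last by rewrite !mulr0.
  by case: nx; exists j.
have mg_ : measurable_fun setT g_ by apply: (measurable_fun_cvg mg).
have tail N dl : (forall M, \sum_(N <= i < M) c i ^+ 2 <= dl) ->
    (\int[mu]_x ((g_ x - g N x) ^+ 2)%:E <= dl%:E)%E.
  move=> cdl; apply: (@sqr_integral_le_limit _ _ _ _ (fun M x => g M x - g N x)).
  - by move=> M; exact: measurable_funB.
  - by move=> x; apply: cvgB => //; exact: cvg_cst.
  exists N => // M /= NM.
  have gNM x : g M x - g N x = \sum_(N <= i < M) c i * f i x.
    by rewrite /g (big_cat_nat (n := N))//= addrAC subrr add0r.
  under eq_integral do rewrite gNM.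
  rewrite -(sqr_norm_integral (u := \sum_(N <= i < M) c i *: e i)).
  - by rewrite normr_sum_e ?iota_uniq// lee_fin.
  - by apply: measurable_sum => i; exact: measurable_funM.
  - exact: sum_e.
have g2 : (\int[mu]_x (g_ x ^+ 2)%:E < +oo)%E.
  apply: le_lt_trans (ltry B); apply: le_trans (tail 0%N B cB).
  by under [leRHS]eq_integral do rewrite /g big_nil subr0.
exists (to_L2 mg_ g2) => N dl cdl.
rewrite -lee_fin (@sqr_norm_integral _ _ _ _ _ (fun x => g_ x - g N x)).
- exact: tail.
- exact: measurable_funB.
have h := Lspace_addE (to_L2 mg_ g2) (- \sum_(0 <= i < N) c i *: e i).
have h1 : (- \sum_(0 <= i < N) c i *: e i : X) = (fun x => - g N x) %[ae mu].
  apply: filterS2 (Lspace_scaleE (-1) (\sum_(0 <= i < N) c i *: e i))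
    (sum_e c (index_iota 0 N)) => x hx hy _.
  by rewrite -scaleN1r hx// hy// mulN1r.
by apply: filterS3 h h1 (to_L2E mg_ g2) => x {}h {}h1 h2 _; rewrite h//= h1// h2.
Qed.
End orthonormal_L2.

Lemma L2_orthonormal (R : realType) : exists e : nat -> L2 R,
  (forall i j, ip (e i) (e j) = (i == j)%:R) /\
  forall c : nat -> R, (exists B, forall N, \sum_(0 <= i < N) c i ^+ 2 <= B) ->
  exists v : L2 R, forall N dl, (forall M, \sum_(N <= i < M) c i ^+ 2 <= dl) ->
    `|v - \sum_(0 <= i < N) c i *: e i| ^+ 2 <= dl.
Proof.
pose a n : R := n.+1%:R^-1.
have aS n : a n.+1 < a n by rewrite /a ltf_pV2 ?posrE ?ltr0n// ltr_nat.
have a_le m n : (m <= n)%N -> a n <= a m.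
  by move=> mn; rewrite /a lef_pV2 ?posrE ?ltr0n// ler_nat.
have a0 n : 0 < a n by rewrite invr_gt0 ltr0n.
pose A n : set R := `]a n.+1, a n]%classic.
have mA n : measurable (A n) by exact: measurable_itv.
have muA n : lebesgue01 R (A n) = (a n - a n.+1)%:E.
  transitivity (lebesgue_measure (A n `&` `[0, 1]%classic)) => //; rewrite setIidl.
    by rewrite lebesgue_measure_itv/= lte_fin aS EFinB.
  move=> x; rewrite /A/= !in_itv/= => /andP[ax xa].
  rewrite (ltW (lt_trans _ ax))//= (le_trans xa)//.
  by rewrite (le_trans (a_le 0%N n _))// /a invr1.
apply: (@orthonormal_with_series _ _ _ (lebesgue01 R) A) => //.
- apply: ltn_trivIset => m n mn; apply/seteqP; split => // x [].
  rewrite /A/= !in_itv/= => /andP[nx _] /andP[_ xm].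
  by have := lt_le_trans nx (le_trans xm (a_le _ _ mn)); rewrite ltxx.
- by move=> n; rewrite muA lte_fin subr_gt0.
- by move=> n; rewrite muA ltry.
Qed.

Definition square_summable (R : realType) (c : nat -> R) :=
  exists B, forall N, \sum_(0 <= i < N) c i ^+ 2 <= B.

Lemma square_summable_tail (R : realType) (c : nat -> R) (eps : R) :
  square_summable c -> 0 < eps ->
  exists N0, forall N, (N0 <= N)%N -> forall M, \sum_(N <= i < M) c i ^+ 2 <= eps.
Proof.
move=> [B cB] e0.
pose S := [set \sum_(0 <= i < N) c i ^+ 2 | N in [set: nat]].
have supS : has_sup S.
  by split; [exists (\sum_(0 <= i < 0) c i ^+ 2), 0%N|exists B => _ [N _ <-]].
have [_ [N0 _ <-] hN0] := sup_adherent e0 supS.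
exists N0 => N N0N M; have [MN|NM] := leqP M N; first by rewrite big_geq// ltW.
have h : \sum_(0 <= i < M) c i ^+ 2 <= sup S by apply: sup_upper_bound => //; exists M.
have h1 : \sum_(0 <= i < N0) c i ^+ 2 <= \sum_(0 <= i < N) c i ^+ 2.
  rewrite [leRHS](big_cat_nat (n := N0))//= lerDl.
  by apply: sumr_ge0 => i _; exact: sqr_ge0.
move: h; rewrite (big_cat_nat (n := N))//= ?(ltnW NM)//; lra.
Qed.

Section extension_by_identity.
Context d (T : measurableType d) (R : realType) (mu : {measure set T -> \bar R}).
Local Notation X := (LspaceType2 mu).
Variable e : nat -> X.
Hypothesis ee : forall i j, ip (e i) (e j) = (i == j)%:R.
Hypothesis e_series : forall c : nat -> R, square_summable c ->
  exists v : X, forall N dl, (forall M, \sum_(N <= i < M) c i ^+ 2 <= dl) ->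
    `|v - \sum_(0 <= i < N) c i *: e i| ^+ 2 <= dl.

Definition coord (u : X) (n : nat) : R := ip u (e n).

(** [v] is the sum of the series [c i *: e i]: it has these coefficients, and it
    is orthogonal to whatever is orthogonal to all the [e i]. *)
Definition synth_spec (c : nat -> R) (v : X) :=
  coord v =1 c /\ forall w, coord w =1 (fun=> 0) -> ip w v = 0.

Lemma coord_sum (c : nat -> R) N n : (n < N)%N ->
  coord (\sum_(0 <= i < N) c i *: e i) n = c n.
Proof.
move=> nN; rewrite /coord ip_suml (bigD1_seq n) ?iota_uniq ?mem_index_iota//=.
rewrite ipZl ee eqxx mulr1 big1 ?addr0// => i i_n.
by rewrite ipZl ee (negbTE i_n) mulr0.
Qed.

Lemma Bessel u : square_summable (coord u) /\
  forall N, \sum_(0 <= i < N) coord u i ^+ 2 <= `|u| ^+ 2.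
Proof.
suff h N : \sum_(0 <= i < N) coord u i ^+ 2 <= `|u| ^+ 2.
  by split => //; exists (`|u| ^+ 2).
have := sqr_ge0 (`|u - \sum_(0 <= i < N) coord u i *: e i|).
rewrite norm_sqrB -[in X in _ + X]ip_norm ip_sumr ip_suml.
under eq_bigr do rewrite ipZr.
have -> : \sum_(0 <= i < N) ip (coord u i *: e i) (\sum_(0 <= i < N) coord u i *: e i)
  = \sum_(0 <= i < N) coord u i ^+ 2.
  apply: eq_big_nat => i iN.
  by rewrite ipC ipZr -/(coord _ i) coord_sum// expr2.
have -> : \sum_(0 <= i < N) coord u i * ip u (e i) = \sum_(0 <= i < N) coord u i ^+ 2.
  by apply: eq_bigr => i _; rewrite expr2.
lra.
Qed.

Lemma synth_unique c v w : synth_spec c v -> synth_spec c w -> v = w.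
Proof.
move=> [vc v0] [wc w0]; apply/eqP; rewrite -subr_eq0 -normr_eq0 -sqrf_eq0 -ip_norm.
have h : coord (v - w) =1 fun=> 0.
  by move=> n; rewrite /coord ipDl ipNl -!/(coord _ n) vc wc subrr.
by rewrite [X in X == _]ipDr ipNr v0// w0// subrr.
Qed.

Lemma synth_exists c : square_summable c -> exists2 v, synth_spec c v &
  forall B, (forall N, \sum_(0 <= i < N) c i ^+ 2 <= B) -> `|v| ^+ 2 <= B.
Proof.
move=> cs; have [v vP] := e_series cs.
have small w k : (forall n, (k <= n)%N -> ip w (\sum_(0 <= i < n) c i *: e i) = 
    ip w (\sum_(0 <= i < k) c i *: e i)) ->
    ip w v = ip w (\sum_(0 <= i < k) c i *: e i).
  move=> wk; apply/eqP; rewrite -subr_eq0 -normr_le0; apply/ler_addgt0Pr => eps eps0.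
  rewrite add0r; set q := eps / (`|w| + 1).
  have w1 : 0 < `|w| + 1 by rewrite ltr_wpDl.
  have q0 : 0 < q by rewrite divr_gt0.
  have [N0 hN] := square_summable_tail cs (exprn_gt0 2 q0).
  rewrite -(wk (maxn k N0)) ?leq_maxl// -ipNr -ipDr.
  apply: le_trans (ip_CauchySchwarz _ _) _.
  have := vP _ _ (hN (maxn k N0) (leq_maxr _ _)).
  rewrite ler_sqr ?nnegrE ?(ltW q0)// => h.
  apply: le_trans (ler_wpM2l (normr_ge0 _) h) _.
  rewrite /q mulrA ler_pdivrMr// mulrC ler_wpM2l ?(ltW eps0)//; lra.
exists v.
  split=> [n|w w0].
    rewrite /coord ipC (small _ n.+1); first by rewrite ipC -/(coord _ n) coord_sum.
    move=> m nm; rewrite ![ip (e n) _]ipC -!/(coord _ n) !coord_sum//.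
  rewrite (small _ 0%N); first by rewrite big_nil ip0r.
  move=> m _; rewrite big_nil ip0r ip_sumr big1// => i _.
  by rewrite ipZr -/(coord w i) w0 mulr0.
by move=> B /(vP 0%N); rewrite big_nil subr0.
Qed.

Definition synth c : X := xget 0 (synth_spec c).

Lemma synthP c : square_summable c -> synth_spec c (synth c).
Proof. by move=> /synth_exists[v vc _]; apply: xgetI vc. Qed.

Lemma synth_eq c v : synth_spec c v -> synth c = v.
Proof. by move=> vc; exact: synth_unique (xgetI 0 vc) vc. Qed.

Lemma synth_norm c B : (forall N, \sum_(0 <= i < N) c i ^+ 2 <= B) ->
  `|synth c| ^+ 2 <= B.
Proof.
by move=> cB; have [v /synth_eq -> ] := synth_exists (ex_intro _ B cB); apply.
Qed.

Lemma synth_lin a c v c' v' : synth_spec c v -> synth_spec c' v' ->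
  synth_spec (fun n => a * c n + c' n) (a *: v + v').
Proof.
move=> [vc v0] [vc' v0']; split=> [n|w w0].
  by rewrite /coord ipDl ipZl -!/(coord _ n) vc vc'.
by rewrite ipDr ipZr v0// v0'// mulr0 addr0.
Qed.

(** An isometry [T1] of the square-summable sequences, given as one of two
    mutually inverse contractions, is extended by the identity on the orthogonal
    complement of the span of [e]: the two pieces of the image of [w] are still
    orthogonal. *)
Lemma synth_isometry (T1 T2 : (nat -> R) -> nat -> R) :
  (forall x B, (forall N, \sum_(0 <= i < N) x i ^+ 2 <= B) ->
     forall N, \sum_(0 <= i < N) T1 x i ^+ 2 <= B) ->
  (forall x B, (forall N, \sum_(0 <= i < N) x i ^+ 2 <= B) ->
     forall N, \sum_(0 <= i < N) T2 x i ^+ 2 <= B) ->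
  (forall x, T2 (T1 x) = x) ->
  forall w : X, `|w - synth (coord w) + synth (T1 (coord w))| = `|w|.
Proof.
move=> T1c T2c T12 w.
have [c2 cw] := Bessel w.
have sw := synthP c2; set v := synth _ in sw *.
have [B cB] := c2.
have t2 : square_summable (T1 (coord w)) by exists B; apply: T1c.
have st := synthP t2; set v' := synth _ in st *.
have v_le := @synth_norm (coord w); have v'_le := @synth_norm (T1 (coord w)).
have vB N : \sum_(0 <= i < N) coord w i ^+ 2 <= `|v| ^+ 2.
  by have [_ /(_ N)] := Bessel v; under eq_bigr do rewrite sw.1.
have v'B N : \sum_(0 <= i < N) T1 (coord w) i ^+ 2 <= `|v'| ^+ 2.
  by have [_ /(_ N)] := Bessel v'; under eq_bigr do rewrite st.1.
have vv' : `|v| ^+ 2 = `|v'| ^+ 2.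
  apply/eqP; rewrite eq_le (v'_le _ (T1c _ _ vB)) andbT.
  by apply: v_le => N; have := T2c _ _ v'B N; rewrite T12.
have w0 : coord (w - v) =1 fun=> 0.
  by move=> n; rewrite /coord ipDl ipNl -!/(coord _ n) sw.1 subrr.
apply/eqP; rewrite -(eqrXn2 (n := 2))//; apply/eqP.
have -> : `|w| ^+ 2 = `|w - v| ^+ 2 + 2 * ip (w - v) v + `|v| ^+ 2.
  by rewrite -norm_sqrD subrK.
by rewrite [LHS]norm_sqrD st.2// sw.2// vv'.
Qed.

(** A cocycle of a linear isometric action on square-summable sequences becomes
    an equivariant map: the space splits as the closed span of [e] plus its
    orthogonal complement, and the action is extended by the identity on the
    latter. *)
Lemma equivariant_of_cocycle (Gam : groupType)
    (A : Gam -> (nat -> R) -> nat -> R) (b : Gam -> nat -> R) :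
  (forall g a x y n, A g (fun i => a * x i + y i) n = a * A g x n + A g y n) ->
  (forall g x B, (forall N, \sum_(0 <= i < N) x i ^+ 2 <= B) ->
     forall N, \sum_(0 <= i < N) A g x i ^+ 2 <= B) ->
  (forall x, A 1%g x = x) ->
  (forall g h x, A (g * h)%g x = A g (A h x)) ->
  (forall g, square_summable (b g)) ->
  (forall g h n, b (g * h)%g n = b g n + A g (b h) n) ->
  exists2 f : Gam -> X, equivariant f & forall g, synth_spec (b g) (f g).
Proof.
move=> Alin Acontr A1 AM b2 bM.
have A2 g x : square_summable x -> square_summable (A g x).
  by move=> [B xB]; exists B; exact: Acontr.
pose L g (u : X) : X := u - synth (coord u) + synth (A g (coord u)).
have L_lin g a u v : L g (a *: u + v) = a *: L g u + L g v.
  have [cu _] := Bessel u; have [cv _] := Bessel v.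
  rewrite /L; have -> : coord (a *: u + v) = fun n => a * coord u n + coord v n.
    by apply/funext => n; rewrite /coord ipDl ipZl.
  have -> : A g (fun n => a * coord u n + coord v n) =
            fun n => a * A g (coord u) n + A g (coord v) n.
    by apply/funext => n; rewrite Alin.
  rewrite (synth_eq (synth_lin a (synthP cu) (synthP cv))).
  rewrite (synth_eq (synth_lin a (synthP (A2 g _ cu)) (synthP (A2 g _ cv)))).
  by rewrite opprD (addrACA (a *: u)) [LHS]addrACA !scalerDr scalerN.
have L_synth g c : square_summable c -> L g (synth c) = synth (A g c).
  move=> c2; rewrite /L (_ : coord (synth c) = c) ?subrr ?add0r//.
  by apply/funext => n; rewrite (synthP c2).1.
have LM g h u : L (g * h)%g u = L g (L h u).
  have [c2 _] := Bessel u.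
  rewrite /L; have -> : coord (u - synth (coord u) + synth (A h (coord u))) = A h (coord u).
    apply/funext => n; rewrite {1}/coord !ipDl ipNl -!/(coord _ n).
    by rewrite (synthP c2).1 (synthP (A2 h _ c2)).1 subrr add0r.
  by rewrite AM addrK.
pose al g u : X := L g u + synth (b g).
have b1 n : b 1%g n = 0.
  by have := bM 1%g 1%g n; rewrite mulg1 A1; lra.
have alM g h u : al (g * h)%g u = al g (al h u).
  have key : synth (b (g * h)%g) = synth (A g (b h)) + synth (b g).
    rewrite -[X in _ = X + _]scale1r.
    rewrite -(synth_eq (synth_lin 1 (synthP (A2 g _ (b2 h))) (synthP (b2 g)))).
    by congr synth; apply/funext => n; rewrite bM mul1r addrC.
  have := L_lin g 1 (L h u) (synth (b h)).
  by rewrite /al !scale1r => ->; rewrite LM L_synth// key [LHS]addrA.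
have al1 u : al 1%g u = u.
  rewrite /al /L A1 subrK.
  have -> : synth (b 1%g) = 0; last by rewrite addr0.
  apply: synth_eq; split=> [n|w _]; last by rewrite ip0r.
  by rewrite /coord ip0l b1.
have alB g u v : al g u - al g v = L g (u - v).
  rewrite /al opprD addrACA subrr addr0.
  by have := L_lin g (-1) v u; rewrite !scaleN1r (addrC (- v)) => ->; exact: addrC.
exists (fun g => al g 0); last first.
  move=> g; have c0 : coord 0 = fun=> 0 by apply/funext => n; rewrite /coord ip0l.
  have A0 : A g (fun=> 0) = fun=> 0.
    apply/funext => n; have := Alin g 1 (fun=> 0) (fun=> 0) n.
    rewrite mulr0 addr0; lra.
  rewrite /al /L c0 A0 add0r addNr add0r; exact: synthP.
exists al => //; split=> [g|u|g h u]; [|exact: al1|exact: alM].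
split.
- exists (al g^-1%g) => u; first by rewrite -alM mulVg al1.
  by rewrite -alM mulgV al1.
- move=> u v; rewrite alB; apply: (synth_isometry (Acontr g) (Acontr g^-1%g)) => x.
  by rewrite -AM mulVg A1.
- move=> a x y.
  have -> : a *: x + (1 - a) *: y = a *: (x - y) + y.
    by rewrite scalerBl scale1r scalerBr [LHS]addrCA; exact: addrC.
  apply/(addIr (- al g y)); rewrite alB addrK.
  have L0 : L g 0 = 0 by have := alB g 0 0; rewrite !subrr => <-.
  have := L_lin g a (x - y) 0; rewrite L0 !addr0 => ->.
  by rewrite -alB scalerBl scale1r scalerBr [RHS]addrAC [RHS]addrA subrK.
Qed.

Lemma synthB c v c' v' : synth_spec c v -> synth_spec c' v' ->
  synth_spec (fun n => c n - c' n) (v - v').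
Proof.
move=> [vc v0] [vc' v0']; split=> [n|w w0].
  by rewrite /coord ipDl ipNl -!/(coord _ n) vc vc'.
by rewrite ipDr ipNr v0// v0'// subrr.
Qed.

Lemma synth_norm_finite c v N : synth_spec c v ->
  (forall i, (N <= i)%N -> c i = 0) -> `|v| ^+ 2 = \sum_(0 <= i < N) c i ^+ 2.
Proof.
move=> cv c0.
have -> : v = \sum_(0 <= i < N) c i *: e i.
  apply: synth_unique cv _; split=> [n|w w0]; last first.
    by rewrite ip_sumr big1// => i _; rewrite ipZr -/(coord w i) w0 mulr0.
  have [nN|Nn] := ltnP n N; first exact: coord_sum.
  rewrite c0// /coord ip_suml big_nat big1// => j /andP[_ jN].
  by rewrite ipZl ee (ltn_eqF (leq_trans jN Nn)) mulr0.
rewrite -ip_norm ip_suml; apply: eq_big_nat => i iN.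
by rewrite ipZl ipC -/(coord _ _) coord_sum.
Qed.

End extension_by_identity.

(** * Gram-Schmidt orthogonalisation of a positive semidefinite matrix *)
Section pdot.
Variable R : rcfType.
Implicit Types (p q : {poly R}) (x : nat -> R).

(** Polynomials serve as finitely supported sequences, paired here with
    arbitrary ones. *)
Definition pdot p x : R := \sum_(i < size p) p`_i * x i.

Lemma sum_coef_ext n p (F : nat -> R) : (size p <= n)%N ->
  \sum_(i < size p) p`_i * F i = \sum_(i < n) p`_i * F i.
Proof.
move=> pn; rewrite (big_ord_widen n (fun i => p`_i * F i))//.
rewrite big_mkcond/=; apply: eq_bigr => i _; case: ltnP => // ip.
by rewrite nth_default// mul0r.
Qed.

Lemma pdot_lin a p q x : pdot (a *: p + q) x = a * pdot p x + pdot q x.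
Proof.
pose n := maxn (size (a *: p + q)) (maxn (size p) (size q)).
rewrite /pdot !(@sum_coef_ext n) ?leq_max ?leqnn ?orbT//.
by rewrite mulr_sumr -big_split; apply: eq_bigr => i _; rewrite coefD coefZ/=; ring.
Qed.

Lemma pdot0 x : pdot 0 x = 0.
Proof. by rewrite /pdot size_poly0 big_ord0. Qed.
Lemma pdotD p q x : pdot (p + q) x = pdot p x + pdot q x.
Proof. by rewrite -[p]scale1r pdot_lin mul1r scale1r. Qed.
Lemma pdotZ a p x : pdot (a *: p) x = a * pdot p x.
Proof. by rewrite -[a *: p]addr0 pdot_lin pdot0 addr0. Qed.
Lemma pdot_sum (I : Type) (r : seq I) (P : pred I) (F : I -> {poly R}) x :
  pdot (\sum_(i <- r | P i) F i) x = \sum_(i <- r | P i) pdot (F i) x.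
Proof. by elim/big_rec2: _ => [|i y z _ <-]; rewrite ?pdot0 ?pdotD. Qed.

Lemma pdotXn n x : pdot 'X^n x = x n.
Proof.
rewrite /pdot size_polyXn (bigD1 ord_max)//= coefXn eqxx mul1r big1 ?addr0// => i.
by rewrite coefXn -val_eqE/= => /negbTE ->; rewrite mul0r.
Qed.

Lemma pdotlr a p x y : pdot p (fun i => a * x i + y i) = a * pdot p x + pdot p y.
Proof. by rewrite /pdot mulr_sumr -big_split; apply: eq_bigr => i _ /=; ring. Qed.

Lemma pdot_coefC p q : pdot p (fun i => q`_i) = pdot q (fun i => p`_i).
Proof.
pose n := maxn (size p) (size q).
rewrite /pdot !(@sum_coef_ext n) ?leq_maxl ?leq_maxr//.
by apply: eq_bigr => i _; rewrite mulrC.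
Qed.

(** Bessel's inequality for finitely supported orthonormal vectors; only
    finitely many terms of [x] are involved for each [N]. *)
Lemma pdot_contract N (rho : nat -> {poly R}) x B :
  (forall i j, pdot (rho i) (fun n => (rho j)`_n) = (i == j)%:R) ->
  (forall M, \sum_(0 <= i < M) x i ^+ 2 <= B) ->
  \sum_(0 <= j < N) pdot (rho j) x ^+ 2 <= B.
Proof.
move=> rr xB; pose y := \sum_(0 <= j < N) pdot (rho j) x *: rho j.
have yx : pdot y x = \sum_(0 <= j < N) pdot (rho j) x ^+ 2.
  by rewrite pdot_sum; apply: eq_bigr => j _; rewrite pdotZ expr2.
have yy : pdot y (fun i => y`_i) = \sum_(0 <= j < N) pdot (rho j) x ^+ 2.
  rewrite {1}/y pdot_sum; apply: eq_big_nat => j jN.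
  rewrite pdotZ pdot_coefC /y pdot_sum (bigD1_seq j) ?iota_uniq ?mem_index_iota//=.
  rewrite pdotZ rr eqxx mulr1 big1 ?addr0// => i ij.
  by rewrite pdotZ rr (negbTE ij) mulr0.
apply: le_trans (xB (size y)); rewrite big_mkord [leRHS]big_mkord in yx yy *.
have : 0 <= \sum_(i < size y) (x i - y`_i) ^+ 2 by apply: sumr_ge0 => i _; exact: sqr_ge0.
have -> : \sum_(i < size y) (x i - y`_i) ^+ 2 =
    \sum_(i < size y) x i ^+ 2 - 2 * pdot y x + pdot y (fun i => y`_i).
  rewrite /pdot mulr_sumr -sumrB -big_split.
  by apply: eq_bigr => i _ /=; ring.
rewrite yx yy; lra.
Qed.

End pdot.

Section Gram_Schmidt.
Variables (R : rcfType) (k : nat -> nat -> R).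
Implicit Types (p q r : {poly R}).
Hypothesis kC : forall i j, k i j = k j i.

(** The polynomial [p] stands for the formal combination of points with
    coefficients [p`_i], and [k] for the matrix of their inner products. *)
Definition gform p q : R := pdot p (fun i => pdot q (k i)).
Hypothesis k_ge0 : forall p, 0 <= gform p p.

Lemma gformXX i j : gform 'X^i 'X^j = k i j.
Proof. by rewrite /gform !pdotXn. Qed.

Lemma gform_linl a p q r : gform (a *: p + q) r = a * gform p r + gform q r.
Proof. exact: pdot_lin. Qed.

Lemma gformC p q : gform p q = gform q p.
Proof.
rewrite /gform /pdot; under eq_bigr do rewrite mulr_sumr.
rewrite exchange_big; apply: eq_bigr => i _ /=; rewrite mulr_sumr.
by apply: eq_bigr => j _ /=; rewrite kC; ring.
Qed.

Lemma gformDl p q r : gform (p + q) r = gform p r + gform q r.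
Proof. exact: pdotD. Qed.
Lemma gformZl a p r : gform (a *: p) r = a * gform p r.
Proof. exact: pdotZ. Qed.
Lemma gform0l r : gform 0 r = 0. Proof. exact: pdot0. Qed.
Lemma gform_suml (I : Type) (s : seq I) (P : pred I) (F : I -> {poly R}) r :
  gform (\sum_(i <- s | P i) F i) r = \sum_(i <- s | P i) gform (F i) r.
Proof. exact: pdot_sum. Qed.
Lemma gformDr p q r : gform r (p + q) = gform r p + gform r q.
Proof. by rewrite !(gformC r) gformDl. Qed.
Lemma gformZr a p r : gform r (a *: p) = a * gform r p.
Proof. by rewrite !(gformC r) gformZl. Qed.
Lemma gform0r r : gform r 0 = 0. Proof. by rewrite gformC gform0l. Qed.
Lemma gform_sumr (I : Type) (s : seq I) (P : pred I) (F : I -> {poly R}) r :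
  gform r (\sum_(i <- s | P i) F i) = \sum_(i <- s | P i) gform r (F i).
Proof. by rewrite gformC gform_suml; apply: eq_bigr => i _; rewrite gformC. Qed.
Lemma gformBl p q r : gform (p - q) r = gform p r - gform q r.
Proof. by rewrite -scaleN1r gformDl gformZl mulN1r. Qed.
Lemma gformBr p q r : gform r (p - q) = gform r p - gform r q.
Proof. by rewrite !(gformC r) gformBl. Qed.

Lemma null_form r : gform r r = 0 -> forall q, gform r q = 0.
Proof.
move=> r0 q; have [//|rq] := eqVneq (gform r q) 0.
have h t : 0 <= 2 * t * gform r q + gform q q.
  have := k_ge0 (t *: r + q).
  by rewrite !gformDl !gformDr !gformZl !gformZr r0 (gformC q r); lra.
have := h (- (gform q q + 1) / (2 * gform r q)).
have -> : 2 * (- (gform q q + 1) / (2 * gform r q)) * gform r q = - (gform q q + 1).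
  by field.
lra.
Qed.

Lemma gform_Xn p q : gform p q = \sum_(i < size p) p`_i * gform 'X^i q.
Proof. by rewrite {1}/gform {1}/pdot; apply: eq_bigr => i _; rewrite /gform pdotXn. Qed.

(** The list holds the vectors already built. Keeping a zero vector at the ranks
    where the residue is null keeps the numbering of the points. *)
Definition gs_next n (s : seq {poly R}) : {poly R} :=
  let v := 'X^n - \sum_(b <- s) gform 'X^n b *: b in
  if gform v v == 0 then 0 else (Num.sqrt (gform v v))^-1 *: v.

Fixpoint gs_list n : seq {poly R} :=
  if n is m.+1 then rcons (gs_list m) (gs_next m (gs_list m)) else [::].

Definition gs n := gs_next n (gs_list n).

Lemma gs_listE n : gs_list n = [seq gs i | i <- iota 0 n].
Proof. by elim: n => // n ih; rewrite -addn1 iotaD map_cat/= addn1 /= -ih cats1. Qed.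

Let res n : {poly R} := 'X^n - \sum_(0 <= i < n) gform 'X^n (gs i) *: gs i.

Let gsE n : gs n = if gform (res n) (res n) == 0 then 0
                   else (Num.sqrt (gform (res n) (res n)))^-1 *: res n.
Proof.
by rewrite {1}/gs /gs_next gs_listE big_map /res /index_iota subn0.
Qed.

Lemma gs_orthonormal i j : gform (gs i) (gs j) = ((i == j) && (gs i != 0))%:R.
Proof.
have diag n : gform (gs n) (gs n) = (gs n != 0)%:R.
  have := gsE n; case: eqVneq => [_ ->|v0 gn]; first by rewrite gform0l eqxx.
  have g1 : gform (gs n) (gs n) = 1.
    rewrite gn gformZl gformZr mulrA -invfM -expr2 sqr_sqrtr//.
    by rewrite mulVf.
  case: eqVneq => // g0; move: g1; rewrite g0 gform0l => /eqP.
  by rewrite eq_sym oner_eq0.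
suff off m : forall n, (m < n)%N -> gform (gs n) (gs m) = 0.
  have [<-|ij] := eqVneq i j; first exact: diag.
  by case: (ltngtP i j) ij => // ij _; [rewrite gformC|]; rewrite off.
move=> n; elim/ltn_ind: n m => n ih m mn.
have rm : gform (res n) (gs m) = 0.
  rewrite /res gformBl gform_suml (bigD1_seq m) ?iota_uniq ?mem_index_iota//=.
  rewrite gformZl diag big_seq_cond big1 ?addr0 => [|l]; last first.
    rewrite mem_index_iota => /andP[/andP[_ ln] lm]; rewrite gformZl.
    case: (ltngtP l m) lm => // lm _; [rewrite (gformC (gs l))|];
      by rewrite ih ?mulr0.
  by case: eqVneq => [->|_]; rewrite ?gform0r ?mul0r ?mulr1 subrr.
by rewrite gsE; case: eqP => _; rewrite ?gform0l// gformZl rm mulr0.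
Qed.

Let null r := gform r r = 0.

Let nullD a r r' : null r -> null r' -> null (a *: r + r').
Proof.
move=> r0 r'0; rewrite /null gformDl gformZl.
by rewrite (null_form r0) (null_form r'0) mulr0 addr0.
Qed.

Lemma gs_null_Xn n N : (n < N)%N -> null ('X^n - \sum_(0 <= i < N) gform 'X^n (gs i) *: gs i)
  /\ forall i, (n < i)%N -> gform 'X^n (gs i) = 0.
Proof.
have h : null ('X^n - \sum_(0 <= i < n.+1) gform 'X^n (gs i) *: gs i).
  rewrite big_nat_recr//= opprD addrA -/(res n).
  have rg : gform 'X^n (gs n) = gform (res n) (gs n).
    rewrite /res gformBl gform_suml big_seq_cond big1 ?subr0 => // l.
    rewrite mem_index_iota andbT => /andP[_ ln]; rewrite gformZl gs_orthonormal.
    by rewrite (ltn_eqF ln) mulr0.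
  rewrite rg gsE; case: eqVneq => [v0|v0]; first by rewrite scaler0 subr0.
  rewrite gformZr scalerA mulrAC -invfM -expr2 sqr_sqrtr// mulVf// scale1r subrr.
  by rewrite /null gform0l.
have h0 i : (n < i)%N -> gform 'X^n (gs i) = 0.
  move=> ni; have := null_form h (gs i); rewrite gformBl gform_suml => /eqP.
  rewrite subr_eq0 => /eqP ->; rewrite big_seq_cond big1// => l.
  rewrite mem_index_iota andbT => /andP[_ ln]; rewrite gformZl gs_orthonormal.
  by rewrite ltn_eqF ?mulr0// (leq_trans ln).
move=> nN; split=> //; rewrite (big_cat_nat (n := n.+1))//=.
rewrite [X in _ - (_ + X)]big_nat [X in _ - (_ + X)]big1 ?addr0 => // i /andP[ni _].
by rewrite h0// scale0r.
Qed.

Lemma gs_null p N : (size p <= N)%N ->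
  null (p - \sum_(0 <= i < N) gform p (gs i) *: gs i).
Proof.
move=> pN.
have -> : p - \sum_(0 <= i < N) gform p (gs i) *: gs i = \sum_(j < size p) p`_j *:
    ('X^j - \sum_(0 <= i < N) gform 'X^j (gs i) *: gs i).
  under [RHS]eq_bigr do rewrite scalerBr scaler_sumr.
  rewrite sumrB -poly_def coefK; congr (_ - _).
  rewrite exchange_big/=; apply: eq_bigr => i _.
  rewrite gform_Xn scaler_suml; apply: eq_bigr => j _; by rewrite scalerA.
elim/big_rec: _ => [|j r _ r0]; first by rewrite /null gform0l.
by apply: nullD => //; apply: (gs_null_Xn (leq_trans (ltn_ord j) pN)).1.
Qed.

Lemma gs_vanish p i : (size p <= i)%N -> gform p (gs i) = 0.
Proof.
move=> pi; rewrite gform_Xn big1// => j _.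
by rewrite (gs_null_Xn (ltnSn j)).2 ?mulr0// (leq_trans _ pi).
Qed.

(** Up to null vectors [gs] is an orthonormal basis for [gform], and triangular:
    finite combinations have finitely many nonzero coordinates. *)
Definition gs_coord p : {poly R} := \poly_(i < size p) gform p (gs i).

Lemma gs_coordE p i : (gs_coord p)`_i = gform p (gs i).
Proof. by rewrite coef_poly; case: ltnP => // ip; rewrite gs_vanish. Qed.

Lemma gs_coord_eq p q : (forall r, gform p r = gform q r) -> gs_coord p = gs_coord q.
Proof. by move=> pq; apply/polyP => i; rewrite !gs_coordE. Qed.

Lemma gs_coord_lin a p q : gs_coord (a *: p + q) = a *: gs_coord p + gs_coord q.
Proof.
by apply/polyP => i; rewrite coefD coefZ !gs_coordE gform_linl.
Qed.

Lemma gs_coord_sum (I : Type) (s : seq I) (F : I -> {poly R}) (c : I -> R) :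
  gs_coord (\sum_(i <- s) c i *: F i) = \sum_(i <- s) c i *: gs_coord (F i).
Proof.
apply/polyP => i; rewrite gs_coordE gform_suml coef_sum.
by apply: eq_bigr => j _; rewrite coefZ gs_coordE gformZl.
Qed.

Lemma gs_expand p q N : (size p <= N)%N ->
  gform p q = \sum_(0 <= i < N) gform p (gs i) * gform (gs i) q.
Proof.
move=> /gs_null/null_form/(_ q); rewrite gformBl gform_suml => /eqP.
by rewrite subr_eq0 => /eqP ->; apply: eq_bigr => i _; rewrite gformZl.
Qed.

Lemma pdot_gs_coord p q : pdot (gs_coord p) (fun i => (gs_coord q)`_i) = gform p q.
Proof.
rewrite /pdot (@sum_coef_ext _ (size p)) ?size_poly//.
rewrite (gs_expand _ (leqnn _)) big_mkord; apply: eq_bigr => i _.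
by rewrite !gs_coordE (gformC q).
Qed.

End Gram_Schmidt.

(** * From an invariant kernel to an affine isometric action *)
Section GNS.
Variables (R : rcfType) (Gam : groupType).
Variables (en : nat -> Gam) (idx : Gam -> nat).
Hypothesis idxK : cancel idx en.
Variable K : Gam -> Gam -> R.
Hypothesis KC : forall u v, K u v = K v u.
Hypothesis K0 : forall u, K u u = 0.
Hypothesis KM : forall g u v, K (g * u)%g (g * v)%g = K u v.

(** The inner product of the points [u] and [v] of an orbit whose base point is
    the origin, in terms of the squared distances [K]. *)
Definition based u v := (K u 1%g + K v 1%g - K u v) / 2.
Definition gram i j := based (en i) (en j).
Hypothesis gram_ge0 : forall p : {poly R}, 0 <= gform gram p p.

Lemma gram_sym i j : gram i j = gram j i.
Proof. by rewrite /gram /based (KC (en i) (en j)); lra. Qed.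

Let gramC : forall i j, gram i j = gram j i := gram_sym.

Let fm := gform gram.
Let bv := gs gram.
Let L := gs_coord gram.
Let fC p q : fm p q = fm q p.
Proof. exact: gformC. Qed.

Definition mono u : {poly R} := 'X^(idx u).

(** The linear part of the action of [g], which sends the point [u] of the orbit
    of the origin to the difference of the points [g * u] and [g]. *)
Definition trans g (p : {poly R}) : {poly R} :=
  \sum_(i < size p) p`_i *: (mono (g * en i)%g - mono g).

Let trans_ext g (p : {poly R}) n : (size p <= n)%N ->
  trans g p = \sum_(i < n) p`_i *: (mono (g * en i)%g - mono g).
Proof.
move=> pn; rewrite /trans.
rewrite (big_ord_widen n (fun i => p`_i *: (mono (g * en i)%g - mono g)))//.
rewrite big_mkcond/=; apply: eq_bigr => i _; case: ltnP => // ip.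
by rewrite nth_default// scale0r.
Qed.

Lemma trans_lin g a p q : trans g (a *: p + q) = a *: trans g p + trans g q.
Proof.
pose n := maxn (size (a *: p + q)) (maxn (size p) (size q)).
rewrite !(@trans_ext _ _ n) ?leq_max ?leqnn ?orbT//.
rewrite scaler_sumr -big_split; apply: eq_bigr => i _.
by rewrite coefD coefZ/= scalerDl scalerA.
Qed.

Lemma trans0 g : trans g 0 = 0.
Proof. by rewrite /trans size_poly0 big_ord0. Qed.
Lemma transD g p q : trans g (p + q) = trans g p + trans g q.
Proof. by rewrite -[p]scale1r trans_lin !scale1r. Qed.
Lemma transZ g a p : trans g (a *: p) = a *: trans g p.
Proof. by rewrite -[a *: p]addr0 trans_lin trans0 addr0. Qed.
Lemma transB g p q : trans g (p - q) = trans g p - trans g q.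
Proof. by rewrite -scaleN1r transD transZ scaleN1r. Qed.
Lemma trans_sum g (I : Type) (s : seq I) (F : I -> {poly R}) (c : I -> R) :
  trans g (\sum_(i <- s) c i *: F i) = \sum_(i <- s) c i *: trans g (F i).
Proof. by elim/big_rec2: _ => [|i y z _ <-]; rewrite ?trans0 ?trans_lin. Qed.

Lemma transXn g i : trans g 'X^i = mono (g * en i)%g - mono g.
Proof.
rewrite /trans size_polyXn (bigD1 ord_max)//= coefXn eqxx scale1r big1 ?addr0// => j.
by rewrite coefXn -val_eqE/= => /negbTE ->; rewrite scale0r.
Qed.

Lemma trans_mono g u : trans g (mono u) = mono (g * u)%g - mono g.
Proof. by rewrite transXn idxK. Qed.

Lemma poly_sumXn (p : {poly R}) : p = \sum_(i <- iota 0 (size p)) p`_i *: 'X^i.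
Proof. by rewrite -{1}[p]coefK poly_def -(big_mkord xpredT (fun i => p`_i *: 'X^i)) /index_iota subn0. Qed.

(** This holds exactly, and not only modulo null vectors, since the section
    [idx] picks one index for each group element. *)
Lemma transM g h p : trans (g * h)%g p = trans g (trans h p).
Proof.
rewrite (poly_sumXn p) (trans_sum h) !(trans_sum g) trans_sum; apply: eq_bigr => i _.
by rewrite !transXn transB !trans_mono mulgA opprB addrA subrK.
Qed.

Lemma fm_mono u v : fm (mono u) (mono v) = based u v.
Proof. by rewrite /fm gformXX /gram !idxK. Qed.

Lemma fm_mono1 q : fm (mono 1%g) q = 0.
Proof.
by apply: (null_form gramC gram_ge0); rewrite -/fm fm_mono /based !K0; lra.
Qed.

Lemma fm_trans g p q : fm (trans g p) q = fm p (trans g^-1%g q).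
Proof.
have mon u v : fm (trans g (mono u)) (mono v) = fm (mono u) (trans g^-1%g (mono v)).
  rewrite !trans_mono /fm gformBl (gformBr gramC) -/fm !fm_mono /based.
  rewrite -(KM g u (g^-1 * v)%g) -(KM g u g^-1%g) -(KM g (g^-1 * v)%g 1%g).
  rewrite -(KM g g^-1%g 1%g) mulVKg mulgV !mulg1.
  by rewrite (KC 1%g g) (KC g v); lra.
have X i r : fm 'X^i r = fm (mono (en i)) r.
  by rewrite /fm /gform !pdotXn; congr pdot; apply: boolp.funext => j; rewrite /gram idxK.
have XX i j : fm (trans g 'X^i) 'X^j = fm 'X^i (trans g^-1%g 'X^j).
  have tX h n : trans h 'X^n = trans h (mono (en n)) by rewrite transXn trans_mono.
  rewrite (tX g i) (tX g^-1%g j) (X i) -(mon (en i) (en j)).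
  by rewrite (fC (trans g (mono (en i))) 'X^j) (X j) (fC (mono (en j))).
rewrite (poly_sumXn p) (poly_sumXn q) !trans_sum /fm !gform_suml.
apply: eq_bigr => i _; rewrite !gformZl !(gform_sumr gramC); congr (_ * _).
by apply: eq_bigr => j _; rewrite !(gformZr gramC) -/fm XX.
Qed.

Lemma fm_trans1 p q : fm (trans 1%g p) q = fm p q.
Proof.
rewrite (poly_sumXn p) !trans_sum /fm !gform_suml; apply: eq_bigr => i _.
rewrite !gformZl transXn mul1g gformBl -/fm fm_mono1 subr0 /fm /gform !pdotXn.
by congr (_ * pdot _ _); apply: boolp.funext => j; rewrite /gram idxK.
Qed.

Lemma L_eq p q : (forall r, fm p r = fm q r) -> L p = L q.
Proof. exact: gs_coord_eq. Qed.

Lemma pdotL p q : pdot (L p) (fun i => (L q)`_i) = fm p q.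
Proof. exact: pdot_gs_coord. Qed.

Lemma L_coef p i : (L p)`_i = fm p (bv i).
Proof. exact: gs_coordE. Qed.

Lemma bv_orthonormal i j : fm (bv i) (bv j) = ((i == j) && (bv i != 0))%:R.
Proof. exact: gs_orthonormal. Qed.

Lemma L_bv i : bv i != 0 -> L (bv i) = 'X^i.
Proof.
by move=> g0; apply/polyP => j; rewrite L_coef bv_orthonormal g0 andbT coefXn eq_sym.
Qed.

(** The rows of the matrix of the linear part of [g] in the basis [bv]; a row
    is that of the identity where the basis has a null vector. *)
Definition row_of g j : {poly R} :=
  if bv j == 0 then 'X^j else L (trans g^-1%g (bv j)).

Definition lin_act g (x : nat -> R) (j : nat) : R := pdot (row_of g j) x.

Lemma row_orthonormal g i j :
  pdot (row_of g i) (fun n => (row_of g j)`_n) = (i == j)%:R.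
Proof.
rewrite /row_of; have [i0|i0] := boolP (bv i == 0); have [j0|j0] := boolP (bv j == 0).
- by rewrite pdotXn coefXn.
- rewrite pdotXn L_coef (eqP i0) /fm (gform0r gramC).
  by case: eqVneq => // ij; move: j0; rewrite -ij i0.
- rewrite pdot_coefC pdotXn L_coef (eqP j0) /fm (gform0r gramC).
  by case: eqVneq => // ij; move: i0; rewrite ij j0.
- by rewrite pdotL fm_trans -transM mulVg fC fm_trans1 bv_orthonormal j0 andbT eq_sym.
Qed.

Lemma lin_act_contract g x B : (forall N, \sum_(0 <= i < N) x i ^+ 2 <= B) ->
  forall N, \sum_(0 <= i < N) lin_act g x i ^+ 2 <= B.
Proof. by move=> xB N; apply: pdot_contract => // i j; exact: row_orthonormal. Qed.

Lemma lin_act1 x : lin_act 1%g x = x.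
Proof.
apply: boolp.funext => j; rewrite /lin_act /row_of; case: ifP => [_|/negbT j0].
  exact: pdotXn.
rewrite invg1 (@L_eq _ (bv j)) ?L_bv ?pdotXn// => r; exact: fm_trans1.
Qed.

(** The rows have finite support, so that the product of two of these infinite
    matrices is a finite sum, and the identity holds on all sequences. *)
Lemma lin_actM g h x : lin_act (g * h)%g x = lin_act g (lin_act h x).
Proof.
apply: boolp.funext => j; rewrite /lin_act; set p := row_of g j.
have -> : pdot p (fun i => pdot (row_of h i) x) =
    pdot (\sum_(i < size p) p`_i *: row_of h i) x.
  by rewrite pdot_sum; apply: eq_bigr => i _; rewrite pdotZ.
congr pdot; have [j0|j0] := boolP (bv j == 0).
  have rX f : row_of f j = 'X^j by rewrite /row_of j0.
  rewrite {}/p rX (rX g) size_polyXn (bigD1 ord_max)//= coefXn eqxx scale1r rX.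
  by rewrite big1 ?addr0// => i; rewrite -val_eqE/= coefXn => /negbTE ->; rewrite scale0r.
have rL f : row_of f j = L (trans f^-1%g (bv j)) by rewrite /row_of (negbTE j0).
rewrite {}/p (rL g) rL; set p := trans g^-1%g (bv j).
transitivity (\sum_(i < size p) (L p)`_i *: row_of h i); last first.
  rewrite [RHS](big_ord_widen (size p) (fun i => (L p)`_i *: row_of h i)) ?size_poly//.
  rewrite [RHS]big_mkcond/=; apply: eq_bigr => i _; case: ltnP => // ip.
  by rewrite nth_default// scale0r.
transitivity (\sum_(i < size p) fm p (bv i) *: L (trans h^-1%g (bv i))); last first.
  apply: eq_bigr => i _; rewrite L_coef /row_of; case: ifP => // /eqP ->.
  by rewrite /fm (gform0r gramC) !scale0r.
rewrite -(big_mkord xpredT (fun i => fm p (bv i) *: L (trans h^-1%g (bv i)))).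
have -> : \sum_(0 <= i < size p) fm p (bv i) *: L (trans h^-1%g (bv i)) =
    L (trans h^-1%g (\sum_(0 <= i < size p) fm p (bv i) *: bv i)).
  by rewrite trans_sum /L gs_coord_sum.
rewrite invgM transM.
apply: L_eq => r; rewrite 2!(fm_trans h^-1%g) -/p; apply/eqP.
rewrite -subr_eq0 /fm -gformBl.
apply/eqP/(null_form gramC gram_ge0).
exact: (gs_null gramC gram_ge0 (leqnn _)).
Qed.

Definition cocycle g (n : nat) : R := (L (mono g))`_n.

Lemma cocycleM g h n :
  cocycle (g * h)%g n = cocycle g n + lin_act g (cocycle h) n.
Proof.
rewrite /cocycle /lin_act /row_of; case: eqVneq => [n0|n0].
  by rewrite pdotXn !L_coef n0 /fm !(gform0r gramC) addr0.
rewrite pdotL fm_trans invgK trans_mono (fC _ (_ - _)) /fm gformBl -/fm !L_coef.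
by rewrite addrC subrK.
Qed.

Lemma cocycle_dist g h : pdot (L (mono g - mono h)) (fun i => (L (mono g - mono h))`_i) = K g h.
Proof.
rewrite pdotL /fm gformBl !(gformBr gramC) -/fm !fm_mono /based !K0 (KC h g); lra.
Qed.

End GNS.

(** Conditionally negative definite kernels; points carry their coefficients,
    so that adding a point is [cons]. *)
Definition cnd (R : numDomainType) (T : Type) (K : T -> T -> R) :=
  forall s : seq (R * T), \sum_(x <- s) x.1 = 0 ->
    \sum_(x <- s) \sum_(y <- s) x.1 * y.1 * K x.2 y.2 <= 0.

Section realization.
Variables (R : realType) (Gam : groupType).
Variables (en : nat -> Gam) (idx : Gam -> nat).
Hypothesis idxK : cancel idx en.
Variable K : Gam -> Gam -> R.
Hypothesis KC : forall u v, K u v = K v u.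
Hypothesis K0 : forall u, K u u = 0.
Hypothesis KM : forall g u v, K (g * u)%g (g * v)%g = K u v.
Hypothesis Kcnd : cnd K.

(** Adding the base point with the coefficient that makes the sum vanish turns
    negativity of [K] into positivity of [based K]. *)
Lemma gram_psd (p : {poly R}) : 0 <= gform (gram en K) p p.
Proof.
pose s := [seq (p`_i, en i) | i <- iota 0 (size p)].
have sumS (F : R * Gam -> R) : \sum_(x <- s) F x = \sum_(i < size p) F (p`_i, en i).
  by rewrite big_map -(big_mkord xpredT (fun i => F (p`_i, en i))) /index_iota subn0.
pose c := \sum_(x <- s) x.1; pose a := \sum_(x <- s) x.1 * K x.2 1%g.
pose b := \sum_(x <- s) \sum_(y <- s) x.1 * y.1 * K x.2 y.2.
have -> : gform (gram en K) p p = c * a - b / 2.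
  transitivity (\sum_(x <- s) \sum_(y <- s) x.1 * y.1 * based K x.2 y.2).
    rewrite /gform /pdot sumS; apply: eq_bigr => i _; rewrite mulr_sumr sumS.
    by apply: eq_bigr => j _; rewrite mulrA.
  transitivity (\sum_(x <- s) (x.1 * K x.2 1%g * c / 2 + x.1 * a / 2
      - (\sum_(y <- s) x.1 * y.1 * K x.2 y.2) / 2)).
    apply: eq_bigr => x _; rewrite /c /a !mulr_sumr !mulr_suml.
    rewrite -sumrN -!big_split/=; by apply: eq_bigr => y _; rewrite /based; field.
  by rewrite sumrB big_split/= -!mulr_suml -/a -/c -/b; field.
have := Kcnd (s := (- c, 1%g) :: s).
rewrite !big_cons/= -/c addNr K0 mulr0 add0r => /(_ erefl).
under [X in _ + X]eq_bigr do rewrite big_cons/=.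
rewrite big_split/= -/b.
have -> : \sum_(i <- s) i.1 * - c * K i.2 1%g = - c * a.
  by rewrite /a mulr_sumr; apply: eq_bigr => x _; ring.
have -> : \sum_(j <- s) - c * j.1 * K 1%g j.2 = - c * a.
  by rewrite /a mulr_sumr; apply: eq_bigr => x _; rewrite KC; ring.
lra.
Qed.

(** Schoenberg: an invariant conditionally negative definite kernel on a
    countable group is the squared distance along an orbit. *)
Lemma equivariant_of_kernel : exists2 f : Gam -> L2 R, equivariant f &
  forall g h, `|f g - f h| ^+ 2 = K g h.
Proof.
have [e [ee e_series]] := L2_orthonormal R.
have KP := gram_psd.
pose A := lin_act en idx K; pose b := cocycle en idx K.
have Alin g a x y n : A g (fun i => a * x i + y i) n = a * A g x n + A g y n.
  exact: pdotlr.
have b2 g : square_summable (b g).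
  exists (\sum_(0 <= i < size (gs_coord (gram en K) (mono R idx g))) b g i ^+ 2) => N.
  set m := size _; apply: (@le_trans _ _ (\sum_(0 <= i < maxn m N) b g i ^+ 2)).
    rewrite [leRHS](big_cat_nat (n := N)) ?leq_maxr//= lerDl.
    by apply: sumr_ge0 => i _; exact: sqr_ge0.
  rewrite (big_cat_nat (n := m)) ?leq_maxl//= [X in _ + X]big_nat [X in _ + X]big1 ?addr0//.
  by move=> i /andP[mi _]; rewrite /b /cocycle nth_default ?expr0n.
have [f eqf fP] := equivariant_of_cocycle ee e_series Alin
  (lin_act_contract idxK KC K0 KM KP) (lin_act1 idxK KC K0 KP)
  (lin_actM idxK KC KM KP) b2 (cocycleM idxK KC KM KP).
exists f => // g h.
rewrite -(cocycle_dist idxK KC K0 KP).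
set p := gs_coord _ _.
have pE : (fun i => p`_i) = (fun i => b g i - b h i).
  apply/funext => i; rewrite /p /b /cocycle -[mono R idx g - _]addrC -scaleN1r.
  by rewrite (gs_coord_lin (gram_sym en KC) KP) coefD coefZ mulN1r addrC.
have hp : synth_spec e (fun i => p`_i) (f g - f h).
  by rewrite pE; exact: (synthB (fP g) (fP h)).
rewrite (synth_norm_finite ee (N := size p) hp) ?big_mkord//.
by move=> i; exact: nth_default.
Qed.

End realization.

(** * Elementary estimates and the central limit for cosines *)
Section elementary.
Variable R : realType.
Implicit Types u x a : R.

Lemma sin_le_id u : 0 <= u -> sin u <= u.
Proof.
move=> u0.
have d x : x \in `]0, u[ -> is_derive x 1 (@sin R) (cos x) by move=> _; exact: is_derive_sin.
have c : {within `[0, u], continuous (@sin R)}.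
  by apply: continuous_subspaceT => x; exact: continuous_sin.
have [y _] := MVT_segment u0 d c; rewrite sin0 !subr0 => ->.
by rewrite -[leRHS]mul1r ler_wpM2r// cos_le1.
Qed.

Lemma norm_sin_le u : `|sin u| <= `|u|.
Proof.
wlog u0 : u / 0 <= u => [h|].
  have [/h//|/ltW u0] := leP 0 u.
  by rewrite -normrN -sinN -(normrN u) h// oppr_ge0.
rewrite (ger0_norm u0) ler_norml sin_le_id// andbT.
have [u1|u1] := leP u 1; last by rewrite (le_trans _ (sin_geN1 u))// lerN2 ltW.
rewrite (@le_trans _ _ 0) ?oppr_le0// sin_ge0_pi// u0.
by rewrite (le_trans u1)// (le_trans _ (pi_ge2 R))// ler1n.
Qed.

Lemma one_sub_cosE u : 1 - cos u = 2 * sin (u / 2) ^+ 2.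
Proof.
have {1}-> : u = (u / 2) *+ 2 by rewrite mulr2n; field.
by rewrite cos_mulr2n cos2sin2 mulr2n; ring.
Qed.

Lemma one_sub_cos_ge0 u : 0 <= 1 - cos u.
Proof. by rewrite subr_ge0 cos_le1. Qed.

Lemma one_sub_cos_le u : 1 - cos u <= u ^+ 2 / 2.
Proof.
have h : sin (u / 2) ^+ 2 <= (u / 2) ^+ 2.
  by rewrite -[leLHS]real_normK ?num_real// -[leRHS]real_normK ?num_real// lerXn2r ?nnegrE// norm_sin_le.
rewrite one_sub_cosE; move: h; rewrite expr_div_n; lra.
Qed.

(** This comparison bounds an absolute moment from below by a cosine moment. *)
Lemma one_sub_cos_le_norm u : 1 - cos u <= `|u|.
Proof.
rewrite one_sub_cosE; have h := norm_sin_le (u / 2).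
have h1 := sin_max (u / 2).
rewrite -real_normK ?num_real//; move: h; rewrite normrM (@ger0_norm _ 2^-1) ?invr_ge0//.
have := normr_ge0 (sin (u / 2)); nra.
Qed.

Lemma sin_sub_id u : `|sin u - u| <= u ^+ 2.
Proof.
wlog u0 : u / 0 <= u => [h|].
  have [/h//|/ltW u0] := leP 0 u.
  have := h (- u); rewrite oppr_ge0 sinN sqrrN -opprD normrN; exact.
have d x : x \in `]0, u[ -> is_derive x 1 (fun x : R => sin x - x) (cos x - 1).
  by move=> _; apply: is_deriveB.
have c : {within `[0, u], continuous (fun x : R => sin x - x)}.
  apply: continuous_subspaceT => x; apply: cvgB; last exact: cvg_id.
  exact: continuous_sin.
have [y /[!in_itv]/= /andP[y0 yu]] := MVT_segment u0 d c.
rewrite sin0 !subr0 => ->.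
rewrite normrM (ger0_norm u0) expr2 ler_wpM2r// distrC ger0_norm ?one_sub_cos_ge0//.
by apply: le_trans (one_sub_cos_le_norm y) _; rewrite ger0_norm.
Qed.

Lemma expRN_sub x : 0 <= x -> `|expR (- x) - (1 - x)| <= x ^+ 2.
Proof.
move=> x0; have h1 : 1 - x <= expR (- x) := expR_ge1Dx (- x).
rewrite ger0_norm ?subr_ge0// lerBlDl.
have h2 := expR_ge1Dx x; have e0 : 0 < expR x := expR_gt0 x.
rewrite expRN -[_^-1]mul1r ler_pdivrMr//.
have : 0 <= x ^+ 3 by rewrite exprn_ge0.
have : 0 <= 1 - x + x ^+ 2 by nra.
nra.
Qed.

Lemma expRN_lip x y : 0 <= x -> 0 <= y -> `|expR (- x) - expR (- y)| <= `|x - y|.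
Proof.
wlog xy : x y / x <= y => [h x0 y0|x0 y0].
  have [xy|/ltW yx] := leP x y; first exact: h.
  by rewrite distrC (distrC x) h.
rewrite distrC (distrC x) [leRHS]ger0_norm ?subr_ge0//.
rewrite distrC ger0_norm; last by rewrite subr_ge0 ler_expR lerN2.
have -> : expR (- y) = expR (- x) * expR (- (y - x)) by rewrite -expRD; congr expR; ring.
have h1 : 1 - (y - x) <= expR (- (y - x)) := expR_ge1Dx _.
have h2 : expR (- x) <= 1 by rewrite -expR0 ler_expR oppr_le0.
have := expR_gt0 (- x); nra.
Qed.

Lemma expr_lip x y n : `|x| <= 1 -> `|y| <= 1 -> `|x ^+ n - y ^+ n| <= n%:R * `|x - y|.
Proof.
move=> x1 y1; elim: n => [|n ih]; first by rewrite !expr0 subrr normr0 mul0r.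
have -> : x ^+ n.+1 - y ^+ n.+1 = x * (x ^+ n - y ^+ n) + (x - y) * y ^+ n.
  by rewrite !exprS; ring.
rewrite (le_trans (ler_normD _ _))// !normrM -natr1 mulrDl mul1r lerD//.
  by rewrite -[leRHS]mul1r ler_pM// ?mul1r.
by rewrite -[leRHS]mulr1 ler_wpM2l// normrX exprn_ile1.
Qed.

Lemma cvg_inv_sqrt (u : nat -> R) l C :
  (forall m, (0 < m)%N -> `|u m - l| <= C / Num.sqrt m%:R) -> u @ \oo --> l.
Proof.
move=> uC; apply/cvgrPdist_le => e e0.
have [C0|C0] := leP C 0.
  exists 1%N => // m /= m0; rewrite distrC (le_trans (uC _ m0))// (le_trans _ (ltW e0))//.
  by rewrite mulr_le0_ge0// invr_ge0 sqrtr_ge0.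
have q0 : 0 < C / e by rewrite divr_gt0.
exists (Num.bound ((C / e) ^+ 2)) => // m /= mN.
have m1 : (C / e) ^+ 2 < m%:R.
  by rewrite (lt_le_trans (archi_boundP _)) ?ler_nat// sqr_ge0.
have m0 : (0 < m)%N by rewrite -(ltr0n R) (le_lt_trans _ m1)// sqr_ge0.
rewrite distrC (le_trans (uC _ m0))//.
have s0 : 0 < Num.sqrt (m%:R : R) by rewrite sqrtr_gt0 ltr0n.
rewrite ler_pdivrMr// mulrC -ler_pdivrMr//.
by rewrite -ler_sqr ?nnegrE ?(ltW q0) ?(ltW s0)// sqr_sqrtr ?ler0n// ltW.
Qed.

(** The left-hand side is the characteristic function of a normalised sum of [m]
    random signs; writing [cos] as [1 - x], both [(1 - x) ^+ m] and
    [expR (- (m%:R * x))] are within [O(1 / Num.sqrt m)] of the limit. *)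
Lemma cvg_cos_pow a : (fun m => cos (a / Num.sqrt m%:R) ^+ m) @ \oo --> expR (- (a ^+ 2 / 2)).
Proof.
apply: (@cvg_inv_sqrt _ _ (a ^+ 4 + `|a| ^+ 3)) => m m0.
set s := Num.sqrt _; have s0 : 0 < s by rewrite sqrtr_gt0 ltr0n.
have s1 : 1 <= s by rewrite -(sqrtr1 R) ler_sqrt ?ler1n// ltr0n.
have s2 : s ^+ 2 = m%:R by rewrite sqr_sqrtr// ler0n.
pose u := a / s; pose x := 1 - cos u.
have x0 : 0 <= x := one_sub_cos_ge0 u.
have x_le : x <= u ^+ 2 / 2 := one_sub_cos_le u.
have us : u * s = a by rewrite /u divfK ?gt_eqF.
have cosx : cos u = 1 - x by rewrite /x opprB addrC subrK.
have h1 : `|cos u ^+ m - expR (- x) ^+ m| <= m%:R * x ^+ 2.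
  apply: le_trans (expr_lip _ _ _) _; first exact: cos_max.
    by rewrite ger0_norm ?expR_ge0// -expR0 ler_expR oppr_le0.
  by rewrite ler_wpM2l// cosx distrC expRN_sub.
have h2 : `|expR (- x) ^+ m - expR (- (a ^+ 2 / 2))| <= `|m%:R * x - a ^+ 2 / 2|.
  rewrite -expRM_natl mulrN; apply: expRN_lip; first exact: mulr_ge0.
  by rewrite divr_ge0 ?sqr_ge0.
have h3 : m%:R * x ^+ 2 <= a ^+ 4 / s.
  have -> : a ^+ 4 / s = s ^+ 2 * (u ^+ 4 * s) by rewrite -us; field; rewrite gt_eqF.
  rewrite -s2 ler_wpM2l ?sqr_ge0//.
  apply: (@le_trans _ _ (u ^+ 4)).
    have : x ^+ 2 <= (u ^+ 2 / 2) ^+ 2 by rewrite lerXn2r// ?nnegrE ?divr_ge0 ?sqr_ge0.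
    have : 0 <= u ^+ 4 by exact: exprn_even_ge0.
    have -> : (u ^+ 2 / 2) ^+ 2 = u ^+ 4 / 4 by field.
    lra.
  by rewrite ler_peMr// exprn_even_ge0.
have h4 : `|m%:R * x - a ^+ 2 / 2| <= `|a| ^+ 3 / s.
  pose h := u / 2.
  have -> : m%:R * x - a ^+ 2 / 2 = 2 * s ^+ 2 * ((sin h - h) * (sin h + h)).
    by rewrite -s2 /x one_sub_cosE -us -/h (_ : u = 2 * h) /h; field.
  have -> : `|a| ^+ 3 / s = 2 * s ^+ 2 * (4 * (h ^+ 2 * `|h|)).
    rewrite -us normrM (ger0_norm (ltW s0)) (_ : u = 2 * h); last by rewrite /h; field.
    rewrite normrM (@ger0_norm _ 2)// -[h ^+ 2]real_normK ?num_real//.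
    by field; rewrite gt_eqF.
  have s22 : 0 <= 2 * s ^+ 2 by rewrite mulr_ge0 ?sqr_ge0.
  rewrite normrM (ger0_norm s22) ler_wpM2l//.
  have h5 := sin_sub_id h; have h6 := norm_sin_le h.
  rewrite normrM; apply: (@le_trans _ _ (h ^+ 2 * (2 * `|h|))).
    apply: ler_pM => //; apply: le_trans (ler_normD _ _) _; lra.
  rewrite mulrCA ler_wpM2r//; last lra.
  by rewrite mulr_ge0 ?sqr_ge0.
have -> : cos u ^+ m - expR (- (a ^+ 2 / 2)) =
  (cos u ^+ m - expR (- x) ^+ m) + (expR (- x) ^+ m - expR (- (a ^+ 2 / 2))) by ring.
rewrite (le_trans (ler_normD _ _))// mulrDl lerD//; first exact: le_trans h1 h3.
exact: le_trans h2 h4.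
Qed.

End elementary.

(** * Averages over random signs *)
Section sign_average.
Variable R : realType.

(** The expectation of [F] on a list of [n] independent random signs. *)
Fixpoint avg n (F : seq R -> R) : R :=
  if n is n'.+1 then
    (avg n' (fun s => F (1 :: s)) + avg n' (fun s => F (-1 :: s))) / 2
  else F [::].

Lemma eq_avg n F G : F =1 G -> avg n F = avg n G.
Proof. by move=> /funext ->. Qed.

Lemma le_avg n F G : (forall s, F s <= G s) -> avg n F <= avg n G.
Proof.
elim: n F G => [|n ih] F G FG /=; first exact: FG.
by rewrite ler_pM2r// lerD// ih.
Qed.

Lemma avg_lin n a F G : avg n (fun s => a * F s + G s) = a * avg n F + avg n G.
Proof. by elim: n F G => [//|n ih] F G /=; rewrite !ih; field. Qed.

Lemma avg_cst n c : avg n (fun=> c) = c.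
Proof. by elim: n => [//|n /= ->]; field. Qed.

Lemma avgD n F G : avg n (fun s => F s + G s) = avg n F + avg n G.
Proof. by under eq_avg do rewrite -[F _]mul1r; rewrite avg_lin mul1r. Qed.

Lemma avg_sum n (I : Type) (r : seq I) (c : I -> R) (F : I -> seq R -> R) :
  avg n (fun s => \sum_(i <- r) c i * F i s) = \sum_(i <- r) c i * avg n (F i).
Proof.
elim: r => [|i r ih]; first by rewrite big_nil -[RHS](avg_cst n); apply: eq_avg => s; rewrite big_nil.
by rewrite big_cons -ih -avg_lin; apply: eq_avg => s; rewrite big_cons.
Qed.

Lemma avg_dist n F G H : (forall s, `|F s - G s| <= H s) ->
  `|avg n F - avg n G| <= avg n H.
Proof.
move=> FG; rewrite ler_distl lerBlDr -!avgD.
by apply/andP; split; apply: le_avg => s;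
  have := FG s; rewrite ler_distl => /andP[]; rewrite ?lerBlDr.
Qed.

(** One sign at a time, by [cos (x + y) + cos (x - y) = 2 * (cos x * cos y)]. *)
Lemma avg_cos n (a : nat -> R) c :
  avg n (fun s => cos (c + \sum_(i < n) s`_i * a i)) = cos c * \prod_(i < n) cos (a i).
Proof.
elim: n a c => [|n ih] a c /=; first by rewrite !big_ord0 addr0 mulr1.
under eq_avg do rewrite big_ord_recl/= mul1r addrA.
under [X in _ + X]eq_avg do rewrite big_ord_recl/= mulN1r addrA.
rewrite (ih (fun i => a i.+1)) (ih (fun i => a i.+1)) big_ord_recl/= cosD cosB.
by field.
Qed.

Lemma avg_sqr n (a : nat -> R) c :
  avg n (fun s => (c + \sum_(i < n) s`_i * a i) ^+ 2) = c ^+ 2 + \sum_(i < n) a i ^+ 2.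
Proof.
elim: n a c => [|n ih] a c /=; first by rewrite !big_ord0 !addr0.
under eq_avg do rewrite big_ord_recl/= mul1r addrA.
under [X in _ + X]eq_avg do rewrite big_ord_recl/= mulN1r addrA.
rewrite (ih (fun i => a i.+1)) (ih (fun i => a i.+1)) big_ord_recl/=.
by field.
Qed.

End sign_average.

Section Gaussian_functional.
Variable R : realType.
Implicit Types (p q : {poly R}).

(** The value at [p] of a random linear form which is approximately Gaussian:
    its coefficient of rank [j] is the normalised sum of the [m] signs of indices
    between [j * m] and [j * m + m - 1].  Only [m] coefficients are used, which
    is enough in the limit because [p] has finitely many terms. *)
Definition omega m (s : seq R) p : R :=
  \sum_(i < m * m) s`_i * (p`_(i %/ m) / Num.sqrt m%:R).

Definition sqnorm p : R := pdot p (fun i => p`_i).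

Lemma omega_lin m s a p q : omega m s (a *: p + q) = a * omega m s p + omega m s q.
Proof.
rewrite /omega mulr_sumr -big_split; apply: eq_bigr => i _ /=.
by rewrite coefD coefZ; ring.
Qed.

Lemma omegaZ m s a p : omega m s (a *: p) = a * omega m s p.
Proof. by rewrite /omega mulr_sumr; apply: eq_bigr => i _; rewrite coefZ; ring. Qed.

Lemma omegaD m s p q : omega m s (p + q) = omega m s p + omega m s q.
Proof. by rewrite -[p]scale1r omega_lin mul1r scale1r. Qed.

Lemma omegaN m s p : omega m s (- p) = - omega m s p.
Proof. by rewrite -scaleN1r omegaZ mulN1r. Qed.

Lemma omega_sum m s (I : Type) (r : seq I) (c : I -> R) (F : I -> {poly R}) :
  omega m s (\sum_(i <- r) c i *: F i) = \sum_(i <- r) c i * omega m s (F i).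
Proof.
elim/big_rec2: _ => [|i y z _ <-]; last exact: omega_lin.
by have := omegaZ m s 0 0; rewrite scale0r mul0r.
Qed.

Lemma big_divn (T : Type) (idx : T) (op : Monoid.law idx) n m (f : nat -> T) :
  \big[op/idx]_(0 <= i < n * m) f (i %/ m)%N =
  \big[op/idx]_(0 <= j < n) \big[op/idx]_(0 <= k < m) f j.
Proof.
elim: n => [|n ih]; first by rewrite mul0n !big_geq.
rewrite big_nat_recr//= -ih mulSnr (big_cat_nat (n := (n * m)%N)) ?leq_addr//=.
apply: f_equal; rewrite -{1}[(n * m)%N]add0n (addnC _ m) big_addn addnK.
apply: eq_big_nat => k /andP[_ km]; congr f.
by rewrite addnC divnMDl ?(leq_ltn_trans _ km)// divn_small ?addn0.
Qed.

Lemma omega_cos p c :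
  (fun m => avg (m * m) (fun s => cos (c + omega m s p))) @ \oo -->
    cos c * expR (- (sqnorm p / 2)).
Proof.
have -> : expR (- (sqnorm p / 2)) = \prod_(j < size p) expR (- (p`_j ^+ 2 / 2)).
  rewrite /sqnorm /pdot mulr_suml -sumrN; under eq_bigr do rewrite -expr2.
  by elim/big_rec2: _ => [|i y z _ <-]; rewrite ?expR0 ?expRD.
have h N : (fun m => \prod_(j < N) cos (p`_j / Num.sqrt m%:R) ^+ m) @ \oo -->
    \prod_(j < N) expR (- (p`_j ^+ 2 / 2)).
  elim: N => [|N ih].
    by under eq_fun do rewrite big_ord0; rewrite big_ord0; exact: cvg_cst.
  under eq_fun do rewrite big_ord_recr; rewrite big_ord_recr.
  by apply: cvgM => //; exact: cvg_cos_pow.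
apply: cvg_trans (cvgM (cvg_cst (cos c)) (h (size p))).
apply: near_eq_cvg; exists (size p) => // m /= pm.
rewrite (avg_cos _ (fun i => p`_(i %/ m) / Num.sqrt m%:R)) -[RHS]/(_ * _); congr (_ * _).
rewrite -(big_mkord xpredT (fun i => cos (p`_(i %/ m) / Num.sqrt m%:R))).
rewrite (big_divn _ m m (fun j => cos (p`_j / Num.sqrt m%:R))).
rewrite (big_cat_nat (n := size p))//= big_mkord [X in _ = _ * X]big_nat [X in _ = _ * X]big1 ?mulr1.
  by apply: eq_bigr => j _; rewrite prodr_const_nat subn0.
by move=> j /andP[pj _]; rewrite nth_default// mul0r cos0 big1.
Qed.

Lemma omega_sqr_le m p : avg (m * m) (fun s => omega m s p ^+ 2) <= sqnorm p.
Proof.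
have := avg_sqr (m * m) (fun i => p`_(i %/ m) / Num.sqrt m%:R) 0.
under eq_avg do rewrite add0r; rewrite -/(omega _ _ _) => ->.
rewrite expr0n add0r -(big_mkord xpredT (fun i => (p`_(i %/ m) / Num.sqrt m%:R) ^+ 2)).
rewrite (big_divn _ m m (fun j => (p`_j / Num.sqrt m%:R) ^+ 2)).
have [->|m0] := posnP m.
  by rewrite big_geq//; apply: sumr_ge0 => i _; rewrite -expr2 sqr_ge0.
have -> : \sum_(0 <= j < m) \sum_(0 <= k < m) (p`_j / Num.sqrt m%:R) ^+ 2 =
    \sum_(0 <= j < m) p`_j ^+ 2.
  apply: eq_bigr => j _; rewrite sumr_const_nat subn0 expr_div_n sqr_sqrtr ?ler0n//.
  by rewrite -[LHS]mulr_natr divfK// pnatr_eq0 -lt0n.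
rewrite /sqnorm /pdot (@sum_coef_ext _ (maxn m (size p))) ?leq_maxr//.
under [leRHS]eq_bigr do rewrite -expr2.
rewrite -(big_mkord xpredT (fun i => p`_i ^+ 2)) [leRHS](big_cat_nat (n := m)) ?leq_maxl//=.
by rewrite lerDl; apply: sumr_ge0 => i _; rewrite sqr_ge0.
Qed.

End Gaussian_functional.

(** * The lattice generated by trigonometric polynomials *)
Section trigonometric_closure.
Variables (R : realType) (J : Type).
Implicit Types (F G : (J -> R) -> R) (t : J -> R).

(** A term is an amplitude, a phase and a linear form; sines are cosines with
    another phase. *)
Definition trig_sum (x : seq (R * R * seq (R * J))) t : R :=
  \sum_(z <- x) z.1.1 * cos (z.1.2 + \sum_(y <- z.2) y.1 * t y.2).

Definition trig F := exists x, F =1 trig_sum x.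

Lemma trig_lin a F G : trig F -> trig G -> trig (fun t => a * F t + G t).
Proof.
move=> [x Fx] [y Gy]; exists ([seq (a * z.1.1, z.1.2, z.2) | z <- x] ++ y) => t.
rewrite /trig_sum big_cat big_map/= Fx Gy; congr (_ + _).
by rewrite /trig_sum mulr_sumr; apply: eq_bigr => z _; rewrite mulrA.
Qed.

Lemma trig_cos a c l : trig (fun t => a * cos (c + \sum_(y <- l) y.1 * t y.2)).
Proof. by exists [:: (a, c, l)] => t; rewrite /trig_sum big_seq1. Qed.

Lemma trig_cst c : trig (fun=> c).
Proof.
by exists [:: (c, 0, [::])] => t; rewrite /trig_sum big_seq1/= big_nil addr0 cos0 mulr1.
Qed.

Lemma trig_sumP (I : Type) (r : seq I) (F : I -> (J -> R) -> R) :
  (forall i, trig (F i)) -> trig (fun t => \sum_(i <- r) F i t).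
Proof.
move=> TF; elim: r => [|i r ih].
  have [x xP] := trig_cst 0; exists x => t; rewrite big_nil; exact: xP.
have [x xP] := trig_lin 1 (TF i) ih; exists x => t.
by rewrite big_cons -xP mul1r.
Qed.

Lemma trigM F G : trig F -> trig G -> trig (fun t => F t * G t).
Proof.
move=> [x Fx] [y Gy].
pose H (z w : R * R * seq (R * J)) t := z.1.1 * cos (z.1.2 + \sum_(u <- z.2) u.1 * t u.2) *
  (w.1.1 * cos (w.1.2 + \sum_(u <- w.2) u.1 * t u.2)).
have TH z w : trig (H z w).
  pose neg (l : seq (R * J)) := [seq (- u.1, u.2) | u <- l].
  have [a aP] := trig_lin 1
    (trig_cos (z.1.1 * w.1.1 / 2) (z.1.2 + w.1.2) (z.2 ++ w.2))
    (trig_cos (z.1.1 * w.1.1 / 2) (z.1.2 - w.1.2) (z.2 ++ neg w.2)).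
  exists a => t; rewrite -aP /H !big_cat/= big_map/=.
  set A := \sum_(u <- z.2) _; set B := \sum_(u <- w.2) _.
  have -> : \sum_(u <- w.2) - u.1 * t u.2 = - B.
    by rewrite -sumrN; apply: eq_bigr => u _; rewrite mulNr.
  have -> : z.1.2 + w.1.2 + (A + B) = (z.1.2 + A) + (w.1.2 + B) by ring.
  have -> : z.1.2 - w.1.2 + (A - B) = (z.1.2 + A) - (w.1.2 + B) by ring.
  by move: (z.1.2 + A) (w.1.2 + B) => X Y; rewrite cosD cosB; field.
have [a aP] := trig_sumP x (fun z => trig_sumP y (TH z)).
exists a => t; rewrite -aP Fx Gy /trig_sum mulr_suml; apply: eq_bigr => z _.
by rewrite mulr_sumr.
Qed.

Lemma trig_bounded F : trig F -> exists M, forall t, `|F t| <= M.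
Proof.
move=> [x Fx]; exists (\sum_(z <- x) `|z.1.1|) => t; rewrite Fx /trig_sum.
rewrite (le_trans (ler_norm_sum _ _ _))//; apply: ler_sum => z _.
by rewrite normrM ler_piMr// cos_max.
Qed.

Definition trig_cl F := forall e, 0 < e -> exists2 G, trig G & forall t, `|F t - G t| <= e.

Lemma trig_cl_trig F : trig F -> trig_cl F.
Proof. by move=> TF e e0; exists F => // t; rewrite subrr normr0 ltW. Qed.

Lemma trig_cl_lim F :
  (forall e, 0 < e -> exists2 G, trig_cl G & forall t, `|F t - G t| <= e) -> trig_cl F.
Proof.
move=> h e e0; have e20 : 0 < e / 2 by rewrite divr_gt0.
have [G TG FG] := h _ e20; have [G' TG' GG'] := TG _ e20.
exists G' => // t; have -> : F t - G' t = (F t - G t) + (G t - G' t) by ring.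
by rewrite (le_trans (ler_normD _ _))// (splitr e) lerD.
Qed.

Lemma trig_cl_lin a F G : trig_cl F -> trig_cl G -> trig_cl (fun t => a * F t + G t).
Proof.
move=> TF TG e e0; have e20 : 0 < e / 2 by rewrite divr_gt0.
have a1 : 0 < `|a| + 1 by rewrite ltr_wpDl.
have [F' TF' FF'] := TF (e / 2 / (`|a| + 1)) (divr_gt0 e20 a1).
have [G' TG' GG'] := TG (e / 2) e20.
exists (fun t => a * F' t + G' t); first exact: trig_lin.
move=> t; have -> : a * F t + G t - (a * F' t + G' t) = a * (F t - F' t) + (G t - G' t) by ring.
rewrite (le_trans (ler_normD _ _))// (splitr e) lerD// normrM.
apply: (@le_trans _ _ ((`|a| + 1) * (e / 2 / (`|a| + 1)))).
  by rewrite ler_pM// lerDl.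
by rewrite mulrC divfK// gt_eqF.
Qed.

Lemma trig_cl_bounded F : trig_cl F -> exists2 M, 0 < M & forall t, `|F t| <= M.
Proof.
move=> /(_ 1 ltr01)[G /trig_bounded[M GM] FG]; exists (`|M| + 1); first by rewrite ltr_wpDl.
move=> t; rewrite -[F t](subrK (G t)) addrC (le_trans (ler_normD _ _))// lerD//.
by rewrite (le_trans (GM t))// ler_norm.
Qed.

Lemma trig_clM F G : trig_cl F -> trig_cl G -> trig_cl (fun t => F t * G t).
Proof.
move=> TF TG e e0; have e20 : 0 < e / 2 by rewrite divr_gt0.
have [M M0 GM] := trig_cl_bounded TG.
have [F' TF' FF'] := TF (e / 2 / M) (divr_gt0 e20 M0).
have [N' F'N] := trig_bounded TF'; pose N := `|N'| + 1.
have N0 : 0 < N by rewrite ltr_wpDl.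
have [G' TG' GG'] := TG (e / 2 / N) (divr_gt0 e20 N0).
exists (fun t => F' t * G' t); first exact: trigM.
move=> t; have -> : F t * G t - F' t * G' t = (F t - F' t) * G t + (G t - G' t) * F' t by ring.
rewrite (le_trans (ler_normD _ _))// (splitr e) lerD// normrM.
  by rewrite -[leRHS](@divfK _ M _ (e / 2)) ?gt_eqF// ler_pM.
rewrite -[leRHS](@divfK _ N _ (e / 2)) ?gt_eqF// ler_pM//.
by rewrite (le_trans (F'N t))// (le_trans (ler_norm _))// lerDl.
Qed.

End trigonometric_closure.

Section lattice_closure.
Variables (R : realType) (J : Type).
Implicit Types (F G : (J -> R) -> R) (t : J -> R).

Lemma trig_cl_ext F G : F =1 G -> trig_cl F -> trig_cl G.
Proof. by move=> /funext ->. Qed.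

Lemma trig_clZ a F : trig_cl F -> trig_cl (fun t => a * F t).
Proof.
move=> /(trig_cl_lin a)/(_ (trig_cl_trig (@trig_cst R J 0))) h e /h[G TG FG].
by exists G => // t; rewrite -[a * F t]addr0.
Qed.

Lemma trig_clD F G : trig_cl F -> trig_cl G -> trig_cl (fun t => F t + G t).
Proof.
move=> TF TG e e0; have [H TH FH] := trig_cl_lin 1 TF TG e0.
by exists H => // t; rewrite -[F t]mul1r.
Qed.

(** Iterates converging to [`|y|] uniformly on [[-1, 1]]: the fixed points of
    the recursion are the solutions of [r ^+ 2 = y ^+ 2]. *)
Fixpoint abs_iter n (y : R) : R :=
  if n is n'.+1 then abs_iter n' y + (y ^+ 2 - abs_iter n' y ^+ 2) / 2 else 0.

Lemma abs_iter_error n y : `|y| <= 1 -> `| `|y| - abs_iter n y| * n%:R <= 2.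
Proof.
move=> y1; set a := `|y|; have a0 : 0 <= a := normr_ge0 y.
have a1 : a <= 1 := y1.
have y2 : y ^+ 2 = a ^+ 2 by rewrite /a real_normK ?num_real.
have h k : 0 <= abs_iter k y <= a /\ a - abs_iter k y <= a * (1 - a / 2) ^+ k.
  elim: k => [|k [/andP[r0 ra] ih]] /=; first by rewrite lexx a0 expr0 mulr1 subr0.
  rewrite y2; move: (abs_iter k y) r0 ra ih => r r0 ra ih.
  have r1 : r <= 1 := le_trans ra a1.
  split; first by apply/andP; split; nra.
  have -> : a - (r + (a ^+ 2 - r ^+ 2) / 2) = (a - r) * (1 - (a + r) / 2) by field.
  rewrite exprSr mulrA; apply: ler_pM => //; lra.
have [/andP[r0 ra] hn] := h n.
rewrite ger0_norm ?subr_ge0//.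
have b k : (1 - a / 2) ^+ k * (1 + k%:R * (a / 2)) <= 1.
  elim: k => [|k ih]; first by rewrite mul0r addr0 mulr1.
  apply: le_trans ih; rewrite exprSr -mulrA ler_wpM2l ?exprn_ge0//; first lra.
  rewrite -natr1; have : 0 <= k%:R * (a / 2) * (a / 2) by rewrite !mulr_ge0//; lra.
  have := sqr_ge0 (a / 2); nra.
have p0 : 0 <= (1 - a / 2) ^+ n by rewrite exprn_ge0//; lra.
have := b n; have : (a - abs_iter n y) * n%:R <= a * (1 - a / 2) ^+ n * n%:R by rewrite ler_wpM2r.
nra.
Qed.

(** A uniformly closed algebra of bounded functions contains [`|F|] with [F]: the
    absolute value is a uniform limit of polynomials on bounded sets. *)
Lemma trig_cl_abs F : trig_cl F -> trig_cl (fun t => `|F t|).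
Proof.
move=> TF; have [M M0 FM] := trig_cl_bounded TF.
pose G t := M^-1 * F t.
have TG : trig_cl G by exact: trig_clZ.
have G1 t : `|G t| <= 1 by rewrite normrM gtr0_norm ?invr_gt0// mulrC ler_pdivrMr// mul1r.
have TI n : trig_cl (fun t => abs_iter n (G t)).
  elim: n => [|n ih] /=; first exact: trig_cl_trig (@trig_cst R J 0).
  have := trig_clD ih (trig_cl_lin (- 2^-1) (trig_clM ih ih) (trig_clZ 2^-1 (trig_clM TG TG))).
  by apply: trig_cl_ext => t; field.
apply: trig_cl_lim => e e0.
pose n := (Num.bound (2 * M / e)).+1.
exists (fun t => M * abs_iter n (G t)); first exact: trig_clZ.
move=> t; have -> : `|F t| - M * abs_iter n (G t) = M * (`|G t| - abs_iter n (G t)).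
  rewrite mulrBr normrM (gtr0_norm (_ : 0 < M^-1)) ?invr_gt0// mulVKf// gt_eqF//.
rewrite normrM gtr0_norm//.
have n0 : 0 < n%:R :> R by rewrite ltr0n.
have h := abs_iter_error n (G1 t).
have : 2 * M / e < n%:R.
  rewrite (lt_le_trans (archi_boundP _)) ?ler_nat//.
  by rewrite divr_ge0 ?ltW// mulr_gt0.
rewrite ltr_pdivrMr// => h'.
rewrite -(ler_pM2r n0) -mulrA (le_trans (ler_wpM2l (ltW M0) h))//.
by rewrite mulrC (le_trans (ltW h'))// mulrC.
Qed.

Lemma trig_cl_max F G : trig_cl F -> trig_cl G -> trig_cl (fun t => Num.max (F t) (G t)).
Proof.
move=> TF TG.
have TA := trig_cl_abs (trig_cl_lin (-1) TG TF).
have := trig_clZ 2^-1 (trig_clD (trig_clD TF TG) TA).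
by apply: trig_cl_ext => t; rewrite maxr_absE mulN1r (addrC (- G t)) mulrC.
Qed.

Definition max_over (b0 : J) (bs : seq J) t : R := \big[Num.max/t b0]_(b <- bs) t b.

(** [A * sin (x / A)] is a bounded substitute for [x], trigonometric and within
    [x ^+ 2 / A] of it. *)
Lemma trig_cl_max_over A b0 bs :
  trig_cl (fun t => max_over b0 bs (fun j => A * sin (t j / A))).
Proof.
have TS b : trig_cl (fun t : J -> R => A * sin (t b / A)).
  apply: trig_cl_trig; have [x xP] := trig_cos A (- (pi / 2)) [:: (A^-1, b)].
  by exists x => t; rewrite -xP big_seq1/= addrC cosBpihalf (mulrC A^-1).
elim: bs => [|b bs ih].
  by apply: trig_cl_ext (TS b0) => t; rewrite /max_over big_nil.
by apply: trig_cl_ext (trig_cl_max (TS b) ih) => t; rewrite /max_over big_cons.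
Qed.

Lemma max_over_close b0 bs (t t' : J -> R) (d : J -> R) :
  (forall j, `|t j - t' j| <= d j) ->
  `|max_over b0 bs t - max_over b0 bs t'| <= \sum_(b <- b0 :: bs) d b.
Proof.
move=> td; have d0 j : 0 <= d j := le_trans (normr_ge0 _) (td j).
rewrite big_cons /max_over; elim: bs => [|b bs]; first by rewrite !big_nil addr0.
rewrite !big_cons; move: (\big[Num.max/t b0]_(j <- bs) t j) (\big[Num.max/t' b0]_(j <- bs) t' j) => x y.
move: (td b) (d0 b); move: (t b) (t' b) (d b) => u v w.
rewrite !ler_norml => /andP[u1 u2] w0 /andP[x1 x2].
have : 0 <= \sum_(j <- bs) d j by apply: sumr_ge0.
have := d0 b0.
move: (\sum_(j <- bs) d j) (d b0) x1 x2 => S D x1 x2 D0 S0.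
by apply/andP; case: (leP u x) => ux; case: (leP v y) => vy; split; lra.
Qed.

End lattice_closure.

(** Used with [u] and [v] the averages for two configurations of vectors with
    the same inner products. *)
Lemma cvg_close_pair (R : realType) (u v : nat -> R) :
  (forall e, 0 < e -> exists (l : R) (u' v' : nat -> R), [/\ u' @ \oo --> l, v' @ \oo --> l,
     forall n, `|u n - u' n| <= e & forall n, `|v n - v' n| <= e]) ->
  exists l : R, u @ \oo --> l /\ v @ \oo --> l.
Proof.
move=> h.
have cu : cvgn u.
  apply/cauchy_cvgP/cauchy_exP => e e0.
  have e30 : 0 < e / 3 by rewrite divr_gt0.
  have [l [u' [v' [/cvgrPdist_lt/(_ _ e30) ul _ uu' _]]]] := h _ e30.
  exists l; suff : \forall n \near \oo, `|l - u n| < e by [].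
  near=> n.
  have -> : l - u n = (l - u' n) - (u n - u' n) by ring.
  rewrite (le_lt_trans (ler_normB _ _))//.
  have : `|l - u' n| < e / 3 by near: n.
  have := uu' n; lra.
exists (limn u); split=> //.
apply/cvgrPdist_lt => e e0.
have e60 : 0 < e / 6 by rewrite divr_gt0.
have [l [u' [v' [/cvgrPdist_lt/(_ _ e60) ul /cvgrPdist_lt/(_ _ e60) vl uu' vv']]]] := h _ e60.
have /cvgrPdist_lt/(_ _ e60) cu' := cu.
near=> n.
have h1 : `|limn u - u n| < e / 6 by near: n.
have h2 : `|l - u' n| < e / 6 by near: n.
have h3 : `|l - v' n| < e / 6 by near: n.
move: h1 h2 h3 (uu' n) (vv' n); rewrite !ltr_norml !ler_norml.
move=> /andP[? ?] /andP[? ?] /andP[? ?] /andP[? ?] /andP[? ?].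
by apply/andP; split; lra.
Unshelve. all: by end_near. Qed.

(** * The mean width of a finite set *)
Section Gaussian_width.
Variables (R : realType) (J : Type).
Implicit Types (F G : (J -> R) -> R) (p q : J -> {poly R}).

Definition gavg p F m : R := avg (m * m) (fun s => F (fun j => omega m s (p j))).

Definition same_gram p q := forall a b,
  pdot (p a) (fun i => (p b)`_i) = pdot (q a) (fun i => (q b)`_i).

Lemma gavg_close p F G (H : (J -> R) -> R) m :
  (forall t, `|F t - G t| <= H t) -> `|gavg p F m - gavg p G m| <= gavg p H m.
Proof.
move=> FG; exact: (avg_dist _ (fun s => FG _)).
Qed.

Lemma sqnorm_comb p (l : seq (R * J)) : sqnorm (\sum_(y <- l) y.1 *: p y.2) =
  \sum_(y <- l) \sum_(z <- l) y.1 * z.1 * pdot (p y.2) (fun i => (p z.2)`_i).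
Proof.
rewrite /sqnorm pdot_sum; apply: eq_bigr => y _.
rewrite pdotZ pdot_coefC pdot_sum mulr_sumr; apply: eq_bigr => z _.
by rewrite pdotZ pdot_coefC mulrA.
Qed.

Lemma gavg_trig F p q : trig F -> same_gram p q ->
  exists l : R, gavg p F @ \oo --> l /\ gavg q F @ \oo --> l.
Proof.
move=> [x /funext ->] pq.
elim: x => [|z x [l [pl ql]]].
  have E0 r : gavg r (trig_sum [::]) = fun=> 0.
    apply/funext => m; rewrite -[RHS](avg_cst (m * m)); apply: eq_avg => s.
    by rewrite /trig_sum big_nil.
  by exists 0; rewrite !E0; split; exact: cvg_cst.
pose v r := \sum_(y <- z.2) y.1 *: r y.2 : {poly R}.
have E r : gavg r (trig_sum (z :: x)) = fun m =>
    z.1.1 * avg (m * m) (fun s => cos (z.1.2 + omega m s (v r))) + gavg r (trig_sum x) m.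
  apply/funext => m; rewrite /gavg -avg_lin; apply: eq_avg => s.
  by rewrite /trig_sum big_cons /v omega_sum.
exists (z.1.1 * (cos z.1.2 * expR (- (sqnorm (v p) / 2))) + l); split.
  by rewrite E; apply: cvgD => //; apply: cvgM; [exact: cvg_cst|exact: omega_cos].
rewrite E; have -> : sqnorm (v p) = sqnorm (v q).
  rewrite !sqnorm_comb; apply: eq_bigr => a _; apply: eq_bigr => b _.
  by rewrite pq.
by apply: cvgD => //; apply: cvgM; [exact: cvg_cst|exact: omega_cos].
Qed.

(** The truncated maximum is in the uniform closure of the trigonometric
    polynomials, for which the limit is explicit; the truncation costs at most
    the sum of the second moments divided by [A]. *)
Lemma gavg_max_over p q b0 bs : same_gram p q ->
  exists l : R, gavg p (max_over b0 bs) @ \oo --> l /\ gavg q (max_over b0 bs) @ \oo --> l.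
Proof.
move=> pq; apply: cvg_close_pair => e e0.
have e20 : 0 < e / 2 by rewrite divr_gt0.
pose C := \sum_(b <- b0 :: bs) sqnorm (p b).
have sn_ge0 r : 0 <= sqnorm r :> R.
  by rewrite /sqnorm /pdot; apply: sumr_ge0 => i _; rewrite -expr2 sqr_ge0.
have C0 : 0 <= C by apply: sumr_ge0 => b _.
have C1 : 0 < C + 1 by rewrite ltr_wpDl.
pose A := (C + 1) / (e / 2); have A0 : 0 < A by rewrite divr_gt0.
have [G TG FG] := trig_cl_max_over A b0 bs e20.
have [l [pl ql]] := gavg_trig TG pq.
have close r m : (forall b, sqnorm (r b) = sqnorm (p b)) ->
    `|gavg r (max_over b0 bs) m - gavg r G m| <= e.
  move=> rp; pose H (t : J -> R) := \sum_(b <- b0 :: bs) A^-1 * t b ^+ 2 + e / 2.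
  have h t : `|max_over b0 bs t - G t| <= H t.
    set FA := fun t : J -> R => max_over b0 bs (fun j => A * sin (t j / A)).
    have -> : max_over b0 bs t - G t = (max_over b0 bs t - FA t) + (FA t - G t) by ring.
    rewrite (le_trans (ler_normD _ _))// lerD// ?FG//.
    apply: max_over_close => j.
    have -> : t j - A * sin (t j / A) = - (A * (sin (t j / A) - t j / A)).
      by field; rewrite gt_eqF.
    rewrite normrN normrM (gtr0_norm A0) (le_trans (ler_wpM2l (ltW A0) (sin_sub_id _)))//.
    suff -> : A * (t j / A) ^+ 2 = A^-1 * t j ^+ 2 by [].
    by field; rewrite gt_eqF.
  apply: le_trans (gavg_close r m h) _.
  rewrite /gavg avgD avg_cst avg_sum [leRHS]splitr lerD2r.
  apply: (@le_trans _ _ (A^-1 * C)).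
    rewrite /C mulr_sumr; apply: ler_sum => b _.
    by rewrite ler_wpM2l ?invr_ge0 ?(ltW A0)// -rp omega_sqr_le.
  rewrite mulrC ler_pdivrMr// /A mulrC divfK ?gt_eqF//; lra.
exists l, (gavg p G), (gavg q G); split=> // m; apply: close => // b.
by rewrite /sqnorm pq.
Qed.

(** Over the points [b0 :: bs]; as a sum of two maxima, rather than a maximum of
    differences, it inherits what holds for maxima. *)
Definition width b0 bs (t : J -> R) : R :=
  max_over b0 bs t + max_over b0 bs (fun j => - t j).

Lemma gavg_width p q b0 bs : same_gram p q ->
  exists l : R, gavg p (width b0 bs) @ \oo --> l /\ gavg q (width b0 bs) @ \oo --> l.
Proof.
move=> pq.
have [l [pl ql]] := gavg_max_over b0 bs pq.
have pq' : same_gram (fun j => - p j) (fun j => - q j).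
  have N (r r' : {poly R}) : pdot (- r) (fun i => (- r')`_i) = pdot r (fun i => r'`_i).
    rewrite -(scaleN1r r) pdotZ pdot_coefC -(scaleN1r r') pdotZ (pdot_coefC r').
    by rewrite mulrA mulrNN mulr1 mul1r.
  by move=> a b; rewrite !N pq.
have [l' [pl' ql']] := gavg_max_over b0 bs pq'.
have E r : gavg r (width b0 bs) = fun m => gavg r (max_over b0 bs) m +
    gavg (fun j => - r j) (max_over b0 bs) m.
  apply/funext => m; rewrite /gavg -avgD; apply: eq_avg => s; congr (_ + _).
  by congr max_over; apply/funext => j; rewrite omegaN.
by exists (l + l'); rewrite !E; split; apply: cvgD.
Qed.

Lemma max_over_shift b0 bs (t : J -> R) c :
  max_over b0 bs (fun j => t j - c) = max_over b0 bs t - c.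
Proof.
rewrite /max_over; elim: bs => [|b bs ih]; first by rewrite !big_nil.
by rewrite !big_cons ih addr_maxl.
Qed.

Lemma gavg_width_shift p b0 bs (c : {poly R}) :
  gavg (fun j => p j - c) (width b0 bs) = gavg p (width b0 bs).
Proof.
apply/funext => m; apply: eq_avg => s; rewrite /width.
under [X in max_over _ _ X]eq_fun do rewrite omegaD omegaN.
under [X in _ + max_over _ _ X]eq_fun do rewrite omegaD omegaN opprD.
rewrite (max_over_shift _ _ _ (omega m s c)) (max_over_shift _ _ _ (- omega m s c)).
by ring.
Qed.

Lemma max_over_default b0 bs (t : J -> R) : t b0 <= max_over b0 bs t.
Proof.
rewrite /max_over; elim: bs => [|b bs ih]; first by rewrite big_nil.
by rewrite big_cons le_max ih orbT.
Qed.

End Gaussian_width.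

Section width_bounds.
Variables (R : realType) (J : eqType).
Implicit Types (t : J -> R) (p : J -> {poly R}).

Lemma max_over_ge b0 bs t b : b \in b0 :: bs -> t b <= max_over b0 bs t.
Proof.
rewrite inE => /predU1P[->|]; first exact: max_over_default.
rewrite /max_over; elim: bs => [//|c bs ih]; rewrite inE big_cons le_max.
by move=> /predU1P[->|/ih ->]; rewrite ?lexx ?orbT.
Qed.

Lemma max_over_le b0 bs t c : (forall b, b \in b0 :: bs -> t b <= c) ->
  max_over b0 bs t <= c.
Proof.
move=> tc; have := tc b0 (mem_head _ _).
have : forall b, b \in bs -> t b <= c by move=> b bb; apply: tc; rewrite inE bb orbT.
rewrite /max_over; elim: bs {tc} => [_ ?|b bs ih h h0]; first by rewrite big_nil.
rewrite big_cons ge_max h ?mem_head//= ih// => x xb.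
by apply: h; rewrite inE xb orbT.
Qed.

Lemma width_ge b0 bs t a b : a \in b0 :: bs -> b \in b0 :: bs ->
  `|t a - t b| <= width b0 bs t.
Proof.
move=> ain bin; have h1 := max_over_ge t ain; have h2 := max_over_ge t bin.
have h3 := max_over_ge (fun j => - t j) ain; have h4 := max_over_ge (fun j => - t j) bin.
by rewrite ler_norml /width; apply/andP; split; lra.
Qed.

(** The width is at least [`|w|], for [w] the value of the random form at the
    difference of two points, and [`|w|] is at least [A * (1 - cos (w / A))],
    whose mean has an explicit limit. The choice of [A] as the norm of that
    difference makes the bound proportional to it. *)
Lemma gavg_width_lb p b0 bs a b l : a \in b0 :: bs -> b \in b0 :: bs ->
  gavg p (width b0 bs) @ \oo --> l ->
  (1 - expR (- (1 / 2))) * Num.sqrt (sqnorm (p a - p b)) <= l.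
Proof.
move=> ain bin wl; set A := Num.sqrt _.
have sn_ge0 r : 0 <= sqnorm r :> R.
  by rewrite /sqnorm /pdot; apply: sumr_ge0 => i _; rewrite -expr2 sqr_ge0.
have [A0|A0] := eqVneq A 0.
  rewrite A0 mulr0; rewrite -(cvg_lim _ wl)//; apply: limr_ge; first by apply/cvg_ex; exists l.
  apply: nearW => m; rewrite -(avg_cst (m * m) 0); apply: le_avg => s.
  exact: le_trans (normr_ge0 _) (width_ge _ ain bin).
have Ap : 0 < A by rewrite lt_neqAle eq_sym A0 sqrtr_ge0.
have := @omega_cos R (A^-1 *: (p a - p b)) 0.
have -> : sqnorm (A^-1 *: (p a - p b)) = 1.
  rewrite /sqnorm pdotZ pdot_coefC pdotZ -/(sqnorm _) mulrA -expr2.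
  have <- : A ^+ 2 = sqnorm (p a - p b) by rewrite sqr_sqrtr.
  by rewrite exprVn mulVf ?expf_neq0.
rewrite cos0 mul1r => h.
have h1 : (fun m => A - A * avg (m * m) (fun s => cos (0 + omega m s (A^-1 *: (p a - p b))))) @ \oo
    --> A - A * expR (- (1 / 2)).
  by apply: cvgB; [exact: cvg_cst|apply: cvgM => //; exact: cvg_cst].
have -> : (1 - expR (- (1 / 2))) * A = A - A * expR (- (1 / 2)) by ring.
rewrite -(cvg_lim _ h1)// -(cvg_lim _ wl)//; apply: ler_lim.
- by apply/cvg_ex; eexists; exact: h1.
- by apply/cvg_ex; exists l.
apply: nearW => m.
rewrite addrC -mulNr -[X in _ + X](avg_cst (m * m)) -avg_lin; apply: le_avg => s.
apply: (@le_trans _ _ `|omega m s (p a) - omega m s (p b)|); last first.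
  exact: (width_ge (fun j => omega m s (p j)) ain bin).
rewrite omegaZ omegaD omegaN add0r.
set w := omega _ _ _ - _.
have := one_sub_cos_le_norm (A^-1 * w).
rewrite normrM gtr0_norm ?invr_gt0// => h2.
have := ler_wpM2l (ltW Ap) h2; rewrite mulVKf//; lra.
Qed.

End width_bounds.

(** * Conditionally negative definite kernels *)
Section cnd_theory.
Variable R : realType.

Lemma cndD (T : Type) (K K' : T -> T -> R) : cnd K -> cnd K' ->
  cnd (fun u v => K u v + K' u v).
Proof.
move=> cK cK' s s0; have := lerD (cK s s0) (cK' s s0); rewrite addr0.
apply: le_trans; rewrite -big_split; apply: ler_sum => x _ /=.
by rewrite -big_split; apply: ler_sum => y _ /=; rewrite mulrDr.
Qed.

Lemma cnd_comp (T T' : Type) (f : T -> T') (K : T' -> T' -> R) :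
  cnd K -> cnd (fun u v => K (f u) (f v)).
Proof.
move=> cK s s0; have := cK [seq (x.1, f x.2) | x <- s].
rewrite !big_map/= => /(_ s0); under eq_bigr do rewrite big_map/=; exact.
Qed.

Lemma cnd_lim (T : Type) (K_ : nat -> T -> T -> R) (K : T -> T -> R) :
  (forall n, cnd (K_ n)) -> (forall u v, (fun n => K_ n u v) @ \oo --> K u v) -> cnd K.
Proof.
move=> cK KK s s0.
have h : (fun n => \sum_(x <- s) \sum_(y <- s) x.1 * y.1 * K_ n x.2 y.2) @ \oo -->
    \sum_(x <- s) \sum_(y <- s) x.1 * y.1 * K x.2 y.2.
  have cs (F_ : nat -> R * T -> R) (F : R * T -> R) :
      (forall x, F_ ^~ x @ \oo --> F x) ->
      forall r, (fun n => \sum_(x <- r) F_ n x) @ \oo --> \sum_(x <- r) F x.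
    move=> FF; elim=> [|x r ih].
      by under eq_fun do rewrite big_nil; rewrite big_nil; exact: cvg_cst.
    by under eq_fun do rewrite big_cons; rewrite big_cons; apply: cvgD.
  apply: (cs (fun n x => \sum_(y <- s) x.1 * y.1 * K_ n x.2 y.2)) => x.
  apply: (cs (fun n y => x.1 * y.1 * K_ n x.2 y.2)) => y.
  by apply: cvgM; [exact: cvg_cst|exact: KK].
rewrite -(cvg_lim _ h)//; apply: limr_le; first by apply/cvg_ex; eexists; exact: h.
by apply: nearW => n; exact: cK.
Qed.

(** The sum is that of the squares of the class sums of the coefficients, each
    class being counted once through the weights [1 / n]. *)
Lemma equivalence_psd (T : eqType) (E : rel T) (s : seq (R * T)) :
  symmetric E -> transitive E ->
  0 <= \sum_(x <- s) \sum_(y <- s) x.1 * y.1 * (E x.2 y.2)%:R.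
Proof.
move=> Es Et; pose n (x : R * T) : R := \sum_(y <- s) (E x.2 y.2)%:R.
have n_ge0 x : 0 <= n x by apply: sumr_ge0.
have key x y : x \in s -> \sum_(k <- s) (n k)^-1 * ((E k.2 x.2)%:R * (E k.2 y.2)%:R)
    = (E x.2 y.2)%:R.
  move=> xs; have [Exy|nExy] := boolP (E x.2 y.2); last first.
    rewrite big1// => k _; have [Ekx|] := boolP (E k.2 x.2); last by rewrite mul0r mulr0.
    have [Eky|] := boolP (E k.2 y.2); last by rewrite !mulr0.
    by move: nExy; rewrite (Et k.2)// Es.
  have nx : 0 < n x.
    rewrite /n; apply: (@lt_le_trans _ _ (E x.2 x.2)%:R).
      by rewrite (Et y.2)// Es.
    by rewrite (big_rem x)//= lerDl sumr_ge0.
  transitivity (\sum_(k <- s) (n x)^-1 * (E x.2 k.2)%:R); last first.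
    by rewrite -mulr_sumr -/(n x) mulVf// gt_eqF.
  apply: eq_bigr => k _; rewrite (Es x.2); have [Ekx|] := boolP (E k.2 x.2); last by rewrite mul0r !mulr0.
  rewrite (Et x.2 _ _ Ekx Exy) mulr1; congr (_^-1 * _).
  apply: eq_bigr => z _; congr (_%:R); congr nat_of_bool.
  by apply/idP/idP => h; apply: Et h => //; rewrite Es.
have -> : \sum_(x <- s) \sum_(y <- s) x.1 * y.1 * (E x.2 y.2)%:R =
    \sum_(k <- s) (n k)^-1 * (\sum_(x <- s) x.1 * (E k.2 x.2)%:R) ^+ 2.
  transitivity (\sum_(x <- s) \sum_(y <- s) \sum_(k <- s)
      x.1 * y.1 * ((n k)^-1 * ((E k.2 x.2)%:R * (E k.2 y.2)%:R))).
    apply: eq_big_seq => x xs; apply: eq_bigr => y _.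
    by rewrite -mulr_sumr key.
  under eq_bigr do rewrite exchange_big/=.
  rewrite exchange_big/=; apply: eq_bigr => k _.
  rewrite expr2 mulr_suml mulr_sumr; apply: eq_bigr => x _.
  by rewrite !mulr_sumr; apply: eq_bigr => y _; ring.
by apply: sumr_ge0 => k _; rewrite mulr_ge0 ?invr_ge0 ?sqr_ge0.
Qed.

Lemma sum_prod_zero (T : Type) (s : seq (R * T)) (c : R) : \sum_(x <- s) x.1 = 0 ->
  \sum_(x <- s) \sum_(y <- s) x.1 * y.1 * c = 0.
Proof.
move=> s0; transitivity ((\sum_(x <- s) x.1) * \sum_(y <- s) y.1 * c).
  rewrite mulr_suml; apply: eq_bigr => x _; rewrite mulr_sumr.
  by apply: eq_bigr => y _; rewrite mulrA.
by rewrite s0 mul0r.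
Qed.

Lemma cnd_neq (T : eqType) : cnd (fun u v : T => (u != v)%:R : R).
Proof.
move=> s s0.
have h := @equivalence_psd T (fun u v => u == v) s (@eq_sym T) (@eq_op_trans T).
have -> : \sum_(x <- s) \sum_(y <- s) x.1 * y.1 * (x.2 != y.2)%:R =
    \sum_(x <- s) \sum_(y <- s) x.1 * y.1 * 1 -
    \sum_(x <- s) \sum_(y <- s) x.1 * y.1 * (x.2 == y.2)%:R :> R.
  rewrite -sumrB; apply: eq_bigr => x _; rewrite -sumrB; apply: eq_bigr => y _.
  by case: eqP => _ /=; ring.
by rewrite sum_prod_zero// sub0r oppr_le0.
Qed.

(** Layer-cake: an ultrametric kernel is a combination with nonnegative
    coefficients of the kernels [x, y |-> (b < M x y)], and [M x y <= b] is
    symmetric and transitive. *)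
Lemma cnd_ultrametric (T : eqType) (M : T -> T -> R) :
  (forall u v, M u v = M v u) ->
  (forall u v w, M u w <= Num.max (M u v) (M v w)) -> cnd M.
Proof.
move=> MC MT s s0.
suff h (vs : seq R) : sorted (fun a b => b < a) vs ->
    forall M : T -> T -> R, (forall u v, M u v = M v u) ->
    (forall u v w, M u w <= Num.max (M u v) (M v w)) ->
    (forall x y, x \in s -> y \in s -> M x.2 y.2 \in vs) ->
    \sum_(x <- s) \sum_(y <- s) x.1 * y.1 * M x.2 y.2 <= 0.
  pose vs := [seq M x.2 y.2 | x <- s, y <- s].
  apply: (h (rev (sort <=%R (undup vs)))) => //.
    rewrite rev_sorted -(@eq_sorted _ <%R)//.
    by rewrite lt_sorted_uniq_le sort_uniq undup_uniq sort_sorted//; exact: le_total.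
  move=> x y xs ys; rewrite mem_rev mem_sort mem_undup.
  by apply/allpairsP; exists (x, y).
elim: vs => [_ {MC MT}M _ _ Mv|b vs ih bvs {MC MT}M MC MT Mv].
  case: s s0 Mv => [_ _|x s' _ /(_ x x)]; first by rewrite big_nil.
  by rewrite mem_head => /(_ isT isT).
case: vs ih bvs Mv => [_ _ Mv|b' vs ih /andP[b'b sv] Mv].
  rewrite le_eqVlt; apply/orP; left; apply/eqP; rewrite -[RHS](sum_prod_zero b s0).
  apply: eq_big_seq => x xs; apply: eq_big_seq => y ys.
  by have := Mv x y xs ys; rewrite inE => /eqP ->.
pose M' u v := Num.min (M u v) b'.
have hM' : \sum_(x <- s) \sum_(y <- s) x.1 * y.1 * M' x.2 y.2 <= 0.
  apply: ih => //.
  - by move=> u v; rewrite /M' MC.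
  - by move=> u v w; rewrite /M' -min_maxl le_min !ge_min MT lexx orbT.
  - move=> x y xs ys; have := Mv x y xs ys; rewrite /M' inE => /predU1P[->|Mvs].
      by rewrite min_r ?mem_head// ltW.
    rewrite min_l//; move: Mvs; rewrite inE => /predU1P[->//|].
    by move/(order_path_min (rev_trans lt_trans))/allP: sv => h /h /ltW.
have Et : transitive (fun u v => M u v <= b').
  by move=> v u w uv vw; apply: le_trans (MT u v w) _; rewrite ge_max uv.
have Es : symmetric (fun u v => M u v <= b') by move=> u v; rewrite MC.
have hE := equivalence_psd s Es Et.
have -> : \sum_(x <- s) \sum_(y <- s) x.1 * y.1 * M x.2 y.2 =
  \sum_(x <- s) \sum_(y <- s) x.1 * y.1 * M' x.2 y.2 +
  \sum_(x <- s) \sum_(y <- s) x.1 * y.1 * (b - b') -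
  (b - b') * (\sum_(x <- s) \sum_(y <- s) x.1 * y.1 * (M x.2 y.2 <= b')%R%:R).
  rewrite -big_split mulr_sumr -sumrB; apply: eq_big_seq => x xs /=.
  rewrite -big_split mulr_sumr -sumrB; apply: eq_big_seq => y ys /=.
  rewrite /M'; have := Mv x y xs ys; rewrite inE => /predU1P[->|Mvs].
    by rewrite (min_r (ltW b'b)) leNgt b'b/=; ring.
  have le : M x.2 y.2 <= b'.
    move: Mvs; rewrite inE => /predU1P[->//|].
    by move/(order_path_min (rev_trans lt_trans))/allP: sv => h /h /ltW.
  by rewrite min_l// le/=; ring.
rewrite (sum_prod_zero _ s0) addr0.
have : 0 <= (b - b') * \sum_(x <- s) \sum_(y <- s) x.1 * y.1 * (M x.2 y.2 <= b')%R%:R.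
  by rewrite mulr_ge0// subr_ge0 ltW.
lra.
Qed.

End cnd_theory.

(** * Mean width along an equivariant map *)
Section coordinates.
Context d (T : measurableType d) (R : realType) (mu : {measure set T -> \bar R}).
Local Notation X := (LspaceType2 mu).

(** Gram-Schmidt on a countable family gives finitely supported coordinates,
    without reference to the ambient space. *)
Lemma finite_coordinates (J : Type) (en : nat -> J) (idx : J -> nat) (psi : J -> X) :
  cancel idx en -> exists vec : J -> {poly R}, forall a b,
    pdot (vec a) (fun i => (vec b)`_i) = ip (psi a) (psi b).
Proof.
move=> idxK; pose k i j := ip (psi (en i)) (psi (en j)).
have kC i j : k i j = k j i by exact: ipC.
have k0 p : 0 <= gform k p p.
  have -> : gform k p p = ip (\sum_(i < size p) p`_i *: psi (en i))
                             (\sum_(i < size p) p`_i *: psi (en i)).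
    rewrite ip_suml; apply: eq_bigr => i _; rewrite ipZl ip_sumr; congr (_ * _).
    by apply: eq_bigr => j _; rewrite ipZr.
  by rewrite ip_norm sqr_ge0.
exists (fun a => gs_coord k 'X^(idx a)) => a b.
by rewrite (pdot_gs_coord kC k0) gformXX /k !idxK.
Qed.

End coordinates.

Section mean_width.
Variables (R : realType) (Gam : groupType) (psi : Gam -> L2 R).
Variables (en : nat -> Gam) (idx : Gam -> nat).
Hypothesis idxK : cancel idx en.
Hypothesis psi_equiv : equivariant psi.

Lemma equivariant_dist h a b : `|psi (h * a)%g - psi (h * b)%g| = `|psi a - psi b|.
Proof.
have [al [iso al1 alM] psiE] := psi_equiv.
by rewrite !psiE !alM /=; have [_ ->] := iso h.
Qed.

(** The width does not see a common translation of the points, and after moving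
    the first one to the origin the inner products are determined by the
    distances, which the action preserves: hence the invariance. *)
Lemma mean_width_exists : exists vec : Gam -> {poly R}, [/\
  forall b0 bs, cvgn (gavg vec (width b0 bs)),
  forall h b0 bs, limn (gavg vec (width (h * b0)%g [seq (h * b)%g | b <- bs])) =
     limn (gavg vec (width b0 bs)) &
  forall b0 bs a b, a \in b0 :: bs -> b \in b0 :: bs ->
    (1 - expR (- (1 / 2))) * `|psi a - psi b| <= limn (gavg vec (width b0 bs)) ].
Proof.
have [vec vecP] := finite_coordinates psi idxK.
exists vec.
have cv b0 bs : cvgn (gavg vec (width b0 bs)).
  have sg : same_gram vec vec by [].
  by have [l [vl _]] := gavg_width b0 bs sg; apply/cvg_ex; exists l.
have sq a b : sqnorm (vec a - vec b) = `|psi a - psi b| ^+ 2.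
  rewrite norm_sqrB -!ip_norm -!vecP /sqnorm.
  rewrite -scaleN1r pdotD pdotZ pdot_coefC (pdot_coefC (vec b)) !pdotD !pdotZ.
  by rewrite (pdot_coefC (vec b) (vec a)); ring.
split=> // [h b0 bs|b0 bs a b ain bin]; last first.
  have := gavg_width_lb ain bin (cv b0 bs).
  by rewrite sq sqrtr_sqr normr_id.
have -> : gavg vec (width (h * b0)%g [seq (h * b)%g | b <- bs]) =
    gavg (fun a => vec (h * a)%g) (width b0 bs).
  apply/funext => m; apply: eq_avg => s.
  by rewrite /width /max_over !big_map.
rewrite -(gavg_width_shift _ _ _ (vec (h * b0)%g)) -(gavg_width_shift vec _ _ (vec b0)).
have sg : same_gram (fun a => vec (h * a)%g - vec (h * b0)%g) (fun a => vec a - vec b0).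
  have pol (x y : {poly R}) : pdot x (fun i => y`_i) = (sqnorm x + sqnorm y - sqnorm (x - y)) / 2.
    rewrite /sqnorm -(scaleN1r y) !pdotD pdotZ.
    rewrite (pdot_coefC x (x + _)) (pdot_coefC y (x + _)) !pdotD !pdotZ (pdot_coefC y x).
    by field.
  move=> a b; rewrite !pol.
  have e (x y z : {poly R}) : x - y - (z - y) = x - z by rewrite opprB addrA subrK.
  by rewrite !e !sq !equivariant_dist.
have [l [h1 h2]] := gavg_width b0 bs sg.
by rewrite (cvg_lim _ h1)// (cvg_lim _ h2).
Qed.

End mean_width.

(** * The kernel on the wreath product *)
Lemma neq_triangle (R : numDomainType) (T : eqType) (a b c : T) :
  (a != c)%:R <= (a != b)%:R + (b != c)%:R :> R.
Proof.
rewrite -natrD ler_nat; have [<-|ab] := eqVneq a b; first by rewrite add0n.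
exact: leq_trans (leq_b1 _) (leq_addr _ _).
Qed.

Section lamp_difference.
Variables G H : groupType.
Implicit Types u v w : wreath G H.

Definition dif u v : seq H := finmap.enum_fset (fset_set [set z | lamps u z <> lamps v z]).

Lemma mem_dif u v z : (z \in dif u v) = (lamps u z != lamps v z).
Proof.
rewrite [LHS](@in_fset_set H _ _ z); last first.
  apply: (@sub_finite_set _ _ ([set z | lamps u z <> 1%g] `|` [set z | lamps v z <> 1%g])).
    move=> x /= uv; have [ux|] := pselect (lamps u x = 1%g); last by left.
    by right => vx; apply: uv; rewrite ux vx.
  by rewrite finite_setU; split; exact: lamps_fin.
by apply/idP/idP => [/set_mem h|/eqP h]; [exact/eqP|exact/mem_set].
Qed.

Lemma dif_uniq u v : uniq (dif u v).
Proof. exact: finmap.fset_uniq. Qed.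

Lemma dif_trans u v w z : z \in dif u w -> (z \in dif u v) || (z \in dif v w).
Proof.
rewrite !mem_dif; case: (eqVneq (lamps u z) (lamps v z)) => [->|//].
by [].
Qed.

Lemma dif_mul g u v : perm_eq (dif (g * u)%g (g * v)%g) [seq (cursor g * z)%g | z <- dif u v].
Proof.
apply: uniq_perm; first exact: dif_uniq.
  by rewrite map_inj_uniq ?dif_uniq//; exact: mulgI.
move=> z; rewrite mem_dif /= (inj_eq (mulgI _)).
apply/idP/mapP => [h|[x + ->]]; last by rewrite mem_dif mulKg.
by exists ((cursor g)^-1 * z)%g; rewrite ?mulVKg// mem_dif.
Qed.

Lemma dif_sym u v : dif u v =i dif v u.
Proof. by move=> z; rewrite !mem_dif eq_sym. Qed.

Lemma dif_diag u : dif u u = [::].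
Proof.
apply/eqP; rewrite -size_eq0 size_eq0; apply/eqP/nilP/nilP.
case E : (dif u u) => [//|z s].
by have := mem_head z s; rewrite -E mem_dif eqxx.
Qed.

End lamp_difference.

Section wreath_kernel.
Variables (R : realType) (G H : groupType).
Implicit Types u v w : wreath G H.

Definition step_max (t : H -> R) u v : R := max_over (cursor u) (cursor v :: dif u v) t.

Lemma step_max_sym t u v : step_max t u v = step_max t v u.
Proof.
apply/eqP; rewrite eq_le; apply/andP; split; apply: max_over_le => b bin;
  apply: max_over_ge; move: bin; rewrite !inE (dif_sym u v) => /or3P[->|->|->];
  by rewrite ?orbT.
Qed.

(** A lamp that differs between [u] and [w] differs between [u] and [v] or
    between [v] and [w]. *)
Lemma step_max_ultra t u v w :
  step_max t u w <= Num.max (step_max t u v) (step_max t v w).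
Proof.
apply: max_over_le => b; rewrite inE => /orP[/eqP ->|].
  by rewrite le_max max_over_default.
rewrite inE => /orP[/eqP ->|/(dif_trans v)/orP[|] bd].
- have h : t (cursor w) <= step_max t v w by apply: max_over_ge; rewrite !inE eqxx orbT.
  by rewrite le_max h orbT.
- have h : t b <= step_max t u v by apply: max_over_ge; rewrite !inE bd !orbT.
  by rewrite le_max h.
- have h : t b <= step_max t v w by apply: max_over_ge; rewrite !inE bd !orbT.
  by rewrite le_max h orbT.
Qed.

Definition step_width (t : H -> R) u v := width (cursor u) (cursor v :: dif u v) t.

Lemma step_widthE t u v :
  step_width t u v = step_max t u v + step_max (fun j => - t j) u v.
Proof. by []. Qed.

(** The sets of the pairs [u, v] and [v, w] share the cursor of [v], so that the
    width of their union is at most the sum of their widths. *)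
Lemma step_width_triangle t u v w :
  step_width t u w <= step_width t u v + step_width t v w.
Proof.
have cm (t' : H -> R) : t' (cursor v) <= step_max t' u v /\ t' (cursor v) <= step_max t' v w.
  have cin : cursor v \in [:: cursor u, cursor v & dif u v] by rewrite !inE eqxx orbT.
  by split; [exact: max_over_ge cin|exact: max_over_default].
have [a1 a2] := cm t; have [b1 b2] := cm (fun j => - t j).
have := step_max_ultra t u v w; have := step_max_ultra (fun j => - t j) u v w.
rewrite !step_widthE !le_max => /orP[h1|h1] /orP[h2|h2]; lra.
Qed.

Variables (psi : H -> L2 R) (phi : G -> L2 R).
Variables (enG : nat -> G) (idxG : G -> nat) (enH : nat -> H) (idxH : H -> nat).
Hypotheses (idxGK : cancel idxG enG) (idxHK : cancel idxH enH).
Hypotheses (psi_equiv : equivariant psi) (phi_equiv : equivariant phi).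

Let k0 : R := 1 - expR (- (1 / 2)).

(** Negativity, triangle inequality and symmetry hold for each value of the
    random form, hence for the limits of the means; invariance holds in the limit
    only. *)
Lemma wreath_kernel_exists : exists K : wreath G H -> wreath G H -> R,
  [/\ forall u v, K u v = K v u, forall u, K u u = 0,
      forall g u v, K (g * u)%g (g * v)%g = K u v, cnd K &
      forall u v w, K u w <= K u v + K v w] /\
  forall u v a b, a \in [:: cursor u, cursor v & dif u v] ->
    b \in [:: cursor u, cursor v & dif u v] ->
    k0 * `|psi a - psi b| + (cursor u != cursor v)%:R + (size (dif u v))%:R
      + k0 * \sum_(z <- dif u v) `|phi (lamps u z) - phi (lamps v z)| <= K u v.
Proof.
have [vecH [cvH invH lbH]] := mean_width_exists idxHK psi_equiv.
have [vecG [cvG invG lbG]] := mean_width_exists idxGK phi_equiv.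
pose K1 u v := limn (gavg vecH (width (cursor u) (cursor v :: dif u v))).
pose DG0 a b := limn (gavg vecG (width a [:: b])).
pose DG a b := DG0 a b + (a != b)%:R.
pose K2 u v := \sum_(z <- dif u v) DG (lamps u z) (lamps v z).
pose K3 u v : R := (cursor u != cursor v)%:R.
have lim_leD (J : Type) (vec : J -> {poly R}) F F' F'' : cvgn (gavg vec F) ->
    cvgn (gavg vec F') -> cvgn (gavg vec F'') -> (forall t, F t <= F' t + F'' t) ->
    limn (gavg vec F) <= limn (gavg vec F') + limn (gavg vec F'').
  move=> c c' c'' FF; rewrite -limD//; apply: ler_lim => //; first exact: is_cvgD.
  by apply: nearW => m /=; rewrite -[leRHS]avgD; apply: le_avg.
have lim_eq (J : Type) (vec : J -> {poly R}) F F' : F =1 F' ->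
    limn (gavg vec F) = limn (gavg vec F') by move=> /funext ->.
have K1C u v : K1 u v = K1 v u.
  by apply: lim_eq => t; rewrite -!/(step_width _ _ _) !step_widthE !(step_max_sym _ u).
have w0 (J : Type) (b : J) (t : J -> R) : width b [:: b] t = 0.
  by rewrite /width /max_over !big_cons !big_nil !maxxx subrr.
have lim0 (J : Type) (vec : J -> {poly R}) b : limn (gavg vec (width b [:: b])) = 0.
  have -> : gavg vec (width b [:: b]) = fun=> 0.
    by apply/funext => m; rewrite -[RHS](avg_cst (m * m)); apply: eq_avg => s; exact: w0.
  by rewrite lim_cst.
have K10 u : K1 u u = 0 by rewrite /K1 dif_diag lim0.
have K1M g u v : K1 (g * u)%g (g * v)%g = K1 u v.
  rewrite /K1 -(invH (cursor g) (cursor u)); apply: lim_eq => t.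
  have e (t' : H -> R) : max_over (cursor (g * u)%g) (cursor (g * v)%g :: dif (g * u)%g (g * v)%g) t' =
     max_over (cursor g * cursor u)%g [seq (cursor g * b)%g | b <- cursor v :: dif u v] t'.
    by apply/eqP; rewrite eq_le; apply/andP; split; apply: max_over_le => b bin;
      apply: max_over_ge; move: bin; rewrite /= !inE (perm_mem (dif_mul g u v)).
  by rewrite /width !e.
have avg_sum2 (W : Type) m (s : seq (R * W)) (F : W -> W -> seq R -> R) :
    avg m (fun r => \sum_(x <- s) \sum_(y <- s) x.1 * y.1 * F x.2 y.2 r) =
    \sum_(x <- s) \sum_(y <- s) x.1 * y.1 * avg m (F x.2 y.2).
  transitivity (avg m (fun r => \sum_(x <- s) 1 * \sum_(y <- s) x.1 * y.1 * F x.2 y.2 r)).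
    by apply: eq_avg => r; apply: eq_bigr => x _; rewrite mul1r.
  by rewrite avg_sum; apply: eq_bigr => x _; rewrite mul1r avg_sum.
have cnd_width (t : H -> R) : cnd (step_width t).
  by apply: cndD; apply: cnd_ultrametric; by [exact: step_max_sym|exact: step_max_ultra].
have K1cnd : cnd K1.
  apply: (cnd_lim (K_ := fun m u v => gavg vecH (width (cursor u) (cursor v :: dif u v)) m)).
    move=> m s s0; have := le_avg (m * m) (fun r => cnd_width (fun j => omega m r (vecH j)) s s0).
    rewrite avg_cst => h; apply: le_trans h.
    by rewrite -[leLHS](avg_sum2 _ (m * m)%N s
      (fun u v r => step_width (fun j => omega m r (vecH j)) u v)).
  by move=> u v; exact: cvH.
have K1T u v w : K1 u w <= K1 u v + K1 v w.
  by apply: lim_leD => // t; exact: step_width_triangle.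
have DGC a b : DG a b = DG b a.
  rewrite /DG eq_sym; congr (_ + _); apply: lim_eq => t.
  by rewrite /width /max_over !big_cons !big_nil maxC (maxC (- t b)).
have DG0' a : DG a a = 0 by rewrite /DG /DG0 lim0 eqxx addr0.
have DGM g a b : DG (g * a)%g (g * b)%g = DG a b.
  by rewrite /DG (inj_eq (mulgI g)) /DG0 -(invG g a [:: b]).
have wT (t : G -> R) a b c : width a [:: c] t <= width a [:: b] t + width b [:: c] t.
  rewrite /width /max_over !big_cons !big_nil !maxEle.
  by case: (leP (t c) (t a)) => h1; case: (leP (t b) (t a)) => h2; case: (leP (t c) (t b)) => h3;
    rewrite !lerN2; case: (leP (t a) (t c)) => h4; case: (leP (t a) (t b)) => h5;
    case: (leP (t b) (t c)) => h6; lra.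
have DGT a b c : DG a c <= DG a b + DG b c.
  rewrite /DG addrACA; apply: lerD; first by apply: lim_leD => // t; exact: wT.
  exact: neq_triangle.
have cnd_pair (t : G -> R) : cnd (fun a b => width a [:: b] t).
  have cnd_max (t' : G -> R) : cnd (fun a b => max_over a [:: b] t').
    apply: cnd_ultrametric => [a b|a b c]; rewrite /max_over !big_cons !big_nil.
      exact: maxC.
    by rewrite ge_max !le_max !lexx !orbT.
  exact: (cndD (cnd_max t) (cnd_max (fun j => - t j))).
have DGcnd : cnd DG.
  apply: cndD; last exact: cnd_neq.
  apply: (cnd_lim (K_ := fun m a b => gavg vecG (width a [:: b]) m)); last by move=> *; exact: cvG.
  move=> m s s0; have := le_avg (m * m) (fun r => cnd_pair (fun j => omega m r (vecG j)) s s0).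
  rewrite avg_cst => h; apply: le_trans h.
  by rewrite -[leLHS](avg_sum2 _ (m * m)%N s
    (fun a b r => width a [:: b] (fun j => omega m r (vecG j)))).
(* on a common finite set of positions, the sums over [dif] can be exchanged with
   the others *)
have K2E u v (Z : seq H) : uniq Z -> {subset dif u v <= Z} ->
    K2 u v = \sum_(z <- Z) DG (lamps u z) (lamps v z).
  move=> uZ dZ; rewrite (bigID (fun z => z \in dif u v))/= [X in _ + X]big1 ?addr0; last first.
    by move=> z; rewrite mem_dif negbK => /eqP ->.
  rewrite -big_filter; apply: perm_big; apply: uniq_perm; rewrite ?dif_uniq ?filter_uniq//.
  by move=> z; rewrite mem_filter; case: (boolP (z \in dif u v)) => // /dZ ->.
have K2C u v : K2 u v = K2 v u.
  rewrite (@K2E _ _ (dif v u)) ?dif_uniq//; last by move=> z; rewrite dif_sym.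
  by apply: eq_bigr => z _; exact: DGC.
have K20 u : K2 u u = 0 by rewrite /K2 dif_diag big_nil.
have K2M g u v : K2 (g * u)%g (g * v)%g = K2 u v.
  rewrite /K2 (perm_big _ (dif_mul g u v)) big_map; apply: eq_bigr => z _ /=.
  by rewrite DGM mulKg.
have K2cnd : cnd K2.
  move=> s s0; pose Z := undup (flatten [seq dif x.2 y.2 | x <- s, y <- s]).
  have -> : \sum_(x <- s) \sum_(y <- s) x.1 * y.1 * K2 x.2 y.2 =
    \sum_(z <- Z) \sum_(x <- s) \sum_(y <- s) x.1 * y.1 * DG (lamps x.2 z) (lamps y.2 z).
    rewrite [RHS]exchange_big/=; apply: eq_big_seq => x xs.
    rewrite [RHS]exchange_big/=; apply: eq_big_seq => y ys.
    rewrite (@K2E _ _ Z) ?undup_uniq ?mulr_sumr// => z zd.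
    by rewrite mem_undup; apply/flattenP; exists (dif x.2 y.2) => //; apply/allpairsP; exists (x, y).
  rewrite -oppr_ge0 -sumrN; apply: sumr_ge0 => z _; rewrite oppr_ge0.
  exact: (@cnd_comp _ _ _ (fun u : wreath G H => lamps u z) _ DGcnd).
have K2T u v w : K2 u w <= K2 u v + K2 v w.
  pose Z := undup (dif u v ++ dif v w ++ dif u w).
  have sub a b : {subset dif a b <= dif u v ++ dif v w ++ dif u w} ->
      K2 a b = \sum_(z <- Z) DG (lamps a z) (lamps b z).
    by move=> sb; rewrite (@K2E _ _ Z) ?undup_uniq// => z /sb; rewrite mem_undup.
  rewrite !sub; first by rewrite -big_split; apply: ler_sum => z _; exact: DGT.
  - by move=> z; rewrite !mem_cat => ->; rewrite orbT.
  - by move=> z; rewrite !mem_cat => ->.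
  - by move=> z; rewrite !mem_cat => ->; rewrite !orbT.
exists (fun u v => K1 u v + K3 u v + K2 u v); split; first split.
- by move=> u v; rewrite K1C K2C /K3 eq_sym.
- by move=> u; rewrite K10 K20 /K3 eqxx !addr0.
- by move=> g u v; rewrite K1M K2M /K3 /= (inj_eq (mulgI _)).
- apply: cndD => //; apply: cndD => //.
  exact: (@cnd_comp _ _ _ (@cursor G H) _ (@cnd_neq R H)).
- move=> u v w; have := K1T u v w; have := K2T u v w.
  have : K3 u w <= K3 u v + K3 v w by exact: neq_triangle.
  lra.
move=> u v a b ain bin.
have h1 := lbH _ _ _ _ ain bin; rewrite -/(K1 u v) -/k0 in h1.
have h2 : (size (dif u v))%:R + k0 * \sum_(z <- dif u v) `|phi (lamps u z) - phi (lamps v z)|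
    <= K2 u v.
  rewrite -sum1_size natr_sum mulr_sumr -big_split/= big_seq [leRHS]big_seq.
  apply: ler_sum => z; rewrite mem_dif => zd; rewrite /DG zd addrC lerD2r.
  by apply: lbG; rewrite !inE eqxx ?orbT.
move: h1 h2; rewrite /K3; lra.
Qed.

End wreath_kernel.

(** * Word metrics *)
Section words.
Variable Gam : groupType.
Implicit Types (S : set Gam) (g h : Gam).
Local Open Scope group_scope.

Lemma spellsM S n m g h : spells S n g -> spells S m h -> spells S (n + m) (g * h).
Proof.
move=> [w [<- wS <-]] [w' [<- w'S <-]]; exists (w ++ w'); split.
- by rewrite size_cat.
- by move=> s; rewrite mem_cat => /orP[/wS|/w'S].
- by rewrite big_cat.
Qed.

Lemma spells_hom (Gam' : groupType) (S : set Gam) (S' : set Gam') (f : Gam -> Gam') n g :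
  f 1 = 1 -> {morph f : a b / a * b} -> (forall s, S s -> S' (f s)) ->
  spells S n g -> spells S' n (f g).
Proof.
move=> f1 fM fS [w [<- wS <-]]; exists (map f w); split; first by rewrite size_map.
  have fV a : f a^-1 = (f a)^-1.
    by apply: (mulgI (f a)); rewrite -fM !mulgV.
  move=> _ /mapP[s sw ->]; have [/fS|/fS] := wS s sw; first by left.
  by rewrite fV; right.
by rewrite big_map; elim: w {wS} => [|a w ih]; rewrite ?big_nil// !big_cons fM ih.
Qed.

Lemma word_length_le S n g : spells S n g -> (word_length S g <= n)%N.
Proof.
rewrite /word_length; case: xgetP => [m -> [_ mle]|_ _]; [exact: mle|exact: leq0n].
Qed.

Lemma word_dist_spells S g h : generates S -> spells S (word_dist S g h) (g^-1 * h).
Proof. by move=> genS; have [] := word_lengthP (g^-1 * h) genS. Qed.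

Lemma generated_countable S : finite_set S -> generates S ->
  exists (en : nat -> Gam) (idx : Gam -> nat), cancel idx en.
Proof.
move=> /finite_seqP[l lS] genS.
pose l' := l ++ map (fun s => s^-1) l.
pose en n := \prod_(i <- CodeSeq.decode n) nth 1 l' i.
suff h g : exists n, en n = g.
  by have [idx idxP] := boolp.choice h; exists en, idx.
have [n [w [_ wS <-]]] := genS g.
exists (CodeSeq.code [seq index s l' | s <- w]).
rewrite /en CodeSeq.codeK big_map; apply: eq_big_seq => s sw.
rewrite nth_index// /l' mem_cat; have := wS s sw; rewrite lS /= => -[->//|sl].
by apply/orP; right; apply/mapP; exists s^-1; rewrite ?invgK.
Qed.

(** By the triangle inequality along a word, the constant being a bound for the
    values of [K] on the finitely many generators. *)
Lemma subadditive_le_word (R : realType) S (K : Gam -> Gam -> R) :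
  finite_set S -> generates S ->
  (forall u v, K u v = K v u) -> (forall u, K u u = 0) ->
  (forall g u v, K (g * u) (g * v) = K u v) ->
  (forall u v w, (K u w <= K u v + K v w)%R) ->
  exists2 C : R, (0 < C)%R & forall u v, (K u v <= C * (word_dist S u v)%:R)%R.
Proof.
move=> /finite_seqP[l lS] genS KC K0 KM KT.
have K_ge0 u v : (0 <= K u v)%R by have := KT u v u; rewrite K0 (KC v u); lra.
pose C : R := (1 + \sum_(s <- l) K 1%g s)%R.
have C0 : (0 < C)%R by rewrite ltr_wpDr// sumr_ge0.
have Cs s : S s -> (K 1%g s <= C)%R.
  rewrite lS /= => sl; rewrite /C (big_rem s)//=.
  have : (0 <= \sum_(y <- rem s l) K 1%g y)%R by apply: sumr_ge0.
  lra.
exists C => // u v.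
have [w [<- wS uv]] := word_dist_spells u v genS.
have -> : K u v = K 1 (u^-1 * v) by rewrite -(KM u 1) mulg1 mulVKg.
rewrite -uv; elim: w wS {uv} => [|s w ih] wS; first by rewrite big_nil K0 mulr0.
rewrite big_cons (le_trans (KT 1 s _))//.
rewrite -{2}[s]mulg1 KM /= -natr1 mulrDr mulr1 addrC lerD//.
  by apply: ih => s' s'w; apply: wS; rewrite inE s'w orbT.
have [/Cs//|/Cs] := wS s (mem_head _ _).
by rewrite -(KM s) mulg1 mulgV KC.
Qed.

End words.

Section wreath_words.
Variables (G H : groupType) (S : set G) (T : set H).
Hypotheses (genS : generates S) (genT : generates T).
Implicit Types (u v : wreath G H).
Local Open Scope group_scope.

Lemma wreath_gens_finite : finite_set S -> finite_set T -> finite_set (wreath_gens S T).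
Proof. by move=> fS fT; rewrite finite_setU; split; exact: finite_image. Qed.

(** The lengths of the steps of a path of the cursor through the points of [s]. *)
Fixpoint tour (x : H) (s : seq H) (y : H) : seq nat :=
  if s is z :: s' then word_dist T x z :: tour z s' y else [:: word_dist T x y].

Definition lamp_costs u v (s : seq H) : seq nat :=
  [seq word_dist S (lamps u z) (lamps v z) | z <- s].

Lemma spells_base n (h : H) : spells T n h -> spells (wreath_gens S T) n (wreath_base G h).
Proof.
apply: (@spells_hom _ _ _ _ (@wreath_base G H)).
- exact: wreath_eq.
- by move=> a b; apply: wreath_eq => //= z; rewrite mulg1.
- by move=> s Ts; left; exists s.
Qed.

Lemma spells_lamp n (a : G) : spells S n a -> spells (wreath_gens S T) n (wreath_lamp H a).
Proof.
apply: (@spells_hom _ _ _ _ (@wreath_lamp G H)).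
- by apply: wreath_eq => //= z; rewrite /delta if_same.
- move=> b c; apply: wreath_eq => [z|] /=; last by rewrite mulg1.
  by rewrite invg1 mul1g /delta; case: eqP => _; rewrite ?mulg1.
- by move=> s Ss; right; exists s.
Qed.

(** The cursor visits the points of [s] in turn, changing at each of them the lamp
    of [u] into that of [v], before going to its final position. *)
Lemma wreath_spells u v (s : seq H) : uniq s ->
  (forall z, z \notin s -> lamps u z = lamps v z) ->
  spells (wreath_gens S T) (sumn (tour (cursor u) s (cursor v)) + sumn (lamp_costs u v s))
    (u^-1 * v).
Proof.
elim: s u => [|z s ih] u.
  move=> _ uv; rewrite /= !addn0.
  have -> : u^-1 * v = wreath_base G ((cursor u)^-1 * cursor v).
    by apply: wreath_eq => //= z; rewrite invgK uv// mulVg.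
  exact/spells_base/word_dist_spells.
move=> /= /andP[zs us] uv.
pose b := wreath_base G ((cursor u)^-1 * z).
pose l := wreath_lamp H ((lamps u z)^-1 * lamps v z).
pose u2 := u * b * l.
have cu2 : cursor u2 = z by rewrite /u2 /= mulg1 mulVKg.
have lu2 w : lamps u2 w = if w == z then lamps v z else lamps u w.
  rewrite /u2 /= mulg1 mulVKg /delta -(inj_eq (mulgI z)) mulVKg mulg1.
  by case: eqP => [->|]; rewrite ?mulVKg ?mulg1.
have -> : u^-1 * v = b * l * (u2^-1 * v).
  by rewrite /u2 !invgM !mulgA mulgK mulgV mul1g.
have -> : (word_dist T (cursor u) z + sumn (tour z s (cursor v)) +
    (word_dist S (lamps u z) (lamps v z) + sumn (lamp_costs u v s)))%N =
    (word_dist T (cursor u) z + word_dist S (lamps u z) (lamps v z) +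
     (sumn (tour (cursor u2) s (cursor v)) + sumn (lamp_costs u2 v s)))%N.
  rewrite cu2 addnACA; congr (_ + (_ + sumn _))%N.
  apply/eq_in_map => w ws; rewrite lu2; case: eqP => // wz.
  by move: zs; rewrite -wz ws.
apply: spellsM; first apply: spellsM.
- exact/spells_base/word_dist_spells.
- exact/spells_lamp/word_dist_spells.
apply: ih => // w ws; rewrite lu2; case: eqP => [->//|/eqP wz].
by apply: uv; rewrite inE negb_or wz.
Qed.

Lemma wreath_generates : generates (wreath_gens S T).
Proof.
move=> v.
have v0 z : z \notin dif 1 v -> lamps (1 : wreath G H) z = lamps v z.
  by rewrite mem_dif negbK => /eqP.
have := wreath_spells (dif_uniq 1 v) v0; rewrite invg1 mul1g => sp.
by eexists; exact: sp.
Qed.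

Lemma wreath_dist_le u v : (word_dist (wreath_gens S T) u v <=
  sumn (tour (cursor u) (dif u v) (cursor v)) + sumn (lamp_costs u v (dif u v)))%N.
Proof.
apply/word_length_le/wreath_spells; first exact: dif_uniq.
by move=> z; rewrite mem_dif negbK => /eqP.
Qed.

Lemma size_tour x s y : size (tour x s y) = (size s).+1.
Proof. by elim: s x => //= z s ih x; rewrite ih. Qed.

Lemma mem_tour x s y k : k \in tour x s y ->
  exists a b, [/\ a \in [:: x, y & s], b \in [:: x, y & s] & k = word_dist T a b].
Proof.
elim: s x => [|z s ih] x /=.
  by rewrite inE => /eqP ->; exists x, y; rewrite !inE !eqxx ?orbT.
rewrite inE => /predU1P[->|/ih[a [b [ain bin ->]]]].
  by exists x, z; rewrite !inE !eqxx ?orbT.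
exists a, b; split=> //.
  by move: ain; rewrite !inE => /or3P[->|->|->]; rewrite ?orbT.
by move: bin; rewrite !inE => /or3P[->|->|->]; rewrite ?orbT.
Qed.

End wreath_words.

(** * The embedding *)
Lemma metrically_properP (R : realType) (Gam : groupType) (X : normedModType R)
    (dist : Gam -> Gam -> nat) (f : Gam -> X) :
  metrically_proper dist f <->
  forall M : R, exists t0, forall g h, `|f g - f h| <= M -> (dist g h <= t0)%N.
Proof.
split=> [/cvgeyPge pf M|pf].
  have [t0 _ ht0] := pf (M + 1).
  exists t0 => g h fgh; rewrite leqNgt; apply/negP => /ltnW t0d.
  have := ht0 t0 (leqnn _); apply/negP; rewrite -ltNge.
  apply: (@le_lt_trans _ _ (`|f g - f h|)%:E); last by rewrite lte_fin; lra.
  by apply: ereal_inf_lbound; exists (g, h).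
apply/cvgeyPge => M; have [t0 ht0] := pf M.
exists t0.+1 => // t /= t0t; apply: le_ereal_inf_tmp => _ [[g h] /= td <-].
rewrite lee_fin leNgt; apply/negP => /ltW/ht0; rewrite leqNgt => /negP; apply.
exact: leq_trans t0t td.
Qed.

Section trimming.
Variables (R : realType) (rho : nat -> R).
Hypotheses (rho_mono : {homo rho : s t / (s <= t)%N >-> s <= t}).

(** The compositions that define [nu1] have sum exactly [t], whereas a path only
    gives an upper bound for [t]: its parts have to be shortened. *)
Lemma trim_seq (l : seq nat) t : (t <= sumn l)%N -> exists l', [/\ size l' = size l,
  sumn l' = t & \sum_(k <- l') rho k <= \sum_(k <- l) rho k].
Proof.
elim: l t => [|a l ih] t /=.
  by rewrite leqn0 => /eqP ->; exists [::]; rewrite !big_nil.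
move=> tal; have [|l' [sl' suml' rl']] := ih (t - minn a t)%N; first by lia.
exists (minn a t :: l'); split; rewrite /= ?sl' ?suml' ?subnKC ?geq_minr//.
by rewrite !big_cons lerD// rho_mono// geq_minl.
Qed.

End trimming.

Section wreath_embedding.
Variables (R : realType) (G H : groupType) (S : set G) (T : set H).
Hypotheses (finS : finite_set S) (genS : generates S).
Hypotheses (finT : finite_set T) (genT : generates T).
Variables (psi : H -> L2 R) (phi : G -> L2 R).
Hypotheses (psi_equiv : equivariant psi) (phi_equiv : equivariant phi).

(** The equivariant map is that of the kernel; the constant [k] is that of
    [gavg_width_lb]. *)
Lemma wreath_embedding : exists (Phi : wreath G H -> L2 R) (k C : R),
  [/\ equivariant Phi, 0 < k, 0 < C,
      forall u v, `|Phi u - Phi v| ^+ 2 <= C * (word_dist (wreath_gens S T) u v)%:R &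
      forall u v a b, a \in [:: cursor u, cursor v & dif u v] ->
        b \in [:: cursor u, cursor v & dif u v] ->
        k * `|psi a - psi b| + (cursor u != cursor v)%:R + (size (dif u v))%:R
          + k * \sum_(z <- dif u v) `|phi (lamps u z) - phi (lamps v z)|
        <= `|Phi u - Phi v| ^+ 2].
Proof.
have [enG [idxG idxGK]] := generated_countable finS genS.
have [enH [idxH idxHK]] := generated_countable finT genT.
have finW := wreath_gens_finite finS finT.
have genW := wreath_generates genS genT.
have [en [idx idxK]] := generated_countable finW genW.
have [K [[KC K0 KM Kcnd KT] Klow]] :=
  wreath_kernel_exists idxGK idxHK psi_equiv phi_equiv.
have [Phi Phi_equiv PhiK] := equivariant_of_kernel idxK KC K0 KM Kcnd.
have [C C0 KC_] := subadditive_le_word finW genW KC K0 KM KT.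
have k0 : 0 < 1 - expR (- (1 / 2)) :> R.
  by rewrite subr_gt0 -[ltRHS]expR0 ltr_expR oppr_lt0 divr_gt0.
exists Phi, (1 - expR (- (1 / 2))), C; split=> // [u v|u v a b ain bin].
  by rewrite PhiK.
by rewrite PhiK; exact: Klow.
Qed.

Section compression.
Implicit Types u v : wreath G H.
Variables (Phi : wreath G H -> L2 R) (k : R).
Hypothesis k0 : 0 < k.
Hypothesis Phi_low : forall u v a b, a \in [:: cursor u, cursor v & dif u v] ->
        b \in [:: cursor u, cursor v & dif u v] ->
        k * `|psi a - psi b| + (cursor u != cursor v)%:R + (size (dif u v))%:R
          + k * \sum_(z <- dif u v) `|phi (lamps u z) - phi (lamps v z)|
        <= `|Phi u - Phi v| ^+ 2.

Let Q u v : R := `|Phi u - Phi v| ^+ 2.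

Let lamps_ge0 u v : 0 <= \sum_(z <- dif u v) `|phi (lamps u z) - phi (lamps v z)|.
Proof. exact: sumr_ge0. Qed.

Let psi_le u v a b : a \in [:: cursor u, cursor v & dif u v] ->
  b \in [:: cursor u, cursor v & dif u v] -> `|psi a - psi b| <= Q u v / k.
Proof.
move=> ain bin; rewrite ler_pdivlMr//; have := Phi_low ain bin.
have := mulr_ge0 (ltW k0) (lamps_ge0 u v).
have : 0 <= (cursor u != cursor v)%:R :> R by [].
have : 0 <= (size (dif u v))%:R :> R by [].
rewrite /Q; lra.
Qed.

Let base_low u v : (cursor u != cursor v)%:R + (size (dif u v))%:R
   + k * \sum_(z <- dif u v) `|phi (lamps u z) - phi (lamps v z)| <= Q u v.
Proof.
have cin : cursor u \in [:: cursor u, cursor v & dif u v] by exact: mem_head.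
by have := Phi_low cin cin; rewrite subrr normr0 mulr0 add0r.
Qed.

Let size_le u v : (size (dif u v))%:R <= Q u v.
Proof.
have := base_low u v; have := mulr_ge0 (ltW k0) (lamps_ge0 u v).
have : 0 <= (cursor u != cursor v)%:R :> R by [].
lra.
Qed.

Let phi_le u v : \sum_(z <- dif u v) `|phi (lamps u z) - phi (lamps v z)| <= Q u v / k.
Proof.
rewrite ler_pdivlMr// mulrC; have := base_low u v.
have : 0 <= (cursor u != cursor v)%:R :> R by [].
have : 0 <= (size (dif u v))%:R :> R by [].
lra.
Qed.

(** If the images are at distance at most [M], the number of lamps that differ is
    bounded in terms of [M], and so are all the steps of the cursor and the costs
    of the lamps, by properness of [psi] and [phi]. *)
Lemma wreath_proper :
  metrically_proper (word_dist S) phi -> metrically_proper (word_dist T) psi ->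
  metrically_proper (word_dist (wreath_gens S T)) Phi.
Proof.
move=> /metrically_properP pphi /metrically_properP ppsi; apply/metrically_properP => M.
have [rG hG] := pphi (M ^+ 2 / k); have [rH hH] := ppsi (M ^+ 2 / k).
pose N := Num.bound (M ^+ 2).
exists (N.+1 * rH + N * rG)%N => u v uvM.
have QM : Q u v <= M ^+ 2.
  by rewrite /Q lerXn2r ?nnegrE// (le_trans _ uvM).
have QMk : Q u v / k <= M ^+ 2 / k by rewrite ler_pM2r ?invr_gt0.
have dN : (size (dif u v) <= N)%N.
  rewrite -(ler_nat R) (le_trans (size_le u v))// (le_trans QM)// ltW//.
  by rewrite archi_boundP// sqr_ge0.
have sumn_le (l : seq nat) r n : (size l <= n)%N -> (forall x, x \in l -> x <= r)%N ->
    (sumn l <= n * r)%N.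
  move=> ln lr; apply: (@leq_trans (size l * r)%N); last by rewrite leq_mul2r ln orbT.
  elim: l lr {ln} => //= a l ih lr; rewrite mulSn leq_add ?lr ?mem_head// ih// => x xl.
  by apply: lr; rewrite inE xl orbT.
apply: leq_trans (wreath_dist_le genS genT u v) _; apply: leq_add; apply: sumn_le.
- by rewrite size_tour.
- move=> x /mem_tour[a [b [ain bin ->]]]; apply: hH.
  exact: le_trans (psi_le ain bin) QMk.
- by rewrite size_map.
- move=> x /mapP[z zd ->]; apply: hG; apply: le_trans QMk.
  apply: le_trans (phi_le u v); rewrite (big_rem z)//= lerDl.
  exact: sumr_ge0.
Qed.

(** The tour has [N + 1] steps, each contributing at most [Q / k], and
    [N + 1 <= 2 * Q] unless its only step is trivial.  The changes of the lamps
    contribute at most [Q / k].  Both sums are then compared with one element of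
    [nu1_values]. *)
Lemma wreath_compression (rho tau : nat -> R) :
  bounding_function rho -> bounding_function tau ->
  (forall x y : H, rho (word_dist T x y) <= `|psi x - psi y|) ->
  (forall x y : G, tau (word_dist S x y) <= `|phi x - phi y|) ->
  exists2 c : R, 0 < c & forall u v,
    c * nu1 rho tau (word_dist (wreath_gens S T) u v) <= `|Phi u - Phi v|.
Proof.
move=> [rho0 rho_ge0 rho_mono _] [tau0 tau_ge0 tau_mono _] rho_psi tau_phi.
pose A := Num.sqrt (2 / k) + k^-1.
have A0 : 0 < A by rewrite ltr_wpDl ?sqrtr_ge0// invr_gt0.
exists (Num.sqrt A)^-1; first by rewrite invr_gt0 sqrtr_gt0.
move=> u v; set t := word_dist _ u v.
have Q0 : 0 <= Q u v by rewrite sqr_ge0.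
suff h : inf (nu1_values rho tau t) <= A * Q u v.
  rewrite ler_pdivrMl ?sqrtr_gt0// /nu1.
  rewrite (_ : `|Phi u - Phi v| = Num.sqrt (Q u v)); last by rewrite sqrtr_sqr normr_id.
  by rewrite -sqrtrM ?(ltW A0)// ler_wsqrtr.
set st := tour T (cursor u) (dif u v) (cursor v).
set lc := lamp_costs S u v (dif u v).
have tle : (t <= sumn st + sumn lc)%N by exact: wreath_dist_le.
(* the tour is cut first: what remains of [t] is charged to the lamps *)
have [ss [size_ss sum_ss rho_ss]] := @trim_seq R rho rho_mono st (minn t (sumn st)) (geq_minr _ _).
have [ts [_ sum_ts tau_ts]] : exists ts, [/\ size ts = size lc, sumn ts = (t - minn t (sumn st))%N &
    \sum_(j <- ts) tau j <= \sum_(j <- lc) tau j].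
  by apply: trim_seq => //; lia.
have v_in : nu1_values rho tau t (Num.sqrt (min_split rho (minn t (sumn st))) + \sum_(j <- ts) tau j).
  by exists (minn t (sumn st), ts) => //=; rewrite sum_ts subnKC// geq_minl.
apply: le_trans ((nu1P _ _ tau0).2 _ v_in) _.
have ms : min_split rho (minn t (sumn st)) <= \sum_(j <- st) rho j.
  apply: le_trans rho_ss; apply: (min_splitP _ rho0).2.
  by exists ss => //; split; rewrite // size_ss size_tour.
(* the case apart is that of equal cursors and lamps, where [N + 1] is not [O(Q)] *)
have rho_st : \sum_(j <- st) rho j <= 2 / k * Q u v ^+ 2.
  have [/andP[/eqP cuv /eqP duv]|cuv] := boolP ((cursor u == cursor v) && (dif u v == [::])).
    rewrite /st duv /= big_seq1 cuv.
    have -> : word_dist T (cursor v) (cursor v) = 0%N.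
      apply/eqP; rewrite -leqn0 /word_dist mulVg; apply: word_length_le.
      by exists [::]; rewrite big_nil.
    by rewrite rho0 !mulr_ge0 ?invr_ge0 ?(ltW k0)// sqr_ge0.
  have one_le : 1 <= (cursor u != cursor v)%:R + (size (dif u v))%:R :> R.
    move: cuv; rewrite negb_and -size_eq0 -natrD ler1n.
    by case: (cursor u == cursor v) => //=; rewrite add0n lt0n.
  apply: (@le_trans _ _ (\sum_(j <- st) Q u v / k)).
    rewrite big_seq [leRHS]big_seq; apply: ler_sum => j /mem_tour[a [b [ain bin ->]]].
    exact: le_trans (rho_psi _ _) (psi_le ain bin).
  rewrite big_const_seq count_predT size_tour iter_addr_0 -[leLHS]mulr_natl.
  rewrite [leRHS](_ : _ = 2 * Q u v * (Q u v / k)); last by field; rewrite gt_eqF.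
  rewrite ler_wpM2r ?divr_ge0 ?(ltW k0)// -natr1.
  have := base_low u v; have := mulr_ge0 (ltW k0) (lamps_ge0 u v); have := size_le u v.
  lra.
have tau_lc : \sum_(j <- lc) tau j <= Q u v / k.
  apply: le_trans (phi_le u v); rewrite big_map; apply: ler_sum => z _; exact: tau_phi.
rewrite /A mulrDl; apply: lerD; last by rewrite mulrC (le_trans tau_ts).
apply: le_trans (ler_wsqrtr (le_trans ms rho_st)) _.
by rewrite sqrtrM ?divr_ge0 ?(ltW k0)// sqrtr_sqr ger0_norm.
Qed.

End compression.
End wreath_embedding.

Theorem theorem1p3 (R : realType) (G H : groupType) (S : set G) (T : set H)
    (infG : infinite_set [set: G]) (infH : infinite_set [set: H])
    (finS : finite_set S) (genS : generates S)
    (finT : finite_set T) (genT : generates T) :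
  (haagerup R G -> haagerup R H -> haagerup R (wreath G H)) /\
  (forall (psi : H -> L2 R) (phi : G -> L2 R)
      (rho1 rho2 tau1 tau2 : nat -> R),
    equivariant psi -> equivariant phi ->
    bounding_function rho1 -> bounding_function rho2 ->
    bounding_function tau1 -> bounding_function tau2 ->
    (forall x y : H,
      rho1 (word_dist T x y) <= `|psi x - psi y| <= rho2 (word_dist T x y)) ->
    (forall x y : G,
      tau1 (word_dist S x y) <= `|phi x - phi y| <= tau2 (word_dist S x y)) ->
    exists (Phi : wreath G H -> L2 R) (c C : R),
      [/\ equivariant Phi, 0 < c, 0 < C &
        forall u v : wreath G H,
          c * nu1 rho1 tau1 (word_dist (wreath_gens S T) u v)
            <= `|Phi u - Phi v|
            <= C * nu2 R (word_dist (wreath_gens S T) u v)]).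
Proof.
split=> [[S' [finS' genS' [phi phi_equiv phi_proper]]]
         [T' [finT' genT' [psi psi_equiv psi_proper]]]|].
  have [Phi [k [C [Phi_equiv k0 _ _ low]]]] :=
    wreath_embedding finS' genS' finT' genT' psi_equiv phi_equiv.
  exists (wreath_gens S' T'); split.
  - exact: wreath_gens_finite.
  - exact: wreath_generates.
  - by exists Phi => //; apply: (wreath_proper genS' genT' k0 low).
move=> psi phi rho1 rho2 tau1 tau2 psi_equiv phi_equiv rho1P _ tau1P _ psiP phiP.
have [Phi [k [C [Phi_equiv k0 C0 up low]]]] :=
  wreath_embedding finS genS finT genT psi_equiv phi_equiv.
have [c c0 cP] := wreath_compression genS genT k0 low rho1P tau1P
  (fun x y => proj1 (andP (psiP x y))) (fun x y => proj1 (andP (phiP x y))).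
exists Phi, c, (Num.sqrt C); split=> // [|u v]; first by rewrite sqrtr_gt0.
rewrite cP /nu2 -sqrtrM ?(ltW C0)//=.
rewrite (_ : `|Phi u - Phi v| = Num.sqrt (`|Phi u - Phi v| ^+ 2)).
  by rewrite ler_wsqrtr// up.
by rewrite sqrtr_sqr normr_id.
Qed.
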